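(* Let $a\ge-\frac12$, $\bar a\ge-\frac12$ be real, let $\xi_0:\mathbb R^d\to[a,+\infty]$ be lower semi-continuous and $\bar\xi_1:\mathbb R^d\to[-\infty,-\bar a]$ be upper semi-continuous, and assume $\mathscr P_1\xi_0\ge\bar\xi_1$. Set $\xi_t:=\mathscr P_t\xi_0$ and $\bar\xi_t:=\mathscr R_{1-t}\bar\xi_1$ for $t\in[0,1]$. Then: (1) For every $t\in[0,1]$ we have $\xi_t\ge\bar\xi_t$, and the contact set $\Xi_t:=\{x\in\mathbb R^d:\bar\xi_t(x)=\xi_t(x)\}$ is closed. (2) For every $t\in(0,1)$ and $x\in\Xi_t$ there is a unique $p=:\boldsymbol g_t(x)\in\mathbb R^d$ such that for all $y\in\mathbb R^d$ $$\xi_t(y)-\xi_t(x)-\tfrac12\Lambda_a(t)|x-y|^2\le\langle p,y-x\rangle\le\bar\xi_t(y)-\bar\xi_t(x)+\tfrac12\Lambda_{\bar a}(1-t)|x-y|^2 ;$$ in particular $\xi_t$ and $\bar\xi_t$ are differentiable at $x$ with gradient $\boldsymbol g_t(x)$. (3) For $t\in(0,1)$ the map $\boldsymbol g_t$ is bounded and $C(t)$-Lipschitz on $\Xi_t$ with $C(t)\le2(\Lambda_a(t)+\Lambda_{\bar a}(1-t))\le\frac4{t(1-t)}$. Moreover, for $t\in (0,1)$, $$\Xi_t^-:=\{\xi_0=-\tfrac12\}=\Big\{x\in\Xi_t:\xi_t(x)=\tfrac{-1}{2(1-t)}\Big\},\qquad \Xi_t^+:=\{\bar\xi_1=\tfrac12\}=\Big\{x\in\Xi_t:\bar\xi_t(x)=\tfrac1{2t}\Big\};$$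 these sets are independent of $t$ (write $\Xi^\pm$), are contained in $\Xi_t$ for every $t\in[0,1]$, and the critical set $\Xi_t^0:=\{x\in\Xi_t:\boldsymbol g_t(x)=0\}$ satisfies $\Xi_t^0\supset\Xi^-\cup\Xi^+$ for every $t\in(0,1)$. (4) Let $s\in(0,1)$, $t\in[0,1]$, $\tau:=t-s\ne0$. For every $x\in\Xi_s$ with $1+2\tau\xi_s(x)>0$ the set $\mathsf M_{s\to t}(x)$ consists of a unique element $\boldsymbol T_{s\to t}(x)$, which satisfies $$\boldsymbol T_{s\to t}(x)\in\Xi_t,\quad x\in\mathsf M_{t\to s}(\boldsymbol T_{s\to t}(x)),\quad \boldsymbol T_{s\to t}(x)=x+\boldsymbol{\arctan}\Big(\frac{\tau\boldsymbol g_s(x)}{1+2\tau\xi_s(x)}\Big),$$ $$\big(1-2\tau\xi_t(\boldsymbol T_{s\to t}(x))\big)\big(1+2\tau\xi_s(x)\big)=\cos^2\big(\min\{|x-\boldsymbol T_{s\to t}(x)|,\tfrac\pi2\}\big).$$ (5) For $x\in\Xi_s^0\supset\Xi^\pm$ we have $\boldsymbol T_{s\to t}(x)=x$ (and we define $\boldsymbol T_{s\to t}(x):=x$ for $x\in\Xi^\pm$ also for $t=0$ or $t=1$, and $\boldsymbol T_{s\to s}(x)=x$). For $s\in(0,1)$ and all $x\in\Xi_s$ the map $t\mapsto\boldsymbol T_{s\to t}(x)$ is analytic in $[0,1]$. For $s,t\in(0,1)$ the map $\boldsymbol T_{s\to t}:\Xi_s\to\mathbb R^d$ is Lipschitz.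 If $t=0$ (resp. $t=1$), then $\boldsymbol T_{s\to t}$ is locally Lipschitz in $\Xi_s\setminus\Xi^+$ (resp. in $\Xi_s\setminus\Xi^-$). (6) For $s\in(0,1)$, $x\in\Xi_s$, $\tau=t-s$, define $q_{s\to t}(x)\ge0$ by $$q_{s\to t}^2(x):=\frac{1+2\tau\xi_s(x)}{1-2\tau\xi_t(\boldsymbol T_{s\to t}(x))}=(1+2\tau\xi_s(x))^2+\tau^2|\boldsymbol g_s(x)|^2 .$$ The map $t\mapsto q_{s\to t}(x)$ is analytic in $[0,1]$, $q_{s\to t}$ is bounded and Lipschitz with respect to $x\in\Xi_s$, and $q_{s\to t}(x)>0$ for $t\in(0,1)$, or $t=0$ and $x\notin\Xi^+$ (resp. $t=1$ and $x\notin\Xi^-$). Moreover $q_{s\to t}(x)=1+2(t-s)\xi_s(x)$ for $x\in\Xi^\pm$. (7) For all $t_0,t_1\in(0,1)$ and $t_2\in[0,1]$: the maps $\boldsymbol T_{t_i\to t_j}$ with $i,j\in\{0,1\}$ are Lipschitz on $\Xi_{t_i}$, and for $x\in\Xi_{t_0}$ $$\boldsymbol T_{t_1\to t_2}(\boldsymbol T_{t_0\to t_1}(x))=\boldsymbol T_{t_0\to t_2}(x),\qquad q_{t_1\to t_2}(\boldsymbol T_{t_0\to t_1}(x))\,q_{t_0\to t_1}(x)=q_{t_0\to t_2}(x).$$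
   Context: Generalized Hopf--Lax operators: for $t\in(0,1]$, $$(\mathscr P_t\xi)(x)=\inf_{|y-x|<\pi/2}\frac1{2t}\Big(1-\frac{\cos^2(|x-y|)}{1+2t\xi(y)}\Big),\qquad \mathscr R_t\bar\xi:=-\mathscr P_t(-\bar\xi),$$ i.e. $(\mathscr R_t\bar\xi)(x)=\sup_{|y-x|<\pi/2}\frac1{2t}\big(\frac{\cos^2(|x-y|)}{1-2t\bar\xi(y)}-1\big)$, with the conventions $c/0=+\infty$ and $c/(+\infty)=0$ for $c>0$; $\mathscr P_0$ and $\mathscr R_0$ are the identity. (These satisfy $\xi_t=\mathscr P_{t-s}\xi_s$ and $\bar\xi_s=\mathscr R_{t-s}\bar\xi_t$ for $0\le s<t\le1$.) $\Lambda_a(t):=\dfrac1{t(1+2at)}$; $\boldsymbol{\arctan}(w)=\arctan(|w|)\frac{w}{|w|}$ for $w\in\mathbb R^d\setminus\{0\}$ and $\boldsymbol{\arctan}(0)=0$. For $s\ne t$ in $[0,1]$, $\mathsf M_{s\to t}(x)$ denotes: if $t<s$, the set of minimizers $y$ in the formula for $\xi_s(x)=(\mathscr P_{s-t}\xi_t)(x)$; if $t>s$, the set of maximizers $y$ in the formula for $\bar\xi_s(x)=(\mathscr R_{t-s}\bar\xi_t)(x)$. The first quotient in the definition of $q_{s\to t}^2$ in (6) is meant wherever it makes sense (with $0/\infty=0$); the second expression is always defined.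
   Formalization: In (1), Ξ_t closed is claimed only for t in (0,1), since it can fail at t=0,1; instead closure(Ξ_0) ⊂ Ξ_0 ∪ {x: |x-y|=π/2 for some y in Ξ^+} and closure(Ξ_1) ⊂ Ξ_1 ∪ {x: |x-y|=π/2 for some y in Ξ^-}, giving closedness when Ξ^+ (resp. Ξ^-) is empty. *)

(* Defs.v *)
From HB Require Import structures.
From mathcomp Require Import all_boot all_order all_algebra.
From mathcomp Require Import all_classical all_reals all_analysis.

Set Implicit Arguments.
Unset Strict Implicit.
Unset Printing Implicit Defensive.

Import Order.TTheory GRing.Theory Num.Theory.
Import numFieldNormedType.Exports.

Local Open Scope classical_set_scope.
Local Open Scope ring_scope.

(* R^d is 'rV[R]_d: its library topology is the Euclidean one, but its library
   norm is the sup norm, so every quantitative notion below goes through enorm. *)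
Section Euclidean.
Context {R : realType} {d : nat}.
Implicit Types (u v w x y p : 'rV[R]_d) (A : set 'rV[R]_d).

Definition dotv u v : R := \sum_(i < d) u 0 i * v 0 i.

Definition enorm u : R := Num.sqrt (dotv u u).

(* Equals 0 at w = 0, since scaling the zero vector gives 0. *)
Definition arctanv w : 'rV[R]_d := (atan (enorm w) / enorm w) *: w.

(* [nW] is the norm of the codomain: [enorm] on R^d, [Num.norm] on R. *)
Definition elipschitz (W : zmodType) (nW : W -> R) (C : R) A
    (f : 'rV[R]_d -> W) : Prop :=
  forall x y, A x -> A y -> nW (f x - f y) <= C * enorm (x - y).

Definition locally_elipschitz (W : zmodType) (nW : W -> R) A
    (f : 'rV[R]_d -> W) : Prop :=
  forall x, A x ->
    exists2 U, nbhs x U & exists C, elipschitz nW C (A `&` U) f.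

(* Differentiability at a point of an extended-real valued function requires
   finiteness around that point; [fine] is then the underlying real value. *)
Definition has_gradient (f : 'rV[R]_d -> \bar R) x p : Prop :=
  (\forall y \near x, f y \is a fin_num) /\
  is_diff x (fun y => fine (f y)) (dotv p).

Definition upper_semicontinuous (f : 'rV[R]_d -> \bar R) : Prop :=
  forall x (b : R), (f x < b%:E)%E ->
    exists2 U, nbhs x U & forall y, U y -> (f y < b%:E)%E.

End Euclidean.

(* Around each point of A, f agrees on A with a convergent power series. At an
   end point of an interval this amounts to an analytic extension beyond it. *)
Definition analytic_on {R : realType} {W : normedModType R}
    (A : set R) (f : R -> W) : Prop :=
  forall t0, A t0 -> exists2 r : R, 0 < r & exists c : nat -> W,
    forall t, A t -> `|t - t0| < r ->
      series (fun n => (t - t0) ^+ n *: c n) @ \oo --> f t.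

Section HopfLax.
Context {R : realType} {d : nat}.
Implicit Types (t : R) (x y : 'rV[R]_d) (f : 'rV[R]_d -> \bar R).
Local Open Scope ereal_scope.

Definition hl_ball x : set 'rV[R]_d := [set y | (enorm (y - x) < pi / 2)%R].

(* In \bar R the library has 0^-1 = +oo and +oo^-1 = 0, hence c / 0 = +oo for
   c > 0 and c / +oo = 0. *)
Definition hl_inf_cost t f x y : \bar R :=
  ((2 * t)^-1)%:E *
    (1 - (cos (enorm (x - y)) ^+ 2)%:E / (1 + (2 * t)%:E * f y)).

Definition hl_sup_cost t f x y : \bar R :=
  ((2 * t)^-1)%:E *
    ((cos (enorm (x - y)) ^+ 2)%:E / (1 - (2 * t)%:E * f y) - 1).

Definition hl_inf t f x : \bar R :=
  if t == 0%R then f x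
  else ereal_inf [set hl_inf_cost t f x y | y in hl_ball x].

Definition hl_sup t f x : \bar R := - hl_inf t (fun y => - f y) x.

End HopfLax.

Definition Lambda {R : realType} (a t : R) : R := (t * (1 + 2 * a * t))^-1.

Section Contact.
Context {R : realType} {d : nat}.
Variables (a abar : R) (xi xibar : R -> 'rV[R]_d -> \bar R).
Implicit Types (s t : R) (x y p : 'rV[R]_d).

Definition contact t : set 'rV[R]_d := [set x | xibar t x = xi t x].

Definition contact_slope t x p : Prop :=
  forall y,
    (xi t y - xi t x - (2^-1 * Lambda a t * enorm (x - y) ^+ 2)%:E
       <= (dotv p (y - x))%:E)%E /\
    ((dotv p (y - x))%:E
       <= xibar t y - xibar t x
          + (2^-1 * Lambda abar (1 - t) * enorm (x - y) ^+ 2)%:E)%E.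

Definition contact_grad t x : 'rV[R]_d := xget 0 (contact_slope t x).

Definition critical t : set 'rV[R]_d :=
  [set x | contact t x /\ contact_grad t x = 0].

Definition optimal s t x : set 'rV[R]_d :=
  if t < s then
    [set y | hl_ball x y /\ forall z, hl_ball x z ->
       (hl_inf_cost (s - t) (xi t) x y <= hl_inf_cost (s - t) (xi t) x z)%E]
  else
    [set y | hl_ball x y /\ forall z, hl_ball x z ->
       (hl_sup_cost (t - s) (xibar t) x z
          <= hl_sup_cost (t - s) (xibar t) x y)%E].

(* For s in ]0, 1[ and x in the contact set, 1 + 2 (t - s) xi_s(x) >= 0, with
   equality only if t = 0 and xibar_1(x) = 1/2, or t = 1 and xi_0(x) = -1/2;
   so the last branch is the convention for these two sets at the end times.
   The set [optimal s t x] need not be a singleton there. *)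
Definition transport s t x : 'rV[R]_d :=
  if t == s then x
  else if (0 < 1 + (2 * (t - s))%:E * xi s x)%E then xget x (optimal s t x)
  else x.

(* xi_s is real-valued for s in ]0, 1[. *)
Definition growth s t x : R :=
  Num.sqrt ((1 + 2 * (t - s) * fine (xi s x)) ^+ 2
            + (t - s) ^+ 2 * enorm (contact_grad s x) ^+ 2).

End Contact.

(* Main.v *)
Require Import Defs.
From HB Require Import structures.
From mathcomp Require Import all_boot all_order all_algebra.
From mathcomp Require Import all_classical all_reals all_analysis.
From mathcomp Require Import ring lra.

(* Write h = - xibar_1, so that xibar_t = - P_(1-t) h and the whole situation is
   symmetric under (xi_0, h, t) <-> (h, xi_0, 1 - t). For t < s the potentials are
   coupled by cos^2 |x - y| <= (1 - 2 (s-t) xi_s(x)) (1 + 2 (s-t) xi_t(y)); this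
   and the order xibar_t <= xi_t both come from a single trigonometric inequality
   expressing the triangle inequality of the cone over R^d. At a contact point xi_s
   is touched from above by the semiconcave cost and from below by the semiconvex one, so both have the same slope g_s(x), and the
   minimizer y is read off from the gradient of the cost at x. Its existence for
   0 < t is obtained by following the cone geodesic from x to a minimizer of
   P_s xi_0. All the statements on T and q then follow from the formula
   T_(s->t)(x) = x + arctan (tau g / (1 + 2 tau xi_s(x))). *)

Set Implicit Arguments.
Unset Strict Implicit.
Unset Printing Implicit Defensive.

Import Order.TTheory GRing.Theory Num.Theory.
Import numFieldNormedType.Exports.

Local Open Scope classical_set_scope.
Local Open Scope ring_scope.

(** The quotients in P_t degenerate where a denominator is 0 or infinite, and the competitors range
    over an open ball. Clearing denominators removes both difficulties: with the cosine truncated at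
    pi/2, a lower bound on P_t f(x) becomes a bound of cos^2 by a product of two factors, trivial
    outside the ball. For 0 < t < 1 the bound f >= -1/2 gives 1 + 2 t f >= 1 - t > 0, so the
    potentials are finite, and minimizers exist as soon as P_t f(x) < 1/(2t); the maximal value
    1/(2t) is treated apart each time. The semigroup law is replaced by two facts: the coupling
    inequality between intermediate times, and one explicit point where it is an equality. The
    factor 1 + 2 tau xi_s(x) is affine in t and nonnegative on [0, 1]. It can vanish only at t = 0
    or t = 1, and then x lies in Xi^+ or Xi^-, where g_s(x) = 0 and the transport is constant; this
    is why the formulas persist up to the end times. Closedness of the contact set is more delicate
    there: P_1 f may fail to be lower semicontinuous at distance exactly pi/2 from a point where f =
    -1/2. *)

Section EuclideanGeometry.
Context {R : realType} {d : nat}.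
Implicit Types (u v w x y z : 'rV[R]_d) (k : R).

Lemma dotvC u v : dotv u v = dotv v u.
Proof. by apply: eq_bigr => i _; rewrite mulrC. Qed.

Lemma dotvDl u v w : dotv (u + v) w = dotv u w + dotv v w.
Proof. by rewrite -big_split; apply: eq_bigr => i _; rewrite mxE mulrDl. Qed.

Lemma dotvZl k u v : dotv (k *: u) v = k * dotv u v.
Proof. by rewrite mulr_sumr; apply: eq_bigr => i _; rewrite mxE mulrA. Qed.

Lemma dotvDr u v w : dotv w (u + v) = dotv w u + dotv w v.
Proof. by rewrite !(dotvC w) dotvDl. Qed.

Lemma dotvZr k u v : dotv u (k *: v) = k * dotv u v.
Proof. by rewrite !(dotvC u) dotvZl. Qed.

Lemma dotvNl u v : dotv (- u) v = - dotv u v.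
Proof. by rewrite -scaleN1r dotvZl mulN1r. Qed.

Lemma dotvNr u v : dotv u (- v) = - dotv u v.
Proof. by rewrite !(dotvC u) dotvNl. Qed.

Definition dotvE := (dotvDl, dotvDr, dotvNl, dotvNr, dotvZl, dotvZr).

Lemma dotv0l u : dotv 0 u = 0.
Proof. by rewrite -(scale0r u) dotvZl mul0r. Qed.

Lemma dotv_ge0 u : 0 <= dotv u u.
Proof. by apply: sumr_ge0 => i _; rewrite -expr2 sqr_ge0. Qed.

Lemma enorm_ge0 u : 0 <= enorm u.
Proof. exact: sqrtr_ge0. Qed.

Lemma sqr_enorm u : enorm u ^+ 2 = dotv u u.
Proof. by rewrite sqr_sqrtr// dotv_ge0. Qed.

Lemma enormZ k u : enorm (k *: u) = `|k| * enorm u.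
Proof.
by rewrite /enorm dotvZl dotvZr mulrA -expr2 sqrtrM ?sqr_ge0// sqrtr_sqr.
Qed.

Lemma enorm0 : enorm (0 : 'rV[R]_d) = 0.
Proof. by rewrite /enorm dotv0l sqrtr0. Qed.

Lemma enormN u : enorm (- u) = enorm u.
Proof. by rewrite -scaleN1r enormZ normrN1 mul1r. Qed.

Lemma enormB u v : enorm (u - v) = enorm (v - u).
Proof. by rewrite -opprB enormN. Qed.

Lemma enorm_eq0 u : enorm u = 0 -> u = 0.
Proof.
move=> u0; apply/rowP => i; rewrite mxE; apply/eqP; rewrite -sqrf_eq0 expr2.
have /eqP : dotv u u = 0 by rewrite -sqr_enorm u0 expr0n.
rewrite psumr_eq0; last by move=> j _; rewrite -expr2 sqr_ge0.
by move/allP/(_ i); rewrite mem_index_enum => /(_ isT).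
Qed.

Lemma enorm_gt0 u : u != 0 -> 0 < enorm u.
Proof.
move=> u0; rewrite lt_neqAle enorm_ge0 andbT eq_sym.
by apply: contra u0 => /eqP/enorm_eq0/eqP.
Qed.

(** Cauchy-Schwarz, by expanding the square of [enorm v *: u - enorm u *: v]. *)
Lemma dotv_le_enorm u v : dotv u v <= enorm u * enorm v.
Proof.
have [->|/enorm_gt0 u0] := eqVneq u 0; first by rewrite dotv0l enorm0 mul0r.
have [->|/enorm_gt0 v0] := eqVneq v 0.
  by rewrite dotvC dotv0l enorm0 mulr0.
have := dotv_ge0 (enorm v *: u - enorm u *: v).
rewrite !dotvE (dotvC v u) -!sqr_enorm => h.
rewrite -(ler_pM2l (mulr_gt0 u0 v0)); nra.
Qed.

Lemma ler_enormD u v : enorm (u + v) <= enorm u + enorm v.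
Proof.
rewrite -(@ler_pXn2r _ 2) ?nnegrE ?addr_ge0 ?enorm_ge0//.
rewrite sqr_enorm !dotvE (dotvC v u).
by have := dotv_le_enorm u v; have := sqr_enorm u; have := sqr_enorm v; nra.
Qed.

Lemma ler_enorm_dist x y z : enorm (x - z) <= enorm (x - y) + enorm (y - z).
Proof. by rewrite -{1}(subrKA y) ler_enormD. Qed.

Lemma ler_dist_enorm u v : `|enorm u - enorm v| <= enorm (u - v).
Proof.
have := ler_enorm_dist u v 0; have := ler_enorm_dist v u 0.
by rewrite !subr0 (enormB v u) ler_norml => *; lra.
Qed.

Lemma normr_dotv_le u v : `|dotv u v| <= enorm u * enorm v.
Proof.
rewrite ler_norml dotv_le_enorm andbT lerNl -dotvNl -(enormN u).
exact: dotv_le_enorm.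
Qed.

Lemma coord_le_enorm u (i : 'I_d) : `|u 0 i| <= enorm u.
Proof.
rewrite -sqrtr_sqr ler_wsqrtr// /dotv (bigD1 i)//= -expr2 lerDl.
by apply: sumr_ge0 => j _; rewrite -expr2 sqr_ge0.
Qed.

Lemma mx_norm_le_enorm u : `|u| <= enorm u.
Proof.
rewrite /Num.norm/= mx_normrE; apply/bigmax_leP; split; first exact: enorm_ge0.
by move=> [i j] _ /=; rewrite ord1 coord_le_enorm.
Qed.

Lemma coord_le_mx_norm u (i : 'I_d) : `|u 0 i| <= `|u|.
Proof.
rewrite [leRHS]/Num.norm/= mx_normrE.
by apply/bigmax_geP; right; exists (0, i).
Qed.

Lemma enorm_le_mx_norm u : enorm u <= d%:R * `|u|.
Proof.
have h : enorm u ^+ 2 <= (d%:R * `|u|) ^+ 2.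
  rewrite sqr_enorm; apply: (@le_trans _ _ (\sum_(i < d) `|u| ^+ 2)).
    apply: ler_sum => i _; rewrite -expr2 -(real_normK (num_real (u 0 i))).
    by rewrite lerXn2r ?nnegrE// coord_le_mx_norm.
  rewrite sumr_const card_ord -[leLHS]mulr_natl exprMn ler_wpM2r ?sqr_ge0//.
  by rewrite -natrX ler_nat; case: (d) => // n; rewrite -mulnn leq_pmull.
by rewrite -(@ler_pXn2r _ 2) ?nnegrE ?mulr_ge0 ?enorm_ge0.
Qed.

Lemma near_enorm x (e : R) : 0 < e -> \forall y \near x, enorm (x - y) < e.
Proof.
(* Dividing by [d.+1] instead of [d] also covers d = 0. *)
move=> e0; have e1 : 0 < e / d.+1%:R by rewrite divr_gt0.
apply: filterS (nbhsx_ballx x _ e1) => y.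
rewrite -ball_normE/= => h; apply: le_lt_trans (enorm_le_mx_norm _) _.
apply: le_lt_trans (_ : d%:R * (e / d.+1%:R) < _).
  by rewrite ler_wpM2l// ltW.
by rewrite mulrCA gtr_pMr// ltr_pdivrMr// mul1r ltr_nat.
Qed.

End EuclideanGeometry.

(** * Mean value estimates for sine, cosine and arctangent *)

Section RealAnalysis.
Context {R : realType}.
Implicit Types (x y h t : R) (f df : R -> R).

(** Running along the segment by a parameter in [0, 1] avoids a case split on the sign of h. *)
Lemma mvt_segment f df x h :
  (forall t, 0 <= t <= 1 -> is_derive (x + t * h) 1 f (df (x + t * h))) ->
  exists2 t, 0 <= t <= 1 & f (x + h) - f x = df (x + t * h) * h.
Proof.
move=> fdf; pose g t := f (x + t * h).
have gd t : 0 <= t <= 1 -> is_derive t 1 g (df (x + t * h) * h).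
  move=> /fdf dt; apply: is_derive1_comp.
  by apply: is_derive_eq; rewrite /GRing.scale/=; ring.
have [||c c01 e] := @MVT_segment R g (fun t => df (x + t * h) * h) 0 1 ler01.
- by move=> t /itvP t01; apply: gd; rewrite !t01.
- apply: derivable_within_continuous => t /itvP t01.
  by have [|//] := gd t; rewrite !t01.
exists c; first by rewrite !(itvP c01).
by move: e; rewrite /g mul1r mul0r addr0 subr0 mulr1.
Qed.

Lemma sin_lipschitz x h : `|sin (x + h) - sin x| <= `|h|.
Proof.
have [t _ ->] := @mvt_segment sin cos x h (fun t _ => is_derive_sin _).
by rewrite normrM ler_piMl// cos_max.
Qed.

Lemma atan_lipschitz x y : `|atan y - atan x| <= `|y - x|.
Proof.
have [t _] := @mvt_segment atan (fun u => (1 + u ^+ 2)^-1) x (y - x)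
  (fun t _ => is_derive1_atan _).
rewrite [x + (y - x)]addrC subrK => ->; rewrite normrM ler_piMl//.
rewrite ger0_norm ?invr_ge0 ?addr_ge0 ?sqr_ge0//.
by rewrite invf_le1 ?lerDl ?sqr_ge0// ltr_pwDl// sqr_ge0.
Qed.

Lemma atan_ge0 x : 0 <= x -> 0 <= atan x.
Proof. by move=> /le_atan; rewrite atan0. Qed.

Lemma atan_le x : 0 <= x -> atan x <= x.
Proof.
move=> x0; have := atan_lipschitz 0 x.
by rewrite atan0 !subr0 !ger0_norm ?atan_ge0.
Qed.

(** The function cos u + (u - x) sin x + (u - x)^2 / 2 has derivative sin x - sin u + (u - x), which
    has the sign of u - x because sin is 1-Lipschitz; so it is minimal at u = x. *)
Lemma cos_taylor2 x h : cos x - h * sin x - h ^+ 2 / 2 <= cos (x + h).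
Proof.
pose f u := cos u + (u - x) * sin x + (u - x) ^+ 2 / 2.
have [|t /andP[t0 _]] := @mvt_segment f (fun u => - sin u + sin x + (u - x)) x h.
  move=> t _; rewrite /f.
  apply: is_derive_eq; rewrite /GRing.scale/=; lra.
rewrite /f subrr mul0r expr0n/= mul0r !addr0.
rewrite -[x + h - x]addrAC subrr add0r -[x + t * h - x]addrAC subrr add0r.
suff: 0 <= (- sin (x + t * h) + sin x + t * h) * h by lra.
have := sin_lipschitz x (t * h); rewrite ler_norml => /andP[l1 l2].
have [h0|h0] := leP 0 h.
  by apply: mulr_ge0 => //; rewrite ger0_norm ?mulr_ge0// in l1 l2; lra.
apply: mulr_le0; last exact: ltW.
by rewrite ler0_norm in l1 l2; [lra|rewrite mulr_ge0_le0// ltW].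
Qed.

End RealAnalysis.

(** * The squared cosine truncated at pi/2, and the vector arctangent *)

Section TruncatedCosine.
Context {R : realType} {d : nat}.
Implicit Types (u v w x y z : 'rV[R]_d) (k l P D : R).

(** The truncation encodes the constraint [hl_ball]: outside the open ball the value is 0, so an
    upper bound by a nonnegative product holds there for free. *)
Definition cos2_trunc x y : R := cos (Num.min (enorm (x - y)) (pi / 2)) ^+ 2.

Lemma pihalf_gt0 : 0 < pi / 2 :> R.
Proof. by rewrite divr_gt0// pi_gt0. Qed.

Lemma cos2_truncC x y : cos2_trunc x y = cos2_trunc y x.
Proof. by rewrite /cos2_trunc enormB. Qed.

Lemma cos2_trunc_ge0 x y : 0 <= cos2_trunc x y.
Proof. exact: sqr_ge0. Qed.

Lemma cos2_trunc_le1 x y : cos2_trunc x y <= 1.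
Proof. by rewrite /cos2_trunc -real_normK ?num_real// expr_le1 ?cos_max. Qed.

Lemma cos2_trunc_in x y : enorm (x - y) < pi / 2 ->
  cos2_trunc x y = cos (enorm (x - y)) ^+ 2.
Proof. by move=> h; rewrite /cos2_trunc min_l// ltW. Qed.

Lemma cos2_trunc_out x y : pi / 2 <= enorm (x - y) -> cos2_trunc x y = 0.
Proof. by move=> h; rewrite /cos2_trunc min_r// cos_pihalf expr0n. Qed.

Lemma cos_enorm_gt0 u : enorm u < pi / 2 -> 0 < cos (enorm u).
Proof.
move=> h; apply: cos_gt0_pihalf; rewrite h andbT.
by rewrite (lt_le_trans _ (enorm_ge0 _))// oppr_lt0 pihalf_gt0.
Qed.

Lemma cos2_trunc_gt0 x y : enorm (x - y) < pi / 2 -> 0 < cos2_trunc x y.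
Proof. by move=> h; rewrite cos2_trunc_in// exprn_gt0// cos_enorm_gt0. Qed.

Lemma cos2_trunc_gt0_in x y : 0 < cos2_trunc x y -> enorm (x - y) < pi / 2.
Proof. by rewrite !ltNge; apply: contra => /cos2_trunc_out->. Qed.

Lemma cos2_truncxx x : cos2_trunc x x = 1.
Proof. by rewrite cos2_trunc_in subrr enorm0 ?cos0 ?expr1n ?pihalf_gt0. Qed.

Lemma cos2_trunc_eq1 x y : cos2_trunc x y = 1 -> x = y.
Proof.
move=> h; have h1 : enorm (x - y) < pi / 2.
  by apply: cos2_trunc_gt0_in; rewrite h.
move: h; rewrite cos2_trunc_in// => h.
have c1 : cos (enorm (x - y)) = 1.
  by have := cos_enorm_gt0 h1; nra.
have : enorm (x - y) = 0.
  apply: cos_inj; rewrite ?cos0// in_itv/= ?lexx ?pi_ge0// enorm_ge0/=.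
  by have := pihalf_gt0; move: h1; rewrite /=; lra.
by move/enorm_eq0/eqP; rewrite subr_eq0 => /eqP.
Qed.

(* With p = sqrt P and q = sqrt D the difference of the two sides is
   l (1-l) ((pq + s1 s2)^2 - (c1 c2)^2) + ((1-l) p s2 - l q s1)^2, where
   pq >= cos (th1 + th2) = c1 c2 - s1 s2. *)
Lemma cos2_trunc_triangle l P D x y z : 0 < l < 1 -> 0 <= P -> 0 <= D ->
  cos2_trunc x z <= P * D ->
  l * cos2_trunc x y * (1 - l + l * D)
    + (1 - l) * cos2_trunc y z * (l + (1 - l) * P)
  <= (l + (1 - l) * P) * (1 - l + l * D).
Proof.
move=> /andP[l0 l1] P0 D0; rewrite /cos2_trunc.
set a := Num.min _ _; set b := Num.min (enorm (x - y)) _.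
set c := Num.min (enorm (y - z)) _ => hPD.
have pi0 := @pihalf_gt0.
have mn u : 0 <= Num.min (enorm u) (pi / 2) <= pi / 2.
  by rewrite le_min enorm_ge0 ltW//= ge_min lexx orbT.
have /andP[a0 a1] := mn (x - z); have /andP[b0 b1] := mn (x - y).
have /andP[c0 c1] := mn (y - z).
rewrite -/a -/b -/c in a0 a1 b0 b1 c0 c1.
have abc : a <= b + c.
  rewrite /a /b /c; have := ler_enorm_dist x y z.
  have := enorm_ge0 (x - y); have := enorm_ge0 (y - z).
  move: pi0.
  case: (leP (enorm (x - z)) (pi / 2)); case: (leP (enorm (x - y)) (pi / 2));
  case: (leP (enorm (y - z)) (pi / 2)); rewrite /=; lra.
have cos0_ (t : R) : 0 <= t -> t <= pi / 2 -> 0 <= cos t.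
  by move=> t0 t1; apply: cos_ge0_pihalf; rewrite t1 andbT; lra.
have sin0_ (t : R) : 0 <= t -> t <= pi / 2 -> 0 <= sin t.
  by move=> t0 t1; apply: sin_ge0_pi; rewrite t0/=; lra.
pose p : R := Num.sqrt P; pose q : R := Num.sqrt D.
have p0 : 0 <= p := sqrtr_ge0 _; have q0 : 0 <= q := sqrtr_ge0 _.
have pP : P = p ^+ 2 by rewrite sqr_sqrtr.
have qD : D = q ^+ 2 by rewrite sqr_sqrtr.
have pq : cos b * cos c - sin b * sin c <= p * q.
  rewrite -cosD; apply: (@le_trans _ _ (cos a)).
    rewrite leNgt ltr_cos ?in_itv/= -?leNgt//; first by apply/andP; lra.
    by apply/andP; lra.
  have ca0 : 0 <= cos a by exact: cos0_.
  rewrite -(@ler_pXn2r _ 2) ?nnegrE ?mulr_ge0//.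
  by rewrite exprMn -pP -qD.
have := sin2cos2 b; have := sin2cos2 c.
have := cos0_ _ b0 b1; have := cos0_ _ c0 c1.
have := sin0_ _ b0 b1; have := sin0_ _ c0 c1.
move: pq; rewrite pP qD.
move: (cos b) (cos c) (sin b) (sin c) => cb cc sb sc pq sc0 sb0 cc0 cb0 e1 e2.
have k1 : 0 <= (p * q + sb * sc) ^+ 2 - (cb * cc) ^+ 2.
  rewrite subr_ge0 lerXn2r ?nnegrE ?mulr_ge0 ?addr_ge0 ?mulr_ge0//; lra.
have k2 : 0 <= l * (1 - l) by nra.
have k3 := mulr_ge0 k2 k1.
have k4 := sqr_ge0 ((1 - l) * p * sc - l * q * sb).
rewrite -subr_ge0.
suff -> : (l + (1 - l) * p ^+ 2) * (1 - l + l * q ^+ 2) -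
   (l * cb ^+ 2 * (1 - l + l * q ^+ 2) + (1 - l) * cc ^+ 2 * (l + (1 - l) * p ^+ 2))
  = l * (1 - l) * ((p * q + sb * sc) ^+ 2 - (cb * cc) ^+ 2)
    + ((1 - l) * p * sc - l * q * sb) ^+ 2 by lra.
have -> : cb ^+ 2 = 1 - sb ^+ 2 by rewrite e2; ring.
have -> : cc ^+ 2 = 1 - sc ^+ 2 by rewrite e1; ring.
have -> : (cb * cc) ^+ 2 = (1 - sb ^+ 2) * (1 - sc ^+ 2).
  by rewrite e1 e2; ring.
ring.
Qed.

(** Radially, cos^2 has second derivative at least -2. Passing from radii to vectors costs nothing
    more because sin th cos th / th <= 1; at th = 0 the quotient multiplies x - y = 0. *)
Lemma cos2_trunc_semiconcave x x' y : enorm (x - y) < pi / 2 ->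
  cos2_trunc x y - cos2_trunc x' y <=
    2 * (sin (enorm (x - y)) * cos (enorm (x - y)) / enorm (x - y))
      * dotv (x - y) (x' - x) + enorm (x' - x) ^+ 2.
Proof.
move=> h; set th := enorm (x - y); set r := enorm (x' - y).
have th0 : 0 <= th := enorm_ge0 _; have r0 : 0 <= r := enorm_ge0 _.
have s0 : 0 <= sin th.
  by apply: sin_ge0_pi; rewrite th0/=; have := @pihalf_gt0; rewrite -/th in h; lra.
have c0 : 0 <= cos th by rewrite ltW// cos_enorm_gt0.
have sc0 := mulr_ge0 s0 c0.
have key : cos th ^+ 2 - cos2_trunc x' y
    <= 2 * (sin th * cos th) * (r - th) + (r - th) ^+ 2.
  (* This is [cos_taylor2] at doubled angles, as cos^2 u = (1 + cos 2u) / 2. *)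
  have tay m : cos th ^+ 2 - cos m ^+ 2
      <= 2 * (sin th * cos th) * (m - th) + (m - th) ^+ 2.
    have := cos_taylor2 (th *+ 2) ((m - th) *+ 2).
    have -> : th *+ 2 + (m - th) *+ 2 = m *+ 2 by ring.
    by rewrite !cos_mulr2n sin_mulr2n; lra.
  have [rlt|rge] := ltP r (pi / 2); first by rewrite cos2_trunc_in.
  (* Beyond pi/2 the truncated value is that at m = pi/2, and the right-hand side increases for m >=
     th. *)
  rewrite cos2_trunc_out//; have := tay (pi / 2); rewrite cos_pihalf.
  move: h; rewrite -/th => h; nra.
rewrite cos2_trunc_in// -/th; apply: le_trans key _.
have e : enorm (x' - x) ^+ 2 = r ^+ 2 + th ^+ 2 - 2 * dotv (x - y) (x' - y).
  have -> : x' - x = (x' - y) - (x - y) by rewrite opprB addrA subrK.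
  by rewrite /r /th !sqr_enorm !dotvE (dotvC x' x) (dotvC x' y) (dotvC x y); ring.
have e2 : dotv (x - y) (x' - x) = dotv (x - y) (x' - y) - th ^+ 2.
  have -> : x' - x = (x' - y) - (x - y) by rewrite opprB addrA subrK.
  by rewrite dotvDr dotvNr -sqr_enorm.
rewrite e e2; set D := dotv (x - y) (x' - y).
have hD : D <= th * r := dotv_le_enorm _ _.
have [t0|tn0] := eqVneq th 0.
  rewrite t0 sin0 in hD *.
  rewrite !mul0r mulr0 !mul0r add0r; lra.
have tp : 0 < th by rewrite lt_neqAle eq_sym tn0.
have sle : sin th * cos th <= th.
  have : sin th <= th.
    by have := sin_lipschitz 0 th; rewrite add0r sin0 subr0 !ger0_norm.
  have := cos_le1 th; nra.
set k := sin th * cos th / th.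
have k1 : k <= 1 by rewrite ler_pdivrMr// mul1r.
have ek : sin th * cos th = k * th by rewrite divfK.
(* The difference of the two sides is 2 (1 - k) (th r - D), nonnegative by Cauchy-Schwarz. *)
rewrite ek; nra.
Qed.

(** At k = 0 the value is 0 instead of the limit 1; this is harmless, as only products with k and
    the bounds by 0 and 1 enter. *)
Definition radial k : R := atan k / k.

Lemma radialK k : radial k * k = atan k.
Proof.
rewrite /radial; have [->|k0] := eqVneq k 0; first by rewrite mulr0 atan0.
by rewrite divfK.
Qed.

Lemma radial_bounds k : 0 <= k -> 0 <= radial k <= 1.
Proof.
move=> k0; rewrite /radial divr_ge0 ?atan_ge0//=.
have [->|kn0] := eqVneq k 0; first by rewrite invr0 mulr0 ler01.
by rewrite ler_pdivrMr ?mul1r ?atan_le// lt_neqAle eq_sym kn0.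
Qed.

Lemma arctanvN w : arctanv (- w) = - arctanv w.
Proof. by rewrite /arctanv enormN scalerN. Qed.

Lemma arctanv0 : arctanv (0 : 'rV[R]_d) = 0.
Proof. by rewrite /arctanv scaler0. Qed.

Lemma enorm_arctanv w : enorm (arctanv w) = atan (enorm w).
Proof.
rewrite /arctanv enormZ -/(radial _) ger0_norm ?radialK//.
by have /andP[] := radial_bounds (enorm_ge0 w).
Qed.

(** Inverts the vector arctangent on the ball of radius pi/2; this is how the minimizer is recovered
    from the gradient of the cost. *)
Lemma arctanv_tan u : enorm u < pi / 2 ->
  arctanv ((tan (enorm u) / enorm u) *: u) = u.
Proof.
have [->|u0] := eqVneq u 0; first by rewrite scaler0 arctanv0.
move=> h; have n0 := enorm_gt0 u0.
have t0 : 0 <= tan (enorm u).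
  rewrite /tan divr_ge0//; last exact/ltW/cos_enorm_gt0.
  by apply: sin_ge0_pi; rewrite enorm_ge0/=; have := @pihalf_gt0; lra.
have t1 : enorm ((tan (enorm u) / enorm u) *: u) = tan (enorm u).
  by rewrite enormZ ger0_norm ?divfK ?gt_eqF// divr_ge0// enorm_ge0.
rewrite /arctanv t1 tanK; last first.
  by rewrite in_itv/= h andbT; have := @pihalf_gt0; lra.
have tn0 : tan (enorm u) != 0.
  rewrite /tan mulf_neq0 ?invr_eq0 ?gt_eqF ?cos_enorm_gt0//.
  by apply: sin_gt0_pi; rewrite n0/=; have := @pihalf_gt0; lra.
rewrite scalerA [X in X *: _](_ : _ = 1) ?scale1r//; field.
by rewrite tn0 gt_eqF.
Qed.

(* Off the diagonal direction the factor [radial] is at most 1; along it the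
   map is [atan], which is 1-Lipschitz. *)
Lemma arctanv_lipschitz u v : enorm (arctanv u - arctanv v) <= 2 * enorm (u - v).
Proof.
wlog uv : u v / enorm u <= enorm v.
  move=> H; have [/H//|/ltW/H] := leP (enorm u) (enorm v).
  by rewrite enormB (enormB v).
have -> : arctanv u - arctanv v = radial (enorm v) *: (u - v)
    + (radial (enorm u) - radial (enorm v)) *: u.
  by rewrite /arctanv -!/(radial _); apply/rowP => i; rewrite !mxE; ring.
have /andP[r0 r1] := radial_bounds (enorm_ge0 v).
apply: le_trans (ler_enormD _ _) _; rewrite mulr_natl mulr2n !enormZ lerD//.
  by rewrite ger0_norm// ler_piMl ?enorm_ge0.
apply: le_trans (_ : `|enorm v - enorm u| <= _); last first.
  by rewrite (enormB u) ler_dist_enorm.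
rewrite -[X in _ * X](ger0_norm (enorm_ge0 u)) -normrM mulrBl radialK.
have lip := atan_lipschitz (enorm u) (enorm v).
have av := radialK (enorm v); have auv := le_atan uv; have u0 := enorm_ge0 u.
rewrite ![`|_ - _|]ger0_norm ?subr_ge0// in lip.
rewrite [X in _ <= X]ger0_norm ?subr_ge0// ler_norml; apply/andP; split; nra.
Qed.

End TruncatedCosine.

(** * The Hopf-Lax infimum: bounds, lower semicontinuity, attainment *)

Section HopfLaxOperator.
Context {R : realType} {d : nat}.
Implicit Types (x y z : 'rV[R]_d) (t s r p b c m : R).
Variable f : 'rV[R]_d -> \bar R.
Hypothesis f_ge : forall x, ((- 2^-1)%:E <= f x)%E.

Lemma f_cases x : f x = +oo%E \/ exists2 r, f x = r%:E & - 2^-1 <= r.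
Proof.
have := f_ge x; case: (f x) => [r|_|//]; last by left.
by rewrite lee_fin => ?; right; exists r.
Qed.

Lemma hl_inf_costE t x y r : f y = r%:E -> 0 < 1 + 2 * t * r ->
  hl_inf_cost t f x y
  = ((2 * t)^-1 * (1 - cos (enorm (x - y)) ^+ 2 / (1 + 2 * t * r)))%:E.
Proof.
by move=> fy h; rewrite /hl_inf_cost fy -EFinM -EFinD inver gt_eqF.
Qed.

Lemma hl_inf_cost_pinfty t x y : 0 < t -> f y = +oo%E ->
  hl_inf_cost t f x y = ((2 * t)^-1)%:E.
Proof.
move=> t0 fy; rewrite /hl_inf_cost fy gt0_muley ?lte_fin ?mulr_gt0//.
by rewrite addey// invey mule0 sube0 mule1.
Qed.

Lemma hl_inf_cost_ninfty t x y r : 0 < t -> f y = r%:E ->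
  enorm (x - y) < pi / 2 -> 1 + 2 * t * r = 0 ->
  hl_inf_cost t f x y = -oo%E.
Proof.
move=> t0 fy xy h; rewrite /hl_inf_cost fy -EFinM -EFinD h inve0.
rewrite gt0_muley ?lte_fin ?exprn_gt0 ?cos_enorm_gt0//.
by rewrite addeNy gt0_muleNy// ?lte_fin ?invr_gt0 ?mulr_gt0.
Qed.

Lemma hl_infE t x : 0 < t ->
  hl_inf t f x = ereal_inf [set hl_inf_cost t f x y | y in hl_ball x].
Proof. by move=> t0; rewrite /hl_inf gt_eqF. Qed.

Lemma hl_inf_le_cost t x y : 0 < t -> enorm (x - y) < pi / 2 ->
  (hl_inf t f x <= hl_inf_cost t f x y)%E.
Proof.
move=> t0 xy; rewrite hl_infE//; apply: ereal_inf_lbound.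
by exists y => //; rewrite /hl_ball/= enormB.
Qed.

Lemma denom_ge0 t r : 0 < t <= 1 -> - 2^-1 <= r -> 0 <= 1 + 2 * t * r.
Proof. by move=> /andP[t0 t1] r1; nra. Qed.

Lemma hl_inf_le t x : 0 < t <= 1 -> (hl_inf t f x <= ((2 * t)^-1)%:E)%E.
Proof.
move=> /andP[t0 t1].
have xx : enorm (x - x) < pi / 2 by rewrite subrr enorm0 pihalf_gt0.
apply: le_trans (hl_inf_le_cost t0 xx) _.
have [fx|[r fx r0]] := f_cases x; first by rewrite hl_inf_cost_pinfty.
have h : 0 <= 1 + 2 * t * r by rewrite denom_ge0// t0.
have [h0|hn] := eqVneq (1 + 2 * t * r) 0.
  by rewrite (hl_inf_cost_ninfty t0 fx)// leNye.
have hp : 0 < 1 + 2 * t * r by rewrite lt_neqAle eq_sym hn.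
rewrite (hl_inf_costE _ fx)// lee_fin ler_piMr ?invr_ge0 ?mulr_ge0 ?(ltW t0)//.
have : 0 <= cos (enorm (x - x)) ^+ 2 / (1 + 2 * t * r).
  by rewrite divr_ge0 ?sqr_ge0.
lra.
Qed.

(** The bridge from costs to products: later lower bounds on the infimum are inequalities without
    denominators. *)
Lemma cost_ineq t c p D : 0 < t -> 0 < D ->
  (p <= (2 * t)^-1 * (1 - c / D)) = (c <= (1 - 2 * t * p) * D).
Proof.
move=> t0 D0; rewrite ler_pdivlMl ?mulr_gt0// lerBrDr addrC -lerBrDr.
by rewrite ler_pdivrMr.
Qed.

(** A vanishing denominator at a point of the ball would give the cost -oo, against the finite value
    p; outside the ball the left-hand side is 0 and both factors are nonnegative. *)
Lemma hl_inf_dual t x z p r : 0 < t <= 1 -> hl_inf t f x = p%:E ->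
  f z = r%:E -> cos2_trunc x z <= (1 - 2 * t * p) * (1 + 2 * t * r).
Proof.
move=> t01 fp fz; have /andP[t0 t1] := t01.
have r1 : - 2^-1 <= r by have := f_ge z; rewrite fz lee_fin.
have D0 := denom_ge0 t01 r1.
have p1 : 0 <= 1 - 2 * t * p.
  have := hl_inf_le x t01; rewrite fp lee_fin -[_^-1]mul1r.
  by rewrite ler_pdivlMr ?mulr_gt0// => h; lra.
have [xz|xz] := ltP (enorm (x - z)) (pi / 2); last first.
  by rewrite cos2_trunc_out// mulr_ge0.
have := hl_inf_le_cost t0 xz; rewrite fp.
have [h0|hn] := eqVneq (1 + 2 * t * r) 0.
  by rewrite (hl_inf_cost_ninfty t0 fz)// leeNy_eq.
have hp : 0 < 1 + 2 * t * r by rewrite lt_neqAle eq_sym hn.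
by rewrite (hl_inf_costE _ fz)// lee_fin cost_ineq// cos2_trunc_in.
Qed.

(** Points where f is +oo have cost 1/(2t); they are covered by [2 * t * b <= 1]. *)
Lemma hl_inf_ge t x b : 0 < t <= 1 -> 2 * t * b <= 1 ->
  (forall z r, enorm (x - z) < pi / 2 -> f z = r%:E ->
     0 < 1 + 2 * t * r /\ cos2_trunc x z <= (1 - 2 * t * b) * (1 + 2 * t * r)) ->
  (b%:E <= hl_inf t f x)%E.
Proof.
move=> /andP[t0 t1] tb H; rewrite hl_infE//; apply: le_ereal_inf_tmp => _ [z xz <-].
rewrite /hl_ball/= enormB in xz.
have [fz|[r fz _]] := f_cases z.
  rewrite hl_inf_cost_pinfty// lee_fin -[_^-1]mul1r ler_pdivlMr ?mulr_gt0//.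
  by rewrite mulrC.
have [D0] := H z r xz fz; rewrite cos2_trunc_in// => h.
by rewrite (hl_inf_costE _ fz)// lee_fin cost_ineq.
Qed.

(** For t < 1 every denominator is at least 1 - t, so every cost is at least (1 - 1/(1 - t)) / (2t)
    = -1/(2(1 - t)). *)
Lemma hl_inf_bounds t x : 0 < t < 1 ->
  exists p, [/\ hl_inf t f x = p%:E, 2 * t * p <= 1 & -1 <= 2 * (1 - t) * p].
Proof.
move=> /andP[t0 t1]; have t01 : 0 < t <= 1 by rewrite t0 ltW.
have u0 : 0 < 1 - t by rewrite subr_gt0.
have lo : ((- (2 * (1 - t))^-1)%:E <= hl_inf t f x)%E.
  apply: hl_inf_ge => //.
    apply: (@le_trans _ _ 0); last exact: ler01.
    by rewrite mulrN oppr_le0 mulr_ge0 ?invr_ge0 ?mulr_ge0 ?ltW.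
  move=> z r _ fz; have r1 : - 2^-1 <= r by have := f_ge z; rewrite fz lee_fin.
  have D : 1 - t <= 1 + 2 * t * r by nra.
  split; first by lra.
  apply: le_trans (cos2_trunc_le1 _ _) _.
  rewrite [X in X * _](_ : _ = (1 - t)^-1); last by field; rewrite gt_eqF.
  by rewrite mulrC ler_pdivlMr// mul1r.
have hi := hl_inf_le x t01.
case: (hl_inf t f x) lo hi => [p||] //; rewrite !lee_fin => lo hi.
exists p; split=> //.
  by move: hi; rewrite -[_^-1]mul1r ler_pdivlMr ?mulr_gt0// mulrC.
move: lo; rewrite lerNl -[_^-1]mul1r ler_pdivlMr ?mulr_gt0// => h; lra.
Qed.

(** Lower semicontinuity only speaks of reals below [f y], so a strict inequality at [f y] is first
    moved to such an m. If [f y] is +oo, m is chosen to make the product B + 1 > c; otherwise half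
    of the gap is given up. *)
Lemma strict_witness t b c y : 0 < t -> 0 < 1 - 2 * t * b -> c <= 1 ->
  (forall r, f y = r%:E -> c < (1 - 2 * t * b) * (1 + 2 * t * r)) ->
  exists2 m, (m%:E < f y)%E & c < (1 - 2 * t * b) * (1 + 2 * t * m).
Proof.
move=> t0 tb c1 H; set B := 1 - 2 * t * b in tb H *.
have [fy|[r fy _]] := f_cases y.
  exists (B^-1 / (2 * t)); first by rewrite fy ltry.
  have -> : B * (1 + 2 * t * (B^-1 / (2 * t))) = B + 1 by field; rewrite !gt_eqF.
  lra.
have h := H _ fy.
exists (r - (B * (1 + 2 * t * r) - c) / 2 / (2 * t * B)).
  by rewrite fy lte_fin gtrBl !divr_gt0 ?subr_gt0 ?mulr_gt0.
rewrite [ltRHS](_ : _ = B * (1 + 2 * t * r) - (B * (1 + 2 * t * r) - c) / 2).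
  by lra.
by field; rewrite !gt_eqF.
Qed.

Lemma cos2_trunc_lipschitz x y x' y' :
  `|cos2_trunc x' y' - cos2_trunc x y| <= 2 * (enorm (x - x') + enorm (y - y')).
Proof.
have cl (a a' : R) : `|cos a' ^+ 2 - cos a ^+ 2| <= 2 * `|a' - a|.
  have := sin_lipschitz (a + pi / 2) (a' - a).
  rewrite addrAC [a + (a' - a)]addrC subrK !sinDpihalf => h.
  rewrite subr_sqr normrM mulrC ler_pM//.
  by apply: le_trans (ler_normD _ _) _; have := cos_max a; have := cos_max a'; lra.
apply: le_trans (cl _ _) _; rewrite ler_wpM2l//.
have mn (a a' c : R) : `|Num.min a' c - Num.min a c| <= `|a' - a|.
  have := ler_norm (a' - a); have := lerNnormlW (lexx `|a' - a|).
  by rewrite ler_norml; case: (leP a' c); case: (leP a c) => *; apply/andP; lra.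
apply: le_trans (mn _ _ _) _; apply: le_trans (ler_dist_enorm _ _) _.
have -> : x' - y' - (x - y) = (x' - x) + (y - y').
  by apply/rowP => i; rewrite !mxE; ring.
by rewrite (enormB x); apply: ler_enormD.
Qed.

Hypothesis f_lsc : lower_semicontinuous f.

Lemma closed_eball x c : closed [set y | enorm (x - y) <= c].
Proof.
move=> y cy /=; rewrite leNgt; apply/negP => h.
have e0 : 0 < enorm (x - y) - c by rewrite subr_gt0.
have [z [/= xz]] := cy _ (near_enorm y e0).
have := ler_enorm_dist x z y; rewrite (enormB z); lra.
Qed.

Lemma compact_eball x c : compact [set y | enorm (x - y) <= c].
Proof.
apply: bounded_closed_compact; last exact: closed_eball.
exists (c + `|x|); split; first exact: num_real.
move=> M cM y /= xy.
have -> : y = x - (x - y) by rewrite opprB addrC subrK.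
apply: le_trans (ler_normB _ _) _.
by have := mx_norm_le_enorm (x - y); lra.
Qed.

(** Strictness at every point of the closed ball of radius pi/2 is an open condition in x and b, by
    compactness. It serves twice: for lower semicontinuity, and, read at x itself, for attainment of
    the infimum. *)
Lemma hl_inf_stable t x b : 0 < t <= 1 -> 2 * t * b < 1 ->
  (forall y r, enorm (x - y) <= pi / 2 -> f y = r%:E ->
     cos2_trunc x y < (1 - 2 * t * b) * (1 + 2 * t * r)) ->
  exists2 b', b < b' & \forall x' \near x, (b'%:E <= hl_inf t f x')%E.
Proof.
move=> t01 tb H; have /andP[t0 t1] := t01.
have B0 : 0 < 1 - 2 * t * b by rewrite subr_gt0.
(* The margin 1 leaves room for the balls around all x' with |x - x'| < 1. *)
have /compact_near_coveringP cK := @compact_eball x (pi / 2 + 1).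
pose P (i : 'rV[R]_d * R) y := enorm (i.1 - y) < pi / 2 ->
  exists2 m, (m%:E < f y)%E & cos2_trunc i.1 y < (1 - 2 * t * i.2) * (1 + 2 * t * m).
have := cK _ (filter_prod (nbhs x) (nbhs b)) P _.
case.
  move=> y _; have [xy|xy] := leP (enorm (x - y)) (pi / 2); last first.
    (* Pairs close to such (x, y) stay outside the ball, where the condition is void. *)
    set e := enorm (x - y) - pi / 2.
    have e0 : 0 < e / 2 by rewrite divr_gt0// subr_gt0.
    exists ([set y' | enorm (y - y') < e / 2],
        [set i : 'rV[R]_d * R | enorm (x - i.1) < e / 2]).
      split; first exact: near_enorm.
      exists ([set x' | enorm (x - x') < e / 2], setT).
        by split; [exact: near_enorm|exact: filterT].
      by move=> [x' b'] [].
    move=> [y' [x' b']] [/= h1 h2]; rewrite /P/= => h3.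
    have := ler_enorm_dist x x' y; have := ler_enorm_dist x' y' y.
    rewrite (enormB y' y); rewrite /e in h1 h2; lra.
  have [m fm hm] := strict_witness t0 B0 (cos2_trunc_le1 x y) (H y ^~ xy).
  set gap := (1 - 2 * t * b) * (1 + 2 * t * m) - cos2_trunc x y.
  have g0 : 0 < gap by rewrite subr_gt0.
  have [V Vy VP] := f_lsc fm.
  have g8 : 0 < gap / 8 by rewrite divr_gt0.
  (* Moving x and y by gap/8 each changes [cos2_trunc] by less than gap/2, and moving b by eta
     changes the product by less than gap/4; together this stays below gap. *)
  pose eta := gap / 4 / (`|2 * t * (1 + 2 * t * m)| + 1).
  have eta0 : 0 < eta by rewrite !divr_gt0// ltr_wpDl.
  exists (V `&` [set y' | enorm (y - y') < gap / 8],
        [set i : 'rV[R]_d * R | enorm (x - i.1) < gap / 8 /\ `|b - i.2| < eta]).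
    split; first by apply: filterI => //; exact: near_enorm.
    exists ([set x' | enorm (x - x') < gap / 8], [set b' | `|b - b'| < eta]).
      by split; [exact: near_enorm|exact: nbhsx_ballx].
    by move=> [x' b'] [].
  move=> [y' [x' b']] [/= [h1 h2] [h3 h4]] _; exists m; first exact: VP.
  rewrite /=; have := cos2_trunc_lipschitz x y x' y'; rewrite ler_norml => /andP[_ l].
  have k : `|2 * t * (1 + 2 * t * m) * (b - b')| < gap / 4.
    rewrite normrM; apply: le_lt_trans (_ : _ <=
      (`|2 * t * (1 + 2 * t * m)| + 1) * `|b - b'|) _.
      by rewrite ler_wpM2r// lerDl.
    by rewrite mulrC -ltr_pdivlMr// ltr_wpDl.
  move: k; rewrite ltr_norml => /andP[k1 k2]; rewrite /gap in h2 h3 k1 k2; nra.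
move=> [U W] /= [Ux Wb] UW.
have [e/= e0 eW] := (nbhs_ballP _ _).1 Wb.
(* The second bound ensures 2t(b + e') <= 1, as [hl_inf_ge] requires. *)
pose e' := Num.min (e / 2) ((1 - 2 * t * b) / (2 * t)).
have e'0 : 0 < e' by rewrite lt_min !divr_gt0// mulr_gt0.
exists (b + e'); first by rewrite ltrDl.
apply: filterS (filterI Ux (near_enorm x (@ltr01 R))) => x' [Ux' xx'].
have b'1 : 2 * t * (b + e') <= 1.
  have : e' <= (1 - 2 * t * b) / (2 * t) by rewrite ge_min lexx orbT.
  rewrite ler_pdivlMr ?mulr_gt0//; lra.
apply: hl_inf_ge => // z r xz fz.
have Wb' : W (b + e').
  apply: eW; rewrite -ball_normE/= opprD addNKr normrN gtr0_norm//.
  by rewrite gt_min; apply/orP; left; lra.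
have [|m] := UW (x', b + e') (conj Ux' Wb') z _ xz.
  by rewrite /=; have := ler_enorm_dist x x' z; lra.
rewrite fz lte_fin /= => mr hc.
have p1 : 0 < (1 - 2 * t * (b + e')) * (1 + 2 * t * m).
  exact: le_lt_trans (cos2_trunc_ge0 _ _) hc.
have q0 : 0 < 1 - 2 * t * (b + e').
  rewrite lt_neqAle subr_ge0 b'1 andbT eq_sym; apply/eqP => q0.
  by rewrite q0 mul0r ltxx in p1.
have q1 : 0 < 1 + 2 * t * m by rewrite pmulr_rgt0 in p1.
have q2 : 0 < 2 * t * (r - m) by rewrite !mulr_gt0// subr_gt0.
split; first by lra.
by apply: le_trans (ltW hc) _; rewrite ler_pM2l//; lra.
Qed.

(** On the sphere |x - y| = pi/2 strictness means 0 < (1 - 2tb)(1 + 2t f(y)), which fails only for t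
    = 1 and f(y) = -1/2. The exception is genuine: if d >= 1 and f is -1/2 at the origin and +oo
    elsewhere, then P_1 f is -oo on the open ball of radius pi/2 and 1/2 outside it. *)
Lemma hl_inf_lsc_at t x b : 0 < t <= 1 ->
  (t = 1 -> forall y, f y = (- 2^-1)%:E -> enorm (x - y) <> pi / 2) ->
  (b%:E < hl_inf t f x)%E ->
  exists2 b', b < b' & \forall x' \near x, (b'%:E <= hl_inf t f x')%E.
Proof.
move=> t01 exc bx; have /andP[t0 t1] := t01.
have tb : 2 * t * b < 1.
  have := lt_le_trans bx (hl_inf_le x t01).
  by rewrite lte_fin -[_^-1]mul1r ltr_pdivlMr ?mulr_gt0// mulrC.
apply: hl_inf_stable => // y r xy fy.
have r1 : - 2^-1 <= r by have := f_ge y; rewrite fy lee_fin.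
have D0 := denom_ge0 t01 r1.
have [xy1|xy1] := ltP (enorm (x - y)) (pi / 2).
  have := lt_le_trans bx (hl_inf_le_cost t0 xy1).
  have [h0|hn] := eqVneq (1 + 2 * t * r) 0.
    by rewrite (hl_inf_cost_ninfty t0 fy)// ltNge leNye.
  have hp : 0 < 1 + 2 * t * r by rewrite lt_neqAle eq_sym hn.
  rewrite (hl_inf_costE _ fy)// lte_fin ltr_pdivlMl ?mulr_gt0//.
  rewrite ltrBrDr addrC -ltrBrDr ltr_pdivrMr// cos2_trunc_in//.
rewrite cos2_trunc_out// mulr_gt0 ?subr_gt0// lt_neqAle D0 andbT eq_sym.
apply/eqP => D.
have t11 : t = 1.
  by apply/eqP; rewrite eq_le t1/= leNgt; apply/negP => t11; nra.
apply: (exc t11 y); last by apply/eqP; rewrite eq_le xy.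
by rewrite fy; congr (_%:E); rewrite t11 in D; lra.
Qed.

(** If equality held nowhere, the coupling would be strict everywhere and [hl_inf_stable] would
    yield a lower bound above p. When 2tp = 1 there may be no minimizer with f finite, for instance
    if f is +oo on the ball. *)
Lemma hl_inf_attained t x p : 0 < t < 1 -> hl_inf t f x = p%:E ->
  2 * t * p < 1 ->
  exists z, exists r, [/\ enorm (x - z) < pi / 2, f z = r%:E, 0 < 1 + 2 * t * r
    & cos2_trunc x z = (1 - 2 * t * p) * (1 + 2 * t * r)].
Proof.
move=> /andP[t0 t1] fp tp; have t01 : 0 < t <= 1 by rewrite t0 ltW.
apply: contrapT => H.
have [] := @hl_inf_stable t x p t01 tp.
  move=> y r xy fy; have r1 : - 2^-1 <= r by have := f_ge y; rewrite fy lee_fin.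
  have D0 : 0 < 1 + 2 * t * r by nra.
  have [xy1|xy1] := ltP (enorm (x - y)) (pi / 2); last first.
    by rewrite cos2_trunc_out// mulr_gt0// subr_gt0.
  rewrite lt_neqAle (hl_inf_dual t01 fp fy) andbT; apply/eqP => e.
  by apply: H; exists y, r.
by move=> b' pb' /nbhs_singleton; rewrite fp lee_fin leNgt pb'.
Qed.

End HopfLaxOperator.

(** * Coupling between intermediate times along cone geodesics *)

Section HopfLaxInterpolation.
Context {R : realType} {d : nat}.
Implicit Types (x y z : 'rV[R]_d) (t s r p b c m : R).
Variable f : 'rV[R]_d -> \bar R.
Hypothesis f_ge : forall x, ((- 2^-1)%:E <= f x)%E.
Hypothesis f_lsc : lower_semicontinuous f.

Lemma hl_inf0 x : hl_inf 0 f x = f x.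
Proof. by rewrite /hl_inf eqxx. Qed.

Lemma hl_inf_le_real t x p : 0 < t <= 1 -> hl_inf t f x = p%:E ->
  0 <= 1 - 2 * t * p.
Proof.
move=> t01 fp; have /andP[t0 _] := t01.
have := hl_inf_le f_ge x t01; rewrite fp lee_fin -[_^-1]mul1r.
by rewrite ler_pdivlMr ?mulr_gt0// => h; lra.
Qed.

(** The inequality half of P_s = P_(s-t) P_t. A minimizer z of P_t f at y is a competitor for P_s f
    at x, and the cone triangle inequality through y with weight l = t/s compares the two
    couplings. *)
Lemma hl_inf_semigroup_dual t s x y p r : 0 <= t -> t < s -> s <= 1 ->
  hl_inf s f x = p%:E -> hl_inf t f y = r%:E ->
  cos2_trunc x y <= (1 - 2 * (s - t) * p) * (1 + 2 * (s - t) * r).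
Proof.
move=> t0 ts s1 fp fr; have s0 : 0 < s by exact: le_lt_trans ts.
have s01 : 0 < s <= 1 by rewrite s0.
have [t00|tn0] := eqVneq t 0.
  by rewrite t00 subr0; apply: hl_inf_dual; rewrite // -(hl_inf0 y) -t00.
have tp : 0 < t by rewrite lt_neqAle eq_sym tn0.
have t01 : 0 < t < 1 by rewrite tp (lt_le_trans ts).
have t01' : 0 < t <= 1 by rewrite tp; case/andP: t01 => _ /ltW.
pose l := t / s; have ls : t = l * s by rewrite /l divfK// gt_eqF.
have l0 : 0 < l by rewrite divr_gt0.
have l1 : l < 1 by rewrite ltr_pdivrMr// mul1r.
have P0 := hl_inf_le_real s01 fp; set P := 1 - 2 * s * p in P0.
have eN : 1 - 2 * (s - t) * p = l + (1 - l) * P by rewrite /P ls; ring.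
have eB : 1 + 2 * (s - t) * r = l^-1 * (1 - (1 - l) * (1 - 2 * t * r)).
  by rewrite ls; field; rewrite gt_eqF.
rewrite eN eB mulrCA ler_pdivlMl//.
set N := l + _; have N0 : 0 < N by rewrite ltr_pwDl// mulr_ge0// subr_ge0 ltW.
have w0 := hl_inf_le_real t01' fr.
(* At the maximal value there may be no minimizer; the claim then reduces to cos^2 <= 1. *)
have [w1|wn] := eqVneq (2 * t * r) 1.
  rewrite w1 subrr mulr0 subr0 mulr1.
  have := cos2_trunc_le1 x y; have : 0 <= (1 - l) * P by rewrite mulr_ge0// subr_ge0 ltW.
  by rewrite /N; nra.
have [|z [a [_ fa E0 ca]]] := hl_inf_attained f_ge f_lsc t01 fr.
  by rewrite lt_neqAle wn -subr_ge0.
have a1 : - 2^-1 <= a by have := f_ge z; rewrite fa lee_fin.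
have := @cos2_trunc_triangle _ _ l P (1 + 2 * s * a) x y z.
rewrite l0 l1 P0 (denom_ge0 s01 a1) (hl_inf_dual f_ge s01 fp fa).
move=> /(_ isT isT isT isT); rewrite ca.
have -> : 1 - l + l * (1 + 2 * s * a) = 1 + 2 * t * a by rewrite ls; ring.
rewrite -/N => h; rewrite -(ler_pM2r E0); lra.
Qed.

(** The other half of the semigroup law, with an explicit y on the segment from x to a minimizer z
    of P_s f at x. Finding y explicitly avoids a second compactness argument at time t. *)
Lemma hl_inf_optimal t s x p : 0 <= t -> t < s -> s < 1 ->
  hl_inf s f x = p%:E -> 0 < 1 - 2 * (s - t) * p ->
  exists y, exists r, [/\ enorm (x - y) < pi / 2, hl_inf t f y = r%:E,
    0 < 1 + 2 * (s - t) * r &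
    cos2_trunc x y = (1 - 2 * (s - t) * p) * (1 + 2 * (s - t) * r)].
Proof.
move=> t0 ts s1 fp N0; have s0 : 0 < s by exact: le_lt_trans ts.
have s01 : 0 < s < 1 by rewrite s0.
have s01' : 0 < s <= 1 by rewrite s0 ltW.
have [t00|tn0] := eqVneq t 0.
  have [|y [r [h1 h2 h3 h4]]] := hl_inf_attained f_ge f_lsc s01 fp.
    by move: N0; rewrite t00 subr0; lra.
  by exists y, r; rewrite t00 subr0 hl_inf0.
have tp : 0 < t by rewrite lt_neqAle eq_sym tn0.
have t01 : 0 < t < 1 by rewrite tp (lt_trans ts).
have t01' : 0 < t <= 1 by rewrite tp; case/andP: t01 => _ /ltW.
suff [y [r [xy fr h]]] : exists y, exists r, [/\ enorm (x - y) < pi / 2,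
    hl_inf t f y = r%:E &
    (1 - 2 * (s - t) * p) * (1 + 2 * (s - t) * r) <= cos2_trunc x y].
  have e := hl_inf_semigroup_dual t0 ts (ltW s1) fp fr.
  have {h e} e : cos2_trunc x y = (1 - 2 * (s - t) * p) * (1 + 2 * (s - t) * r).
    by apply/eqP; rewrite eq_le e h.
  exists y, r; split => //.
  by have := cos2_trunc_gt0 xy; rewrite e pmulr_rgt0.
pose l := t / s; have ls : t = l * s by rewrite /l divfK// gt_eqF.
have l0 : 0 < l by rewrite divr_gt0.
have l1 : l < 1 by rewrite ltr_pdivrMr// mul1r.
have P0 := hl_inf_le_real s01' fp.
have eN : 1 - 2 * (s - t) * p = l + (1 - l) * (1 - 2 * s * p) by rewrite ls; ring.
have eB r : 1 + 2 * (s - t) * r = l^-1 * (1 - (1 - l) * (1 - 2 * t * r)).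
  by rewrite ls; field; rewrite gt_eqF.
(* At the maximal value the first factor is l and y = x works. *)
have [w1|wn] := eqVneq (2 * s * p) 1.
  have [r [fr r1 _]] := hl_inf_bounds f_ge x t01.
  exists x, r; rewrite fr subrr enorm0 pihalf_gt0 cos2_truncxx; split=> //.
  rewrite eN eB w1 subrr mulr0 addr0 mulVKf ?gt_eqF//.
  by rewrite gerBl mulr_ge0// subr_ge0// ltW.
have [|z [a [xz fa D0 ca]]] := hl_inf_attained f_ge f_lsc s01 fp.
  by rewrite lt_neqAle wn -subr_ge0.
set th := enorm (x - z) in xz.
have c0 : 0 < cos th by exact: cos_enorm_gt0.
have th0 : 0 <= th := enorm_ge0 _.
have sn0 : 0 <= sin th.
  by apply: sin_ge0_pi; rewrite th0/=; have := @pihalf_gt0 R; lra.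
set D := 1 + 2 * s * a in D0 ca.
set P := 1 - 2 * s * p in P0 eN ca.
have cP : cos th ^+ 2 = P * D by rewrite -ca cos2_trunc_in.
(* In polar coordinates, take the point of radius D at angle 0 and the point of radius cos th at
   angle th, with weights l and 1 - l. Their combination has abscissa M and ordinate (1 - l) cos th
   sin th: T is the tangent of its angle, and S below its squared length. *)
pose M := l * D + (1 - l) * cos th ^+ 2.
have M0 : 0 < M.
  by rewrite addr_gt0// mulr_gt0 ?subr_gt0 ?exprn_gt0.
pose T := (1 - l) * cos th * sin th / M.
have T0 : 0 <= T.
  by rewrite divr_ge0 ?(ltW M0)// !mulr_ge0 ?subr_ge0 ?(ltW l1) ?(ltW c0).
pose th2 := atan T.
have th20 : 0 <= th2 by exact: atan_ge0.
have th21 : th2 < pi / 2 by exact: atan_ltpi2.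
pose k := th2 / th.
have kth : k * th = th2.
  rewrite /k; have [e|?] := eqVneq th 0; last by rewrite divfK.
  by rewrite e mulr0 /th2 /T e sin0 mulr0 mul0r atan0.
have k0 : 0 <= k by rewrite divr_ge0.
have [r [fr r1 _]] := hl_inf_bounds f_ge (x + k *: (z - x)) t01.
have e1 : x - (x + k *: (z - x)) = k *: (x - z).
  by rewrite opprD addNKr -scalerN opprB.
have e2 : x + k *: (z - x) - z = (1 - k) *: (x - z).
  by apply/rowP => i; rewrite !mxE; ring.
have xy : enorm (x - (x + k *: (z - x))) = th2.
  by rewrite e1 enormZ ger0_norm.
have yz : enorm (x + k *: (z - x) - z) = `|th - th2|.
  rewrite e2 enormZ -/th -kth -[X in _ * X](ger0_norm th0) -normrM.
  by rewrite mulrBl mul1r.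
exists (x + k *: (z - x)), r; rewrite xy; split => //.
(* The coupling of y with z bounds 1 - 2tr from below, hence 1 + 2(s - t)r from above. *)
have := hl_inf_dual f_ge t01' fr fa.
have yz1 : `|th - th2| < pi / 2 by rewrite ltr_norml; apply/andP; lra.
rewrite !cos2_trunc_in ?xy ?yz// cos_norm cosB.
set E := 1 + 2 * t * a; have eE : E = 1 - l + l * D by rewrite /E /D ls; ring.
have E0 : 0 < E by rewrite eE ltr_pwDl ?subr_gt0// mulr_ge0// ltW.
pose S := l ^+ 2 * D ^+ 2 + 2 * l * (1 - l) * D * cos th ^+ 2
          + (1 - l) ^+ 2 * cos th ^+ 2.
have eS : S = M ^+ 2 + ((1 - l) * cos th * sin th) ^+ 2.
  by rewrite !exprMn sin2cos2 /S /M; ring.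
have S0 : 0 < S by rewrite eS ltr_pwDl ?sqr_ge0 ?exprn_gt0.
have cn : cos th2 != 0 by rewrite gt_eqF// cos_gt0_pihalf// th21 andbT; lra.
have tT : sin th2 = T * cos th2 by rewrite -[T]atanK /tan divfK.
have ct2 : cos th2 ^+ 2 = M ^+ 2 / S.
  have := cos2_tan2 cn; rewrite atanK => h.
  have -> : cos th2 ^+ 2 = (1 + T ^+ 2)^-1 by rewrite -h invrK.
  rewrite /T eS; field.
  by rewrite -eS !gt_eqF.
rewrite tT ct2.
have -> : cos th * cos th2 + sin th * (T * cos th2) = (cos th * E / M) * cos th2.
  rewrite mulrA -mulrDl; congr (_ * _); rewrite /T.
  have -> : sin th * ((1 - l) * cos th * sin th / M)
     = (1 - l) * cos th * (sin th ^+ 2) / M by ring.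
  rewrite sin2cos2 eE /M; field.
  by rewrite gt_eqF// -/M.
rewrite exprMn ct2 => h.
have {}h : (cos th * E / M) ^+ 2 * (M ^+ 2 / S) / E <= 1 - 2 * t * r.
  by rewrite ler_pdivrMr.
rewrite eN eB mulrCA ler_pdivrMl//.
apply: le_trans (_ : (l + (1 - l) * P) *
    (1 - (1 - l) * ((cos th * E / M) ^+ 2 * (M ^+ 2 / S) / E)) <= _).
  apply: ler_wpM2l.
    have m0 : 0 <= 1 - l by lra.
    by have := mulr_ge0 m0 P0; lra.
  by rewrite lerD2l lerN2 ler_wpM2l// subr_ge0 ltW.
have -> : (cos th * E / M) ^+ 2 * (M ^+ 2 / S) / E = cos th ^+ 2 * E / S.
  by field; rewrite !gt_eqF.
have -> : P = cos th ^+ 2 / D by rewrite cP mulfK// gt_eqF.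
(* For this choice of T the bound obtained is exactly cos^2 th2 = M^2 / S. *)
rewrite le_eqVlt; apply/orP; left; apply/eqP.
have -> : l + (1 - l) * (cos th ^+ 2 / D) = M / D.
  by rewrite /M; field; rewrite gt_eqF.
have -> : 1 - (1 - l) * (cos th ^+ 2 * E / S) = l * D * M / S.
  have -> : l * D * M = S - (1 - l) * (cos th ^+ 2 * E) by rewrite /S /M eE; ring.
  by field; rewrite gt_eqF.
by field; rewrite !gt_eqF.
Qed.

(* The cost with [y] fixed is semiconcave, bounds the potential from above, and
   touches it at [x]. *)
Lemma hl_inf_touching t s x y p r : 0 <= t -> t < s -> s <= 1 ->
  hl_inf s f x = p%:E -> hl_inf t f y = r%:E -> enorm (x - y) < pi / 2 ->
  0 < 1 + 2 * (s - t) * r ->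
  cos2_trunc x y = (1 - 2 * (s - t) * p) * (1 + 2 * (s - t) * r) ->
  forall x' p', hl_inf s f x' = p'%:E ->
    p' - p <= dotv (((s - t) * (1 + 2 * (s - t) * r))^-1
        * (sin (enorm (x - y)) * cos (enorm (x - y)) / enorm (x - y))
        *: (x - y)) (x' - x)
      + 2^-1 * ((s - t) * (1 + 2 * (s - t) * r))^-1 * enorm (x - x') ^+ 2.
Proof.
move=> t0 ts s1 fp fr xy D0 e x' p' fp'.
have := hl_inf_semigroup_dual (x := x') t0 ts s1 fp' fr.
have := cos2_trunc_semiconcave x' xy; rewrite dotvZl (enormB x x').
set k := _ / enorm _; set sg := s - t in D0 e *; set D := 1 + 2 * sg * r in D0 e *.
have sg0 : 0 < sg by rewrite subr_gt0.
move=> h1 h2. set A := dotv _ _ in h1 *; set n2 := _ ^+ 2 in h1 *.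
have -> : (sg * D)^-1 * k * A + 2^-1 * (sg * D)^-1 * n2
    = (sg * D)^-1 * (k * A + 2^-1 * n2) by ring.
rewrite ler_pdivlMl ?mulr_gt0//; rewrite e in h1; lra.
Qed.

End HopfLaxInterpolation.

(** * Minimizers as the points of equality in the coupling *)

Section Minimizers.
Context {R : realType} {d : nat}.
Implicit Types (x y z : 'rV[R]_d) (t s r p b c m : R).
Variable f : 'rV[R]_d -> \bar R.
Hypothesis f_ge : forall x, ((- 2^-1)%:E <= f x)%E.
Hypothesis f_lsc : lower_semicontinuous f.

Lemma hl_inf_cases t y : 0 <= t -> t < 1 ->
  hl_inf t f y = +oo%E \/ exists2 r, hl_inf t f y = r%:E & -1 <= 2 * (1 - t) * r.
Proof.
move=> t0 t1; have [->|tn0] := eqVneq t 0.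
  rewrite hl_inf0; have [|[r fr r1]] := f_cases f_ge y; first by left.
  by right; exists r => //; lra.
have t01 : 0 < t < 1 by rewrite lt_neqAle eq_sym tn0 t0.
by have [r [fr _ r1]] := hl_inf_bounds f_ge y t01; right; exists r.
Qed.

(** Equality says that the cost at y is p, and the coupling with any other z says that the cost
    there is at least p. *)
Lemma hl_inf_minimizer t s x y p r : 0 <= t -> t < s -> s <= 1 ->
  hl_inf s f x = p%:E -> hl_inf t f y = r%:E -> enorm (x - y) < pi / 2 ->
  cos2_trunc x y = (1 - 2 * (s - t) * p) * (1 + 2 * (s - t) * r) ->
  0 < 1 + 2 * (s - t) * r /\
  forall z, enorm (x - z) < pi / 2 ->
    (hl_inf_cost (s - t) (hl_inf t f) x y
       <= hl_inf_cost (s - t) (hl_inf t f) x z)%E.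
Proof.
move=> t0 ts s1 fp fr xy e; have sg0 : 0 < s - t by rewrite subr_gt0.
have s01 : 0 < s <= 1 by rewrite s1 andbT (le_lt_trans t0).
have P0 := hl_inf_le_real f_ge s01 fp.
have N0 : 0 <= 1 - 2 * (s - t) * p.
  have [p0|p0] := leP 0 p; last by nra.
  have : 0 <= 2 * t * p by rewrite !mulr_ge0.
  lra.
have Dpos z r' : hl_inf t f z = r'%:E -> enorm (x - z) < pi / 2 ->
    0 < 1 + 2 * (s - t) * r' /\
    cos2_trunc x z <= (1 - 2 * (s - t) * p) * (1 + 2 * (s - t) * r').
  move=> fz xz; have h := hl_inf_semigroup_dual f_ge f_lsc t0 ts s1 fp fz.
  split=> //; have := lt_le_trans (cos2_trunc_gt0 xz) h.
  by have [h0|//] := leP (1 + 2 * (s - t) * r') 0; rewrite ltNge mulr_ge0_le0.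
have [D0 _] := Dpos y r fr xy; split=> // z xz.
have N1 : 0 < 1 - 2 * (s - t) * p.
  by have := cos2_trunc_gt0 xy; rewrite e pmulr_lgt0.
have -> : hl_inf_cost (s - t) (hl_inf t f) x y = p%:E.
  rewrite (hl_inf_costE _ fr)// -cos2_trunc_in// e mulfK ?gt_eqF//.
  by congr (_%:E); field; rewrite gt_eqF.
have [fz|[r' fz _]] := hl_inf_cases z t0 (lt_le_trans ts s1).
  rewrite hl_inf_cost_pinfty// lee_fin -[_^-1]mul1r ler_pdivlMr ?mulr_gt0//; lra.
have [D1 h] := Dpos z r' fz xz.
by rewrite (hl_inf_costE _ fz)// lee_fin cost_ineq// -cos2_trunc_in.
Qed.

(** The explicit point of [hl_inf_optimal] has cost p, so a minimizer costs at most p; this is the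
    missing half of the equality. *)
Lemma hl_inf_minimizer_eq t s x y p : 0 <= t -> t < s -> s < 1 ->
  hl_inf s f x = p%:E -> 0 < 1 - 2 * (s - t) * p -> enorm (x - y) < pi / 2 ->
  (forall z, enorm (x - z) < pi / 2 ->
    (hl_inf_cost (s - t) (hl_inf t f) x y
       <= hl_inf_cost (s - t) (hl_inf t f) x z)%E) ->
  exists r, [/\ hl_inf t f y = r%:E, 0 < 1 + 2 * (s - t) * r &
    cos2_trunc x y = (1 - 2 * (s - t) * p) * (1 + 2 * (s - t) * r)].
Proof.
move=> t0 ts s1 fp N0 xy H; have sg0 : 0 < s - t by rewrite subr_gt0.
have [z [r [xz fz D0 e]]] := hl_inf_optimal f_ge f_lsc t0 ts s1 fp N0.
have := H z xz.
have -> : hl_inf_cost (s - t) (hl_inf t f) x z = p%:E.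
  rewrite (hl_inf_costE _ fz)// -cos2_trunc_in// e mulfK ?gt_eqF//.
  by congr (_%:E); field; rewrite gt_eqF.
(* A minimizer cannot have infinite potential: its cost 1/(2(s - t)) would exceed p. *)
have [fy|[r' fy r'1]] := hl_inf_cases y t0 (lt_trans ts s1).
  rewrite hl_inf_cost_pinfty// lee_fin -[_^-1]mul1r ler_pdivrMr ?mulr_gt0//; lra.
have D1 : 0 < 1 + 2 * (s - t) * r' by nra.
rewrite (hl_inf_costE _ fy)// lee_fin ler_pdivrMl ?mulr_gt0// lerBlDr addrC.
rewrite -lerBlDr ler_pdivlMr// -cos2_trunc_in// => h.
exists r'; split=> //; apply/eqP; rewrite eq_le h andbT.
by have := hl_inf_semigroup_dual f_ge f_lsc t0 ts (ltW s1) fp fy.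
Qed.

End Minimizers.

(** Along v = e q the left-hand side is linear in e and the right-hand side quadratic; a small e
    contradicts q != 0. *)
Lemma dotv_le_sqr_eq0 {R : realType} {d : nat} (q : 'rV[R]_d) (C : R) :
  (forall v, dotv q v <= C * enorm v ^+ 2) -> q = 0.
Proof.
move=> H; apply: contrapT => /eqP/enorm_gt0 q0.
pose e := (2 * (`|C| + 1))^-1.
have C0 : 0 < `|C| + 1 by rewrite ltr_wpDl.
have e0 : 0 < e by rewrite invr_gt0 mulr_gt0.
have Ce : C * e < 1.
  by rewrite ltr_pdivrMr ?mulr_gt0// mul1r; have := ler_norm C; lra.
have := H (e *: q); rewrite dotvZr enormZ gtr0_norm// -sqr_enorm.
have : 0 < enorm q ^+ 2 by rewrite exprn_gt0.
have : 0 < e * enorm q ^+ 2 by rewrite mulr_gt0 ?exprn_gt0.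
rewrite exprMn; nra.
Qed.

(** * Order of the two potentials, and the common slope at contact points *)

Section DualPair.
Context {R : realType} {d : nat}.
Implicit Types (x y z q : 'rV[R]_d) (t s r p v w a b k C : R)
  (f h : 'rV[R]_d -> \bar R).

(* f = xi_0 and h = - xibar_1; the last clause is the hypothesis
   xibar_1 <= P_1 xi_0 with both denominators cleared. *)
Definition dual_pair a b f h : Prop :=
  [/\ - 2^-1 <= a /\ - 2^-1 <= b,
      (forall x, (a%:E <= f x)%E) /\ (forall x, (b%:E <= h x)%E),
      lower_semicontinuous f, lower_semicontinuous h &
      forall x z v r, h x = v%:E -> f z = r%:E ->
        cos2_trunc x z <= (1 + 2 * v) * (1 + 2 * r)].

Lemma dual_pair_sym a b f h : dual_pair a b f h -> dual_pair b a h f.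
Proof.
move=> [[a0 b0] [fa hb] fl hl H]; split=> // x z v r fx hz.
by rewrite cos2_truncC mulrC; exact: H.
Qed.

(* x is a contact point at time t with common value p, as xibar_t = - P_(1-t) h. *)
Definition touches f h t x p : Prop :=
  hl_inf t f x = p%:E /\ hl_inf (1 - t) h x = (- p)%:E.

Lemma touches_sym f h t x p :
  touches f h t x p -> touches h f (1 - t) x (- p).
Proof. by case=> fp hp; split=> //; rewrite subKr opprK. Qed.

Definition upper_slope f t x p q k : Prop :=
  forall x' p', hl_inf t f x' = p'%:E ->
    p' - p <= dotv q (x' - x) + k * enorm (x - x') ^+ 2.

(** The lower bound on xibar_t is an upper bound for [h] at the reversed time, with the opposite
    slope; in this form time reversal exchanges the two clauses. *)
Definition two_sided_slope a b f h t x p q : Prop :=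
  upper_slope f t x p q (2^-1 * Lambda a t) /\
  upper_slope h (1 - t) x (- p) (- q) (2^-1 * Lambda b (1 - t)).

Lemma two_sided_slope_sym a b f h t x p q :
  two_sided_slope a b f h t x p q ->
  two_sided_slope b a h f (1 - t) x (- p) (- q).
Proof. by case=> h1 h2; split=> //; rewrite subKr !opprK. Qed.

Lemma Lambda_gt0 a t : - 2^-1 <= a -> 0 < t < 1 -> 0 < Lambda a t.
Proof. by move=> a0 /andP[t0 t1]; rewrite invr_gt0 mulr_gt0//; nra. Qed.

Lemma Lambda_le a t : - 2^-1 <= a -> 0 < t < 1 -> Lambda a t <= (t * (1 - t))^-1.
Proof.
move=> a0 /andP[t0 t1]; have ? : 0 < 1 - t by rewrite subr_gt0.
have ? : 1 - t <= 1 + 2 * a * t by nra.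
by rewrite lef_pV2 ?posrE ?mulr_gt0// ?ler_pM2l//; lra.
Qed.

Lemma onem_itv t : 0 < t < 1 -> 0 < 1 - t < 1.
Proof. by case/andP => t0 t1; rewrite subr_gt0 t1 ltrBlDr ltrDl. Qed.

Section Fixed.
Variables (a b : R) (f h : 'rV[R]_d -> \bar R).
Hypothesis fh : dual_pair a b f h.

Lemma dual_pair_fge x : ((- 2^-1)%:E <= f x)%E.
Proof.
by case: fh => [[a0 _] [fa _] _ _ _]; apply: le_trans (fa x); rewrite lee_fin.
Qed.
Let fge := dual_pair_fge.

Let hge x : ((- 2^-1)%:E <= h x)%E.
Proof.
by case: fh => [[_ b0] [_ hb] _ _ _]; apply: le_trans (hb x); rewrite lee_fin.
Qed.

Let flsc : lower_semicontinuous f. Proof. by case: fh. Qed.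
Let hlsc : lower_semicontinuous h. Proof. by case: fh. Qed.

(** The end time of xibar_t <= xi_t, where the coupling of [f] and [h] applies directly, without
    minimizers. *)
Lemma dual_pair_order0 y r : f y = r%:E -> ((- r)%:E <= hl_inf 1 h y)%E.
Proof.
move=> fy; have r1 := fge y; rewrite fy lee_fin in r1.
apply: hl_inf_ge; rewrite ?ltr01 ?lexx//; first by lra.
move=> z v yz hz; have v1 := hge z; rewrite hz lee_fin in v1.
case: fh => _ _ _ _ /(_ z y v r hz fy); rewrite cos2_truncC => H.
have := cos2_trunc_gt0 yz => c0; split; last by lra.
have : 0 < (1 + 2 * v) * (1 + 2 * r) by exact: lt_le_trans H.
by rewrite pmulr_lgt0 ?mulr1//; nra.
Qed.

(** With minimizers z of P_t f and y of P_(1-t) h at x, the cone triangle inequality from y to z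
    through x reads V E (1 - 2t(1 - t)(p + w)) <= V E. *)
Lemma dual_pair_order t x p w : 0 < t < 1 ->
  hl_inf t f x = p%:E -> hl_inf (1 - t) h x = w%:E -> 0 <= p + w.
Proof.
move=> t01 fp hw; have t01' := onem_itv t01; have /andP[t0 t1] := t01.
have [p' [+ p1 p2]] := hl_inf_bounds fge x t01; rewrite fp => -[pp']; subst p'.
have [w' [+ w1 w2]] := hl_inf_bounds hge x t01'; rewrite hw => -[ww']; subst w'.
have t10 : 0 < 1 - t by rewrite subr_gt0.
(* At p = 1/(2t), where a minimizer may be missing, w >= -1/(2t) suffices; the next case is
   symmetric. *)
have [pe|pn] := eqVneq (2 * t * p) 1; first by nra.
have [we|wn] := eqVneq (2 * (1 - t) * w) 1; first by nra.
have [|z [r [_ fz E0 ez]]] := hl_inf_attained fge flsc t01 fp.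
  by rewrite lt_neqAle pn.
have [|y [v [_ hy V0 ey]]] := hl_inf_attained hge hlsc t01' hw.
  by rewrite lt_neqAle wn.
have r1 := fge z; rewrite fz lee_fin in r1.
have v1 := hge y; rewrite hy lee_fin in v1.
have H : cos2_trunc y z <= (1 + 2 * v) * (1 + 2 * r).
  by case: fh => _ _ _ _; apply.
have P0 : 0 <= 1 + 2 * v by lra.
have D0 : 0 <= 1 + 2 * r by lra.
have := cos2_trunc_triangle x t01 P0 D0 H.
rewrite cos2_truncC ez ey.
have -> : 1 - t + t * (1 + 2 * r) = 1 + 2 * t * r by ring.
have -> : t + (1 - t) * (1 + 2 * v) = 1 + 2 * (1 - t) * v by ring.
set E := 1 + _ * r in E0 *; set V := 1 + _ * v in V0 *.
have -> : t * ((1 - 2 * (1 - t) * w) * V) * E + (1 - t) * ((1 - 2 * t * p) * E) * V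
   = V * E * (1 - 2 * (t * (1 - t) * (p + w))) by ring.
rewrite -[leRHS]mulr1 ler_pM2l ?mulr_gt0//.
have := mulr_gt0 t0 t10; nra.
Qed.

(** The cost at a minimizer z touches from above, with constant 1/(t(1 + 2t f(z))) <= Lambda_a(t)
    because f(z) >= a. If 2tp = 1, then x is a maximum point and the slope 0 serves. *)
Lemma upper_slope_exists t x p : 0 < t < 1 -> hl_inf t f x = p%:E ->
  exists q, upper_slope f t x p q (2^-1 * Lambda a t).
Proof.
move=> t01 fp; have /andP[t0 t1] := t01.
have a0 : - 2^-1 <= a by case: fh => -[].
have L0 := Lambda_gt0 a0 t01.
have [pe|pn] := eqVneq (2 * t * p) 1.
  exists 0 => x' p' fp'; rewrite dotv0l add0r.
  have t01' : 0 < t <= 1 by rewrite t0 ltW.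
  have := hl_inf_le_real fge t01' fp'.
  have : 0 <= 2^-1 * Lambda a t * enorm (x - x') ^+ 2.
    by have L1 := ltW L0; rewrite mulr_ge0 ?sqr_ge0// mulr_ge0// invr_ge0.
  nra.
have t01' : 0 < t <= 1 by rewrite t0 ltW.
have [|z [r [xz fz D0 e]]] := hl_inf_attained fge flsc t01 fp.
  by rewrite lt_neqAle pn /=; have := hl_inf_le_real fge t01' fp; lra.
have := hl_inf_touching fge flsc (lexx 0) t0 (ltW t1) fp (y := z) (r := r).
rewrite hl_inf0 subr0 => /(_ fz xz D0 e) H.
set q := _ *: (x - z) in H; exists q => x' p' fp'; apply: le_trans (H x' p' fp') _.
rewrite lerD2l ler_wpM2r ?sqr_ge0// ler_wpM2l//.
have ar : a <= r by case: fh => _ [/(_ z) + _] _ _ _; rewrite fz lee_fin.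
by rewrite lef_pV2 ?posrE ?mulr_gt0// ?ler_pM2l//; nra.
Qed.

(** Adding both bounds at x + v and using xibar_t <= xi_t leaves a linear form in v below a
    quadratic one. The constants are arbitrary, so the slope of any touching cost can be
    identified. *)
Lemma slopes_eq t x p q q' k k' : 0 < t < 1 -> touches f h t x p ->
  upper_slope f t x p q k -> upper_slope h (1 - t) x (- p) (- q') k' -> q = q'.
Proof.
move=> t01 [fp hp] H1 H2; apply/eqP; rewrite -subr_eq0; apply/eqP.
rewrite -[LHS]opprK; apply/eqP; rewrite oppr_eq0; apply/eqP.
apply: (@dotv_le_sqr_eq0 _ _ _ (k + k')) => v.
have [p' [fp' _ _]] := hl_inf_bounds fge (x + v) t01.
have [w' [hw' _ _]] := hl_inf_bounds hge (x + v) (onem_itv t01).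
have := dual_pair_order t01 fp' hw'.
have := H1 _ _ fp'; have := H2 _ _ hw'.
rewrite opprD addNKr enormN addrAC subrr add0r !dotvE; lra.
Qed.

End Fixed.

Section Contact.
Variables (a b : R) (f h : 'rV[R]_d -> \bar R).
Hypothesis fh : dual_pair a b f h.
Let hf := dual_pair_sym fh.
Let fge := dual_pair_fge fh.
Let hge := dual_pair_fge hf.
Let flsc : lower_semicontinuous f. Proof. by case: fh. Qed.
Let hlsc : lower_semicontinuous h. Proof. by case: fh. Qed.

Lemma two_sided_slope_exists t x p : 0 < t < 1 -> touches f h t x p ->
  exists q, two_sided_slope a b f h t x p q.
Proof.
move=> t01 /[dup] fhp [fp hp].
have [q H1] := upper_slope_exists fh t01 fp.
have [q' H2] := upper_slope_exists hf (onem_itv t01) hp.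
exists q; split => //.
rewrite -[q'](opprK) in H2.
by rewrite (slopes_eq fh t01 fhp H1 H2).
Qed.

Lemma two_sided_slope_uniq t x p q q' : 0 < t < 1 -> touches f h t x p ->
  two_sided_slope a b f h t x p q -> two_sided_slope a b f h t x p q' -> q = q'.
Proof. by move=> t01 fhp [H1 _] [_ H2]; exact: (slopes_eq fh t01 fhp H1 H2). Qed.

(** The slope bound is tested at distance 1 from x in the direction of q, where the potentials are
    bounded. *)
Lemma two_sided_slope_bounded t : 0 < t < 1 -> exists B, forall x p q,
  touches f h t x p -> two_sided_slope a b f h t x p q -> enorm q <= B.
Proof.
move=> t01; have /andP[t0 t1] := t01; have t10 : 0 < 1 - t by rewrite subr_gt0.
have b0 : - 2^-1 <= b by case: fh => -[].
have L0 := Lambda_gt0 b0 (onem_itv t01).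
exists ((2 * t)^-1 + (2 * (1 - t))^-1 + 2^-1 * Lambda b (1 - t)) => x p q.
move=> [fp hp] [_ H].
have [->|q0] := eqVneq q 0.
  have : 0 <= (2 * t)^-1 by rewrite invr_ge0 mulr_ge0// ltW.
  have : 0 <= (2 * (1 - t))^-1 by rewrite invr_ge0 mulr_ge0// ltW.
  by rewrite enorm0; lra.
have n0 := enorm_gt0 q0.
have [p' [+ _ p1]] := hl_inf_bounds fge x t01; rewrite fp => -[pp']; subst p'.
pose y := x + (enorm q)^-1 *: q.
have [w [hw _ w1]] := hl_inf_bounds hge y (onem_itv t01).
have := H y w hw; rewrite /y addrAC subrr add0r dotvNl dotvZr -sqr_enorm.
rewrite opprD addNKr enormN enormZ gtr0_norm ?invr_gt0//.
rewrite [_^-1 * _ ^+ 2](_ : _ = enorm q); last by field; rewrite gt_eqF.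
rewrite [_^-1 * enorm q](_ : _ = 1); last by field; rewrite gt_eqF.
have : - (2 * (1 - t))^-1 <= p.
  by rewrite lerNl -[_^-1]mul1r ler_pdivlMr ?mulr_gt0//; lra.
have : - (2 * t)^-1 <= w.
  by rewrite lerNl -[_^-1]mul1r ler_pdivlMr ?mulr_gt0//; lra.
rewrite expr1n; lra.
Qed.

(* Comparing the two one-sided expansions at a third point at distance |x - y|
   from y, in the direction of q' - q. *)
Lemma two_sided_slope_lipschitz t x y p p' q q' : 0 < t < 1 ->
  touches f h t x p -> two_sided_slope a b f h t x p q ->
  touches f h t y p' -> two_sided_slope a b f h t y p' q' ->
  enorm (q - q') <= 2 * (Lambda a t + Lambda b (1 - t)) * enorm (x - y).
Proof.
move=> t01 [fp hp] [H1 H2] [fp' hp'] [H3 H4].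
have [a0 b0] : - 2^-1 <= a /\ - 2^-1 <= b by case: fh.
have La := Lambda_gt0 a0 t01.
have Lb := Lambda_gt0 b0 (onem_itv t01).
rewrite enormB.
have [->|qq] := eqVneq (q' - q) 0.
  by rewrite enorm0 mulr_ge0 ?enorm_ge0// mulr_ge0// addr_ge0// ltW.
have n0 := enorm_gt0 qq.
have [xy|xy] := eqVneq (x - y) 0.
  have exy : x = y by apply/eqP; rewrite -subr_eq0 xy.
  subst y; move: hp'; rewrite hp => -[/oppr_inj pp']; subst p'.
  by have := two_sided_slope_uniq t01 (conj fp hp) (conj H1 H2) (conj H3 H4) => e;
    rewrite e subrr eqxx in qq.
have m0 := enorm_gt0 xy; set m := enorm (x - y) in m0 *.
pose v := (m / enorm (q' - q)) *: (q' - q).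
have vm : enorm v = m.
  by rewrite /v enormZ ger0_norm ?divr_ge0 ?(ltW m0) ?(ltW n0)// divfK// gt_eqF.
have [r [fr _ _]] := hl_inf_bounds fge (y + v) t01.
have [w [hw _ _]] := hl_inf_bounds hge (y + v) (onem_itv t01).
have o := dual_pair_order fh t01 fr hw.
have h1 := H1 _ _ fr; have h4 := H4 _ _ hw; have h2 := H2 _ _ hp'.
rewrite opprD addNKr enormN vm in h4.
rewrite addrAC subrr add0r in h4.
have e1 : enorm (x - (y + v)) <= 2 * m.
  rewrite opprD addrA; apply: le_trans (ler_enormD _ _) _.
  by rewrite enormN vm -/m; lra.
have e2 : enorm (x - (y + v)) ^+ 2 <= 4 * m ^+ 2.
  by have := enorm_ge0 (x - (y + v)); nra.
have e3 : Lambda a t * enorm (x - (y + v)) ^+ 2 <= Lambda a t * (4 * m ^+ 2).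
  by rewrite ler_pM2l.
have e4 : y + v - x = (y - x) + v by rewrite addrAC.
rewrite e4 dotvDr in h1; rewrite !dotvNl in h2 h4; rewrite -/m in h2.
have e5 : dotv q' v - dotv q v = enorm (q' - q) * m.
  rewrite -[LHS]/(dotv q' v + - dotv q v) -dotvNl -dotvDl /v dotvZr -sqr_enorm.
  by field; rewrite gt_eqF.
have k0 : 0 <= Lambda b (1 - t) * m ^+ 2 by rewrite mulr_ge0 ?sqr_ge0 ?ltW.
rewrite -(ler_pM2r m0); lra.
Qed.

End Contact.
End DualPair.

(** * Transported points: contact, position, gradient, uniqueness *)

Section Transport.
Context {R : realType} {d : nat}.
Implicit Types (x y z q : 'rV[R]_d) (t s r p v w a b k C : R)
  (f h : 'rV[R]_d -> \bar R).

Definition argmin t f x : set 'rV[R]_d :=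
  [set y | hl_ball x y /\ forall z, hl_ball x z ->
     (hl_inf_cost t f x y <= hl_inf_cost t f x z)%E].

(** Collects what ties the contact point x at time s to its image y at time t. It is compatible with
    time reversal, so only t < s has to be treated; the gradients are related without division. *)
Definition partner a b f h s t x p q y r : Prop :=
  [/\ enorm (x - y) < pi / 2,
      touches f h t y r,
      cos2_trunc x y = (1 + 2 * (t - s) * p) * (1 - 2 * (t - s) * r),
      y = x + arctanv (((t - s) / (1 + 2 * (t - s) * p)) *: q) &
      0 < t < 1 -> forall q', two_sided_slope a b f h t y r q' ->
        (1 + 2 * (t - s) * p) *: q' = (1 - 2 * (t - s) * r) *: q].

Lemma onemB t s : 1 - t - (1 - s) = s - t.
Proof. by ring. Qed.

Lemma partner_sym a b f h s t x p q y r :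
  partner b a h f (1 - s) (1 - t) x (- p) (- q) y (- r) ->
  partner a b f h s t x p q y r.
Proof.
rewrite /partner !onemB.
have -> : 1 + 2 * (s - t) * - p = 1 + 2 * (t - s) * p by ring.
have -> : 1 - 2 * (s - t) * - r = 1 - 2 * (t - s) * r by ring.
case=> h1 /touches_sym; rewrite subKr opprK => h2 h3 h4 h5; split => //.
  by rewrite {1}h4 scalerN -scaleNr; congr (_ + arctanv (_ *: _)); ring.
move=> /onem_itv t01 q' /two_sided_slope_sym/(h5 t01).
by rewrite !scalerN => /oppr_inj.
Qed.

Section Optimality.
Variables (a b : R) (f h : 'rV[R]_d -> \bar R).
Hypothesis fh : dual_pair a b f h.
Let hf := dual_pair_sym fh.
Let fge := dual_pair_fge fh.
Let hge := dual_pair_fge hf.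
Let flsc : lower_semicontinuous f. Proof. by case: fh. Qed.
Let hlsc : lower_semicontinuous h. Proof. by case: fh. Qed.

(** The coupling for [h] from time s back to t, compared with the equality at (x, y), gives P_(1-t)
    h(y) <= -r; the order of the potentials gives the converse. *)
Lemma touches_optimal t s x y p r : 0 <= t -> t < s -> s < 1 ->
  touches f h s x p -> hl_inf t f y = r%:E -> enorm (x - y) < pi / 2 ->
  0 < 1 - 2 * (s - t) * p ->
  cos2_trunc x y = (1 - 2 * (s - t) * p) * (1 + 2 * (s - t) * r) ->
  touches f h t y r.
Proof.
move=> t0 ts s1 [fp hp] fr xy N0 e; split=> //.
have ts' : 1 - s < 1 - t by rewrite ltrD2l ltrN2.
have s0' : 0 <= 1 - s by rewrite subr_ge0 ltW.
have t1' : 1 - t <= 1 by rewrite gerBl.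
have up w : hl_inf (1 - t) h y = w%:E -> w <= - r.
  move=> hw; have := hl_inf_semigroup_dual hge hlsc s0' ts' t1' hw hp.
  rewrite onemB cos2_truncC e.
  have -> : 1 + 2 * (s - t) * - p = 1 - 2 * (s - t) * p by ring.
  rewrite mulrC ler_pM2r// => l.
  have sg : 0 < 2 * (s - t) by rewrite mulr_gt0// subr_gt0.
  by rewrite -(ler_pM2l sg); lra.
have [w hw rw] : exists2 w, hl_inf (1 - t) h y = w%:E & - r <= w.
  (* At t = 0 the operator on [h] is P_1, whose finiteness is not automatic: here it is squeezed
     between -r and 1/2. *)
  have [t00|tn0] := eqVneq t 0.
    rewrite t00 hl_inf0 in fr; rewrite t00 subr0.
    have := dual_pair_order0 fh fr.
    have : (hl_inf 1 h y <= ((2 * 1)^-1)%:E)%E.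
      by apply: hl_inf_le => //; rewrite ltr01 lexx.
    case: (hl_inf 1 h y) => [w||]//; rewrite !lee_fin => _ rw.
    by exists w.
  have t01 : 0 < t < 1 by rewrite lt_neqAle eq_sym tn0 t0 (lt_trans ts).
  have [w [hw _ _]] := hl_inf_bounds hge y (onem_itv t01).
  exists w => //; have := dual_pair_order fh t01 fr hw; lra.
by rewrite hw; congr (_%:E); apply/eqP; rewrite eq_le rw up.
Qed.

(** The cost with y frozen touches xi_s from above at x, so its gradient there must be the common
    slope. *)
Lemma optimal_slope t s x y p r q : 0 <= t -> t < s -> s < 1 ->
  touches f h s x p -> two_sided_slope a b f h s x p q ->
  hl_inf t f y = r%:E -> enorm (x - y) < pi / 2 -> 0 < 1 + 2 * (s - t) * r ->
  cos2_trunc x y = (1 - 2 * (s - t) * p) * (1 + 2 * (s - t) * r) ->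
  q = (((s - t) * (1 + 2 * (s - t) * r))^-1
        * (sin (enorm (x - y)) * cos (enorm (x - y)) / enorm (x - y)))
        *: (x - y).
Proof.
move=> t0 ts s1 fhp [_ Hq] fr xy D0 e.
have s01 : 0 < s < 1 by rewrite s1 andbT (le_lt_trans t0).
apply/esym; apply: (slopes_eq fh s01 fhp _ Hq).
exact: (hl_inf_touching fge flsc t0 ts (ltW s1) fhp.1 fr xy D0 e).
Qed.

End Optimality.

Section Partner.
Variables (a b : R) (f h : 'rV[R]_d -> \bar R).
Hypothesis fh : dual_pair a b f h.
Let hf := dual_pair_sym fh.
Let fge := dual_pair_fge fh.
Let hge := dual_pair_fge hf.
Let flsc : lower_semicontinuous f. Proof. by case: fh. Qed.
Let hlsc : lower_semicontinuous h. Proof. by case: fh. Qed.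

Lemma partner_lt t s x y p r q : 0 <= t -> t < s -> s < 1 ->
  touches f h s x p -> two_sided_slope a b f h s x p q ->
  0 < 1 - 2 * (s - t) * p ->
  hl_inf t f y = r%:E -> enorm (x - y) < pi / 2 -> 0 < 1 + 2 * (s - t) * r ->
  cos2_trunc x y = (1 - 2 * (s - t) * p) * (1 + 2 * (s - t) * r) ->
  partner a b f h s t x p q y r.
Proof.
move=> t0 ts s1 fhp Hq N0 fr xy D0 e.
have sg : 0 < s - t by rewrite subr_gt0.
have tch := touches_optimal fh t0 ts s1 fhp fr xy N0 e.
have Eq := optimal_slope fh t0 ts s1 fhp Hq fr xy D0 e.
have -> : partner a b f h s t x p q y r = 
  [/\ enorm (x - y) < pi / 2, touches f h t y r,
      cos2_trunc x y = (1 - 2 * (s - t) * p) * (1 + 2 * (s - t) * r),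
      y = x - arctanv (((s - t) / (1 - 2 * (s - t) * p)) *: q) &
      0 < t < 1 -> forall q', two_sided_slope a b f h t y r q' ->
        (1 - 2 * (s - t) * p) *: q' = (1 + 2 * (s - t) * r) *: q].
  have e1 : t - s = - (s - t) by rewrite opprB.
  have e2 : 1 + 2 * - (s - t) * p = 1 - 2 * (s - t) * p by ring.
  have e3 : 1 - 2 * - (s - t) * r = 1 + 2 * (s - t) * r by ring.
  by rewrite /partner e1 e2 e3 mulNr scaleNr arctanvN.
split=> //.
  (* The product of the two factors is cos^2 th, so the scaled slope is (tan th / th)(x - y), which
     the vector arctangent sends to x - y. *)
  rewrite -[arctanv _](_ : x - y = _) ?subKr//.
  rewrite -[LHS]arctanv_tan//; congr arctanv.
  rewrite Eq scalerA; have [->|xy0] := eqVneq (x - y) 0; first by rewrite !scaler0.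
  congr (_ *: _); rewrite cos2_trunc_in// in e.
  have th0 := enorm_gt0 xy0; have c0 := cos_enorm_gt0 xy.
  have -> : (s - t) / (1 - 2 * (s - t) * p) = (s - t) * (1 + 2 * (s - t) * r)
      / cos (enorm (x - y)) ^+ 2.
    by rewrite e; field; rewrite !gt_eqF.
  by rewrite /tan; field; rewrite !gt_eqF.
move=> t01 q' Hq'.
(* Reversing time exchanges x and y, so [optimal_slope] also expresses q' as a multiple of x - y. *)
have ts' : 1 - s < 1 - t by rewrite ltrD2l ltrN2.
have s0' : 0 <= 1 - s by rewrite subr_ge0 ltW.
have t1' : 1 - t < 1 by rewrite gtrBl; case/andP: t01.
have := optimal_slope hf s0' ts' t1' (touches_sym tch)
  (two_sided_slope_sym Hq') fhp.2 (x := y) (y := x).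
rewrite onemB enormB (cos2_truncC y).
have -> : 1 + 2 * (s - t) * - p = 1 - 2 * (s - t) * p by ring.
have -> : 1 - 2 * (s - t) * - r = 1 + 2 * (s - t) * r by ring.
rewrite [X in _ = X -> _]mulrC => /(_ xy N0 e) /(congr1 -%R); rewrite opprK -scalerN opprB => ->.
rewrite Eq !scalerA; congr (_ *: _).
rewrite ![(s - t) * _]mulrC !invfM !mulrA.
by rewrite !divff ?gt_eqF.
Qed.

(** Uniqueness comes from the position formula in [partner], which depends on x, p and q only.
    Reverse optimality holds because the equality in the coupling is symmetric. *)
Lemma partner_exists_lt t s x p q : 0 <= t -> t < s -> s < 1 ->
  touches f h s x p -> two_sided_slope a b f h s x p q ->
  0 < 1 - 2 * (s - t) * p ->
  exists y, exists r, [/\ partner a b f h s t x p q y r,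
    argmin (s - t) (hl_inf t f) x = [set y] &
    argmin (s - t) (hl_inf (1 - s) h) y x].
Proof.
move=> t0 ts s1 fhp Hq N0.
have [y [r [xy fr D0 e]]] := hl_inf_optimal fge flsc t0 ts s1 fhp.1 N0.
have P := partner_lt t0 ts s1 fhp Hq N0 fr xy D0 e.
exists y, r; split=> //.
  apply/seteqP; split=> [z [xz zmin]|z ->]; last first.
    split; first by rewrite /hl_ball/= enormB.
    move=> z'; rewrite /hl_ball/= enormB.
    by have [_] := hl_inf_minimizer fge flsc t0 ts (ltW s1) fhp.1 fr xy e; apply.
  have xz' : enorm (x - z) < pi / 2 by rewrite enormB.
  have [|r' [fr' D0' e']] :=
    hl_inf_minimizer_eq fge flsc t0 ts s1 fhp.1 N0 xz'.
    by move=> z' h'; apply: zmin; rewrite /hl_ball/= enormB.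
  have [_ _ _ zE _] := partner_lt t0 ts s1 fhp Hq N0 fr' xz' D0' e'.
  by case: P => _ _ _ yE _; rewrite /= zE [RHS]yE.
have ts' : 1 - s < 1 - t by rewrite ltrD2l ltrN2.
have s0' : 0 <= 1 - s by rewrite subr_ge0 ltW.
have t1' : 1 - t <= 1 by rewrite gerBl.
case: P => _ [_ hy] _ _ _; split; first by rewrite /hl_ball/=.
move=> z; rewrite /hl_ball/= enormB => yz.
have := hl_inf_minimizer hge hlsc s0' ts' t1' hy fhp.2.
rewrite onemB enormB cos2_truncC e.
case=> //; last by move=> _; apply.
by ring.
Qed.

(** The value -1/(2(1 - t)) is the least possible. If it is reached, a minimizer z satisfies cos^2 =
    1, so z = x and f(x) = -1/2; conversely the coupling of x with itself forces it. *)
Lemma contact_minus t x : 0 < t < 1 ->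
  (f x = (- 2^-1)%:E <->
   touches f h t x (- (2 * (1 - t))^-1)).
Proof.
move=> t01; have /andP[t0 t1] := t01; have t10 : 0 < 1 - t by rewrite subr_gt0.
have t01' : 0 < t <= 1 by rewrite t0 ltW.
split=> [fx|[fp _]].
  have [p [fp p1 p2]] := hl_inf_bounds fge x t01.
  have [w [hw w1 w2]] := hl_inf_bounds hge x (onem_itv t01).
  have := hl_inf_dual fge t01' fp fx; rewrite cos2_truncxx => e.
  have pe : p = - (2 * (1 - t))^-1.
    apply: (@mulfI _ (2 * (1 - t))); first by rewrite gt_eqF// mulr_gt0.
    rewrite mulrN divff ?gt_eqF ?mulr_gt0//; apply/eqP; rewrite eq_le p2 andbT.
    have l : 1 <= (1 - 2 * t * p) * (1 - t) by lra.
    by rewrite -(ler_pM2l t0); lra.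
  split; first by rewrite fp pe.
  have := dual_pair_order fh t01 fp hw; rewrite hw pe opprK => o.
  congr (_%:E); apply/eqP; rewrite eq_le; apply/andP; split; last by lra.
  by rewrite -[leRHS]mul1r ler_pdivlMr ?mulr_gt0//; lra.
have [|z [r [xz fz D0 e]]] := hl_inf_attained fge flsc t01 fp.
  have : 0 < (2 * (1 - t))^-1 by rewrite invr_gt0 mulr_gt0.
  by nra.
have r1 := fge z; rewrite fz lee_fin in r1.
have e2 : 1 - 2 * t * - (2 * (1 - t))^-1 = (1 - t)^-1 by field; rewrite gt_eqF.
rewrite e2 in e.
have e3 : cos2_trunc x z * (1 - t) = 1 + 2 * t * r.
  by rewrite e; field; rewrite gt_eqF.
have c1 : cos2_trunc x z = 1.
  apply/eqP; rewrite eq_le cos2_trunc_le1/= -(ler_pM2r t10) e3; nra.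
rewrite (cos2_trunc_eq1 c1) fz; congr (_%:E).
by rewrite c1 mul1r in e3; apply: (@mulfI _ (2 * t)); [rewrite gt_eqF// mulr_gt0|lra].
Qed.

(** Here x is a minimum point of xi_t. *)
Lemma slope_minus t x q : 0 < t < 1 -> f x = (- 2^-1)%:E ->
  two_sided_slope a b f h t x (- (2 * (1 - t))^-1) q -> q = 0.
Proof.
move=> t01 fx [H _]; have /andP[t0 t1] := t01.
have t10 : 0 < 1 - t by rewrite subr_gt0.
apply: oppr_inj; rewrite oppr0; apply: (@dotv_le_sqr_eq0 _ _ _ (2^-1 * Lambda a t)) => v.
have [p [fp _ p1]] := hl_inf_bounds fge (x + v) t01.
have := H _ _ fp; rewrite opprD addNKr enormN addrAC subrr add0r dotvNl.
have : - (2 * (1 - t))^-1 <= p.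
  by rewrite lerNl -[_^-1]mul1r ler_pdivlMr ?mulr_gt0//; lra.
lra.
Qed.

End Partner.
End Transport.

(** * Power series for primitives of 1/quadratic and for sqrt(quadratic) *)

Section PowerSeries.
Context {R : realType}.
Implicit Types (c e : nat -> R) (h v w b k z r K M : R) (n : nat) (f : R -> R).

Definition shift_coef c n : R := if n is m.+1 then c m else 0.

Lemma pseries_cvg_shift c h v : pseries c h @ \oo --> v ->
  pseries (shift_coef c) h @ \oo --> h * v.
Proof.
move=> cv; rewrite -cvg_shiftS /=.
rewrite [X in X @ _](_ : _ = fun n => h * pseries c h n).
  exact: cvgMl_tmp.
apply/funext => n; rewrite /pseries/series/= big_nat_recl//= mul0r add0r.
by rewrite mulr_sumr; apply: eq_bigr => i _; rewrite exprS mulrCA.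
Qed.

Lemma pseries_cvgD c e h v w : pseries c h @ \oo --> v ->
  pseries e h @ \oo --> w -> pseries (fun n => c n + e n) h @ \oo --> v + w.
Proof.
move=> cv ew; rewrite [X in X @ _](_ : _ = pseries c h \+ pseries e h).
  exact: cvgD.
apply/funext => n; rewrite /pseries/series/= -big_split/=.
by apply: eq_bigr => i _; rewrite mulrDl.
Qed.

Lemma pseries_cvgZ k c h v : pseries c h @ \oo --> v ->
  pseries (fun n => k * c n) h @ \oo --> k * v.
Proof.
move=> cv; rewrite [X in X @ _](_ : _ = fun n => k * pseries c h n).
  exact: cvgMl_tmp.
apply/funext => n; rewrite /pseries/series/= mulr_sumr.
by apply: eq_bigr => i _; rewrite mulrA.
Qed.

Arguments pseries_cvgZ k {c h v}.

Lemma pseries_cvg1 h : pseries (fun n => (n == 0%N)%:R) h @ \oo --> (1 : R).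
Proof.
rewrite -cvg_shiftS /= [X in X @ _](_ : _ = cst 1); first exact: cvg_cst.
apply/funext => n; rewrite /pseries/series/= big_nat_recl//= expr0 mulr1.
by rewrite big1 ?addr0// => i _; rewrite mul0r.
Qed.

Lemma pseries_is_cvg c M K h : (forall n, `|c n| <= M * K ^+ n) -> 0 <= K ->
  K * `|h| < 1 -> cvgn (pseries c h).
Proof.
move=> cM K0 Kh; apply: normed_cvg.
apply: (@series_le_cvg _ _ (geometric M (K * `|h|))) => [n|n|n|] /=.
- exact: normr_ge0.
- apply: le_trans (normr_ge0 (c n * h ^+ n)) _.
  by rewrite normrM normrX exprMn mulrA ler_wpM2r// exprn_ge0.
- by rewrite normrM normrX exprMn mulrA ler_wpM2r// exprn_ge0.
- by apply: is_cvg_geometric_series; rewrite ger0_norm// mulr_ge0.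
Qed.

(** The factor n + 1 is at most 2^n, which doubles the geometric rate. *)
Lemma pseries_diffs_bound c M K : 0 <= K -> (forall n, `|c n| <= M * K ^+ n) ->
  forall n, `|pseries_diffs c n| <= M * K * (2 * K) ^+ n.
Proof.
move=> K0 cM n; rewrite /pseries_diffs normrM normr_nat.
have M0 : 0 <= M by have := cM 0%N; rewrite expr0 mulr1; apply: le_trans.
apply: le_trans (_ : n.+1%:R * (M * K ^+ n.+1) <= _); first by rewrite ler_wpM2l.
have -> : M * K * (2 * K) ^+ n = 2 ^+ n * (M * K ^+ n.+1).
  by rewrite exprMn exprS; ring.
rewrite ler_wpM2r ?mulr_ge0 ?exprn_ge0// -natrX ler_nat.
exact: ltn_expl.
Qed.

(** Termwise differentiation needs the second derived series to converge at some r beyond |h|; its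
    rate is 4K, whence the radius, and r is the midpoint. *)
Lemma pseries_is_derive c M K h : 0 < K -> (forall n, `|c n| <= M * K ^+ n) ->
  4 * K * `|h| < 1 ->
  [/\ cvgn (pseries c h), cvgn (pseries (pseries_diffs c) h) &
      is_derive h 1 (fun x => limn (pseries c x))
        (limn (pseries (pseries_diffs c) h))].
Proof.
move=> K0 cM Kh; pose r : R := (`|h| + (4 * K)^-1) / 2.
have hr : `|h| < (4 * K)^-1.
  by rewrite -[ltRHS]mul1r ltr_pdivlMr ?mulr_gt0// mulrC.
have r0 : 0 <= r by rewrite divr_ge0// addr_ge0// invr_ge0 mulr_ge0// ltW.
have r1 : `|h| < `|r| by rewrite (ger0_norm r0) ltr_pdivlMr//; lra.
have r2 : 4 * K * `|r| < 1.
  rewrite (ger0_norm r0) mulrC -ltr_pdivlMr ?mulr_gt0// mul1r ltr_pdivrMr//; lra.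
have d1 := pseries_diffs_bound (ltW K0) cM.
have K20 : 0 <= 2 * K by rewrite mulr_ge0// ltW.
have d2 := pseries_diffs_bound K20 d1.
have Kr : 0 <= K * `|r| by rewrite mulr_ge0// ltW.
have Kh0 : 0 <= K * `|h| by rewrite mulr_ge0// ltW.
split; first by apply: (pseries_is_cvg cM (ltW K0)); lra.
  by apply: (pseries_is_cvg d1 K20); lra.
apply: (@pseries_snd_diffs _ c r) => //.
- by apply: (pseries_is_cvg cM (ltW K0)); lra.
- by apply: (pseries_is_cvg d1 K20); lra.
- by apply: (pseries_is_cvg d2); [rewrite mulr_ge0|lra].
Qed.

Lemma limn_pseries0 c : limn (pseries c 0) = c 0%N.
Proof.
apply/cvg_lim => //; rewrite -cvg_shiftS /= [X in X @ _](_ : _ = cst (c 0%N)).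
  exact: cvg_cst.
apply/funext => n; rewrite /pseries/series/= big_nat_recl//= expr0 mulr1.
by rewrite big1 ?addr0// => i _; rewrite exprS mul0r mulr0.
Qed.

Lemma derive0_eq f h : (forall t, 0 <= t <= 1 -> is_derive (t * h) 1 f 0) ->
  f h = f 0.
Proof.
move=> H; have [t t01|t _] := @mvt_segment _ f (fun=> 0) 0 h.
  by rewrite add0r; exact: H.
by rewrite mul0r add0r => /eqP; rewrite subr_eq0 => /eqP.
Qed.

Lemma normrM_le1 (t h : R) : 0 <= t <= 1 -> `|t * h| <= `|h|.
Proof. by case/andP => t0 t1; rewrite normrM ger0_norm// ler_piMl. Qed.

(* Coefficients of z0 / (1 + b h + k h^2); the first component is the previous
   coefficient. *)
Fixpoint quad_inv_state (b k z0 : R) n : R * R :=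
  if n is m.+1 then
    let zs := quad_inv_state b k z0 m in (zs.2, - b * zs.2 - k * zs.1)
  else (0, z0).

Lemma quad_inv_bound b k z0 n : let K := 1 + `|b| + `|k| in
  let zs := quad_inv_state b k z0 n in
  `|zs.1| <= `|z0| * K ^+ n /\ `|zs.2| <= `|z0| * K ^+ n.
Proof.
move=> K; have K1 : 1 <= K by rewrite /K -addrA lerDl addr_ge0.
elim: n => [|n]; first by rewrite /= expr0 mulr1 normr0.
move=> /=; move: (quad_inv_state _ _ _ _) => [u v] /= [u1 v1].
have X0 : 0 <= `|z0| * K ^+ n by exact: le_trans v1.
rewrite exprS mulrCA; set X := `|z0| * _ in u1 v1 X0 *.
split; first by apply: le_trans v1 _; rewrite ler_peMl.
apply: le_trans (ler_normB _ _) _; rewrite !normrM normrN /K.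
have := ler_wpM2l (normr_ge0 b) v1; have := ler_wpM2l (normr_ge0 k) u1; nra.
Qed.

Lemma quad_pos b k h : 4 * (1 + `|b| + `|k|) * `|h| < 1 -> 0 < 1 + b * h + k * h ^+ 2.
Proof.
move=> H; have h0 := normr_ge0 h; have b0 := normr_ge0 b; have k0 := normr_ge0 k.
have hb : - (`|b| * `|h|) <= b * h by rewrite -normrM lerNnormlW.
have hk : - (`|k| * `|h| ^+ 2) <= k * h ^+ 2 by rewrite -normrX -normrM lerNnormlW.
have h1 : `|h| <= 1 by nra.
have : `|k| * `|h| ^+ 2 <= `|k| * `|h| by rewrite ler_wpM2l// expr2 ler_piMl.
nra.
Qed.

(** The series of the quotient is integrated term by term; f and the sum then have the same
    derivative and the same value at 0. *)
Lemma rational_primitive_pseries f b k z0 r : 0 < r ->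
  (forall h, `|h| < r -> is_derive h 1 f (z0 / (1 + b * h + k * h ^+ 2))) ->
  exists2 r', 0 < r' & exists c, forall h, `|h| < r' -> pseries c h @ \oo --> f h.
Proof.
move=> r0 fd; pose K : R := 1 + `|b| + `|k|.
have K1 : 1 <= K by rewrite /K -addrA lerDl addr_ge0.
have K0 : 0 < K by exact: lt_le_trans K1.
pose z n := (quad_inv_state b k z0 n).2.
pose c n := if n is m.+1 then z m / m.+1%:R else f 0.
have cb n : `|c n| <= (`|f 0| + `|z0|) * K ^+ n.
  case: n => [|n] /=; first by rewrite expr0 mulr1 lerDl.
  have [_ zb] := quad_inv_bound b k z0 n; rewrite -/(z n) -/K in zb.
  have X : 0 <= K ^+ n by rewrite exprn_ge0// ltW.
  apply: le_trans (_ : `|z n| <= _).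
    by rewrite normrM ler_piMr// normfV normr_nat invf_le1 ?ler1n ?ltr0n.
  apply: le_trans zb _; rewrite ler_pM//; first by rewrite lerDr.
  by rewrite exprS ler_peMl.
have dz : pseries_diffs c = z.
  by apply/funext => n; rewrite /pseries_diffs/= mulrC divfK.
(* Coefficientwise, the series multiplied by 1 + b h + k h^2 is the constant z0. *)
have rec n : z n + (b * shift_coef z n + k * shift_coef (shift_coef z) n)
    = z0 * (n == 0%N)%:R.
  case: n => [|[|n]] /=; first by rewrite !mulr0 !addr0 mulr1.
    by rewrite /z/=; ring.
  by rewrite /z/=; ring.
pose r' : R := Num.min r (4 * K)^-1.
have r'0 : 0 < r' by rewrite lt_min r0 invr_gt0 mulr_gt0.
exists r' => //; exists c => h; rewrite lt_min => /andP[hr].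
rewrite -[ltRHS]mul1r ltr_pdivlMr ?mulr_gt0// mulrC => hK.
pose S (x : R) : R := limn (pseries c x).
have SD (x : R) : `|x| <= `|h| ->
    is_derive x 1 S (z0 / (1 + b * x + k * x ^+ 2)).
  move=> xh; have xK : 4 * K * `|x| < 1.
    by apply: le_lt_trans hK; rewrite ler_pM2l// mulr_gt0.
  have [_ cv dS] := pseries_is_derive K0 cb xK; rewrite dz in cv dS.
  suff <- : limn (pseries z x) = z0 / (1 + b * x + k * x ^+ 2) by [].
  have Q0 := quad_pos xK.
  apply: (@mulIf _ (1 + b * x + k * x ^+ 2)); first by rewrite gt_eqF.
  rewrite divfK ?gt_eqF//; set v : R := limn _.
  have zv : pseries z x @ \oo --> v := cv.
  have s1 := pseries_cvg_shift zv; have s2 := pseries_cvg_shift s1.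
  have := pseries_cvgD zv (pseries_cvgD (pseries_cvgZ b s1) (pseries_cvgZ k s2)).
  rewrite (_ : (fun n => _) = (fun n => z0 * (n == 0%N)%:R)); last exact/funext.
  move=> A; have B := pseries_cvgZ z0 (pseries_cvg1 x).
  have := cvg_unique _ A B; rewrite mulr1 => <- //; ring.
have [cv _ _] := pseries_is_derive K0 cb hK.
suff -> : f h = S h by exact: cv.
have : (f - S) h = (f - S) 0.
  apply: derive0_eq => t t01; have th := normrM_le1 h t01.
  have D1 := fd _ (le_lt_trans th hr); have D2 := SD _ th.
  by apply: is_derive_eq; rewrite subrr.
rewrite !fctE /S limn_pseries0 /= subrr => /eqP.
by rewrite subr_eq0 => /eqP.
Qed.

(* Taylor coefficients of sqrt (1 + b h + k h^2) at h = 0, from the equation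
   2 Q S' = Q' S; the first component is the previous coefficient. *)
Fixpoint quad_sqrt_state (b k : R) n : R * R :=
  if n is m.+1 then
    let zs := quad_sqrt_state b k m in
    (zs.2, m.+1%:R^-1 * (b * (2^-1 - m%:R) * zs.2 + k * (2 - m%:R) * zs.1))
  else (0, 1).

(** The rate involves |2k| because |2 - n| is only bounded by 2(n + 1), with equality at n = 0. *)
Lemma quad_sqrt_bound b k n : let K := 1 + `|b| + `|2 * k| in
  let zs := quad_sqrt_state b k n in `|zs.1| <= K ^+ n /\ `|zs.2| <= K ^+ n.
Proof.
move=> K; have K1 : 1 <= K by rewrite /K -addrA lerDl addr_ge0.
elim: n => [|n]; first by rewrite /= expr0 normr0 normr1.
move=> /=; move: (quad_sqrt_state _ _ _) => [u v] /= [u1 v1].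
have X0 : 0 <= K ^+ n by exact: le_trans v1.
rewrite exprS; set X := K ^+ n in u1 v1 X0 *.
split; first by apply: le_trans v1 _; rewrite ler_peMl.
rewrite normrM normfV normr_nat ler_pdivrMl ?ltr0n//.
have n0 : 0 <= n%:R :> R by rewrite ler0n.
have nS : n.+1%:R = n%:R + 1 :> R by rewrite -natr1.
have a1 : `|2^-1 - n%:R| <= n.+1%:R :> R by rewrite nS ler_norml; apply/andP; lra.
have a2 : `|2 - n%:R| <= 2 * n.+1%:R :> R by rewrite nS ler_norml; apply/andP; lra.
apply: le_trans (ler_normD _ _) _; rewrite !normrM /K.
have e1 : `|b| * `|2^-1 - n%:R| * `|v| <= `|b| * n.+1%:R * X.
  by rewrite ler_pM ?mulr_ge0// ler_wpM2l.
have e2 : `|k| * `|2 - n%:R| * `|u| <= `|k| * (2 * n.+1%:R) * X.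
  by rewrite ler_pM ?mulr_ge0// ler_wpM2l.
apply: le_trans (lerD e1 e2) _; rewrite normrM normr_nat.
have : 0 <= n.+1%:R * X by rewrite mulr_ge0.
nra.
Qed.

Lemma sqrt_quad_pseries b k : exists2 r, 0 < r & exists c, forall h, `|h| < r ->
  pseries c h @ \oo --> Num.sqrt (1 + b * h + k * h ^+ 2).
Proof.
pose K : R := 1 + `|b| + `|2 * k|.
have K1 : 1 <= K by rewrite /K -addrA lerDl addr_ge0.
have K0 : 0 < K by exact: lt_le_trans K1.
pose c n := (quad_sqrt_state b k n).2.
have cb n : `|c n| <= 1 * K ^+ n by rewrite mul1r; have [] := quad_sqrt_bound b k n.
pose d := pseries_diffs c.
have pc n : (quad_sqrt_state b k n).1 = shift_coef c n by case: n.
have dn n : d n = b * (2^-1 - n%:R) * c n + k * (2 - n%:R) * shift_coef c n.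
  by rewrite /d/pseries_diffs {1}/c/= mulVKf// pc.
(* The equation Q S' = (Q'/2) S, read coefficientwise. *)
have rec n : d n + (b * shift_coef d n + k * shift_coef (shift_coef d) n)
    = b / 2 * c n + k * shift_coef c n.
  rewrite dn; case: n => [|[|n]] /=; first by ring.
    by rewrite /d/pseries_diffs; ring.
  by rewrite /d/pseries_diffs -!natr1; ring.
pose r : R := (4 * K)^-1.
have r0 : 0 < r by rewrite invr_gt0 mulr_gt0.
exists r => //; exists c => h.
rewrite -[ltRHS]mul1r ltr_pdivlMr ?mulr_gt0// mulrC => hK.
pose S (x : R) : R := limn (pseries c x); pose Q (x : R) : R := 1 + b * x + k * x ^+ 2.
have Qp (x : R) : 4 * K * `|x| < 1 -> 0 < Q x.
  move=> xK; apply: quad_pos; apply: le_lt_trans xK.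
  by rewrite ler_wpM2r// ler_pM2l// lerD2l normrM normr_nat ler_peMl// ler1n.
have SD (x : R) : 4 * K * `|x| < 1 ->
    is_derive x 1 S ((b / 2 + k * x) * S x / Q x).
  move=> xK; have [cv cvd dS] := pseries_is_derive K0 cb xK.
  suff <- : limn (pseries d x) = (b / 2 + k * x) * S x / Q x by [].
  have Q0 := Qp _ xK.
  apply: (@mulIf _ (Q x)); first by rewrite gt_eqF.
  rewrite divfK ?gt_eqF//; set v : R := limn _.
  have zv : pseries d x @ \oo --> v := cvd.
  have zS : pseries c x @ \oo --> S x := cv.
  have s1 := pseries_cvg_shift zv; have s2 := pseries_cvg_shift s1.
  have := pseries_cvgD zv (pseries_cvgD (pseries_cvgZ b s1) (pseries_cvgZ k s2)).
  rewrite (_ : (fun n => _) = (fun n => b / 2 * c n + k * shift_coef c n)); last first.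
    exact/funext.
  move=> A; have B := pseries_cvgD (pseries_cvgZ (b / 2) zS)
    (pseries_cvgZ k (pseries_cvg_shift zS)).
  have e := cvg_unique _ A B.
  rewrite /Q; transitivity (v + (b * (x * v) + k * (x * (x * v)))); first by ring.
  by rewrite e//; ring.
have [cv _ _] := pseries_is_derive K0 cb hK.
suff -> : Num.sqrt (1 + b * h + k * h ^+ 2) = S h by exact: cv.
(* S / sqrt Q has derivative 0 by the equation for S, and value 1 at 0. *)
pose G (x : R) : R := S x * (Num.sqrt (Q x))^-1.
have sQ (x : R) : 4 * K * `|x| < 1 -> Num.sqrt (Q x) != 0.
  by move=> /Qp q; rewrite gt_eqF// sqrtr_gt0.
have : G h = G 0.
  apply: derive0_eq => t t01; have th := normrM_le1 h t01.
  have xK : 4 * K * `|t * h| < 1.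
    by apply: le_lt_trans hK; rewrite ler_wpM2l// mulr_ge0// ltW.
  move: (t * h) xK => x xK.
  have D1 := SD _ xK; have Q0 := Qp _ xK; have q0 := sQ _ xK.
  have DQ : is_derive x 1 Q (b + 2 * k * x).
    by rewrite /Q; apply: is_derive_eq; rewrite /GRing.scale/=; ring.
  have DR : is_derive x 1 (Num.sqrt \o Q) ((2 * Num.sqrt (Q x))^-1 * (b + 2 * k * x)).
    by apply: is_derive1_comp; exact: is_derive1_sqrt.
  have DI := @is_deriveV _ (Num.sqrt \o Q) x _ 1 q0 DR.
  have DM := is_deriveM D1 DI; apply: (is_derive_eq DM).
  have sq : Q x = Num.sqrt (Q x) ^+ 2 by rewrite sqr_sqrtr// ltW.
  rewrite /GRing.scale/=; move: sq q0 => ->; rewrite sqrtr_sqr.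
  rewrite ger0_norm ?sqrtr_ge0//; move: (Num.sqrt (Q x)) => y y0; field.
  by rewrite y0.
rewrite /G {2}/S limn_pseries0 {2}/Q mulr0 expr0n/= mulr0 !addr0 sqrtr1 invr1 mulr1.
move=> e; have : S h = S h * (Num.sqrt (Q h))^-1 * Num.sqrt (Q h).
  by rewrite divfK// sQ.
by rewrite e mul1r.
Qed.

Definition pseries_at (A : set R) f t0 : Prop :=
  exists2 r, 0 < r & exists c, forall t, A t -> `|t - t0| < r ->
    pseries c (t - t0) @ \oo --> f t.

(** The transported point moves along a fixed line, so scalar expansions suffice. *)
Lemma analytic_on_affine (W : normedModType R) (A : set R) f (x v : W) :
  (forall t0, A t0 -> pseries_at A f t0) -> analytic_on A (fun t => x + f t *: v).
Proof.
move=> H t0 /H[r r0 [c cP]]; exists r => //.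
exists (fun n => (n == 0%N)%:R *: x + c n *: v) => t At tr.
have -> : series (fun n => (t - t0) ^+ n *: ((n == 0%N)%:R *: x + c n *: v))
    = (fun n => pseries (fun n => (n == 0%N)%:R) (t - t0) n *: x
                + pseries c (t - t0) n *: v).
  apply/funext => n; rewrite /pseries/series/= !scaler_suml -big_split/=.
  by apply: eq_bigr => i _; rewrite scalerDr !scalerA ![_ ^+ _ * _]mulrC.
rewrite -[X in _ --> X + _]scale1r; apply: cvgD; apply: cvgZr_tmp.
  exact: pseries_cvg1.
exact: cP.
Qed.

End PowerSeries.

(** * Differentiability from a two-sided quadratic bound *)

Section Gradient.
Context {R : realType} {d : nat}.
Implicit Types (p x y v : 'rV[R]_d) (C : R).

Fact dotv_is_linear p : linear (dotv p : 'rV[R]_d -> R^o).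
Proof. by move=> k u v; rewrite dotvDr dotvZr. Qed.

HB.instance Definition _ p :=
  GRing.isLinear.Build R 'rV[R]_d R^o *:%R (dotv p) (dotv_is_linear p).

Lemma dotv_continuous p : continuous (dotv p : 'rV[R]_d -> R^o).
Proof.
move=> x; apply/(@cvgrPdist_lt _ _ _ _ (nbhs_filter x)) => e e0.
have e1 : 0 < e / (enorm p + 1) by rewrite divr_gt0// ltr_wpDl// enorm_ge0.
near=> y; have xy : enorm (x - y) < e / (enorm p + 1).
  by near: y; exact: near_enorm.
rewrite -dotvNr -dotvDr; apply: le_lt_trans (normr_dotv_le _ _) _.
apply: le_lt_trans (_ : (enorm p + 1) * enorm (x - y) < _).
  by rewrite ler_wpM2r ?enorm_ge0// lerDl.
by rewrite mulrC -ltr_pdivlMr// ltr_wpDl// enorm_ge0.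
Unshelve. all: by end_near. Qed.

Lemma is_diff_littleo (V W : normedModType R) (F : V -> W) (df : {linear V -> W})
  (x : V) : continuous df ->
  (forall e : R, 0 < e -> \forall h \near (0 : V),
     `|F (h + x) - (F x + df h)| <= e * `|h|) ->
  is_diff x F df.
Proof.
move=> cdf H.
have e : F \o shift x = cst (F x) + df +o_ 0 id by apply/eqaddoP.
have dF : 'd F x = df :> (V -> W) := diff_unique cdf e.
by apply: DiffDef => //; apply/diff_locallyP; rewrite dF; split.
Qed.

Lemma is_diff_quadratic (F : 'rV[R]_d -> R) x p C :
  (forall y, `|F y - F x - dotv p (y - x)| <= C * enorm (x - y) ^+ 2) ->
  is_diff x F (dotv p).
Proof.
move=> H.
apply: (@is_diff_littleo _ R^o F (dotv p) x (@dotv_continuous p)) => eps eps0.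
(* The power of [d] converts the Euclidean norm to the sup norm; the added 1 makes D positive. *)
pose D := `|C| * d%:R ^+ 2 + 1.
have D0 : 0 < D by rewrite ltr_wpDl// mulr_ge0// exprn_ge0.
have e1 : 0 < eps / D by rewrite divr_gt0.
near=> h.
have := H (h + x); rewrite addrK opprD addrCA subrr addr0 enormN.
rewrite opprD addrA => hh; apply: le_trans hh _.
have h1 : enorm h ^+ 2 <= (d%:R * `|h|) ^+ 2.
  by rewrite lerXn2r ?nnegrE ?mulr_ge0 ?enorm_ge0// enorm_le_mx_norm.
apply: le_trans (_ : `|C| * (d%:R * `|h|) ^+ 2 <= _).
  apply: le_trans (_ : `|C| * enorm h ^+ 2 <= _).
    by rewrite ler_wpM2r ?sqr_ge0// ler_norm.
  by rewrite ler_wpM2l.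
have hD : D * `|h| <= eps.
  by rewrite mulrC -ler_pdivlMr//; near: h; exact: nbhs0_le.
rewrite exprMn mulrA expr2 mulrA ler_wpM2r//.
by apply: le_trans hD; rewrite ler_wpM2r// lerDl.
Unshelve. all: by end_near. Qed.

End Gradient.

(** * Addition of arctangents; the triangle inequality in the plane *)

Section Elementary.
Context {R : realType}.
Implicit Types u v a b : R.

(** 1 - uv > 0 says that the cosine of the sum is positive, which confines the sum to the interval
    where [tan] is injective. *)
Lemma atanD u v : 0 < 1 - u * v -> atan u + atan v = atan ((u + v) / (1 - u * v)).
Proof.
move=> uv.
have cu (w : R) : 0 < cos (atan w).
  by apply: cos_gt0_pihalf; rewrite atan_gtNpi2 atan_ltpi2.
have su (w : R) : sin (atan w) = w * cos (atan w).
  by rewrite -{2}[w]atanK /tan divfK// gt_eqF.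
have c0 : 0 < cos (atan u + atan v).
  rewrite cosD !su.
  have -> : cos (atan u) * cos (atan v) - u * cos (atan u) * (v * cos (atan v))
    = cos (atan u) * cos (atan v) * (1 - u * v) by ring.
  by rewrite !mulr_gt0.
have [hu1 hu2] := (atan_gtNpi2 u, atan_ltpi2 u).
have [hv1 hv2] := (atan_gtNpi2 v, atan_ltpi2 v).
have itv : - (pi / 2) < atan u + atan v < pi / 2.
  have dec (w : R) : pi / 2 <= w -> w <= pi -> cos w <= 0.
    move=> w1 w2; have p0 := @pihalf_gt0 R; rewrite -(@cos_pihalf R) leNgt ltr_cos ?in_itv/=.
    - by rewrite -leNgt.
    - by apply/andP; lra.
    - by apply/andP; lra.
  apply/andP; split; rewrite ltNge; apply/negP => h.
    have k : cos (- (atan u + atan v)) <= 0 by apply: dec; lra.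
    by rewrite cosN in k; have := lt_le_trans c0 k; rewrite ltxx.
  have k : cos (atan u + atan v) <= 0 by apply: dec => //; lra.
  by have := lt_le_trans c0 k; rewrite ltxx.
rewrite -[LHS]tanK ?in_itv/=//; congr atan.
by rewrite tanD ?gt_eqF// !atanK.
Qed.

Lemma sqrt_sqrD_lipschitz a b a' b' :
  `|Num.sqrt (a ^+ 2 + b ^+ 2) - Num.sqrt (a' ^+ 2 + b' ^+ 2)|
    <= `|a - a'| + `|b - b'|.
Proof.
wlog suff : a b a' b' / Num.sqrt (a ^+ 2 + b ^+ 2)
    <= Num.sqrt (a' ^+ 2 + b' ^+ 2) + (`|a - a'| + `|b - b'|).
  move=> H; have h1 := H a b a' b'; have h2 := H a' b' a b.
  rewrite (distrC a') (distrC b') in h2.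
  by rewrite ler_norml; apply/andP; split; lra.
set N := Num.sqrt (a' ^+ 2 + _).
have N0 : 0 <= N by exact: sqrtr_ge0.
have N2 : N ^+ 2 = a' ^+ 2 + b' ^+ 2 by rewrite sqr_sqrtr// addr_ge0 ?sqr_ge0.
have bnd (c e : R) : 0 <= e -> c ^+ 2 <= e ^+ 2 -> `|c| <= e.
  by move=> e0 ce; rewrite -(ger0_norm e0) -ler_sqr ?nnegrE// !real_normK ?num_real.
have Na : `|a'| <= N by apply: bnd; rewrite // N2 lerDl sqr_ge0.
have Nb : `|b'| <= N by apply: bnd; rewrite // N2 lerDr sqr_ge0.
set da := `|a - a'|; set db := `|b - b'|.
have da0 : 0 <= da := normr_ge0 _; have db0 : 0 <= db := normr_ge0 _.
have R0 : 0 <= N + (da + db) by rewrite !addr_ge0.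
rewrite -(ger0_norm R0) -sqrtr_sqr ler_wsqrtr//.
have sq (c c' M : R) : `|c'| <= M -> 0 <= M ->
    c ^+ 2 <= c' ^+ 2 + 2 * M * `|c - c'| + `|c - c'| ^+ 2.
  move=> cM M0; rewrite real_normK ?num_real//.
  have : c' * (c - c') <= M * `|c - c'|.
    by apply: le_trans (ler_norm _) _; rewrite normrM ler_wpM2r.
  lra.
have := sq a a' N Na N0; have := sq b b' N Nb N0; rewrite -/da -/db.
have := mulr_ge0 da0 db0; have := mulr_ge0 N0 da0; have := mulr_ge0 N0 db0.
lra.
Qed.

End Elementary.

(** * Formulas for transport and growth at contact points *)

Section ContactCurves.
Context {R : realType} {d : nat}.
Variables (a b : R) (f h : 'rV[R]_d -> \bar R).
Hypothesis fh : dual_pair a b f h.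
Implicit Types (x y z q : 'rV[R]_d) (s t p r : R).

Let hf := dual_pair_sym fh.
Let fge := dual_pair_fge fh.
Let hge := dual_pair_fge hf.
Let flsc : lower_semicontinuous f. Proof. by case: fh. Qed.
Let hlsc : lower_semicontinuous h. Proof. by case: fh. Qed.

Let xi t := hl_inf t f.
Let xibar t := fun x => (- hl_inf (1 - t) h x)%E.
Let g := contact_grad a b xi xibar.
Let T := transport xi xibar.
Let q := growth a b xi xibar.

Lemma touches_contact t x p : touches f h t x p -> contact xi xibar t x.
Proof. by case=> fp hp; rewrite /contact/= /xi /xibar fp hp EFinN oppeK. Qed.

Lemma contact_touches t x : 0 < t < 1 -> contact xi xibar t x ->
  exists p, touches f h t x p.
Proof.
move=> t01; have [p [fp _ _]] := hl_inf_bounds fge x t01.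
rewrite /contact/= /xi /xibar fp => e; exists p; split => //.
by rewrite EFinN -e oppeK.
Qed.

Lemma contact_slopeP t x p k : 0 < t < 1 -> touches f h t x p ->
  contact_slope a b xi xibar t x k <-> two_sided_slope a b f h t x p k.
Proof.
move=> t01 [fp hp]; rewrite /contact_slope /xi /xibar fp hp; split.
  move=> H; split=> [y r fr|y w hw]; have [H1 H2] := H y.
    move: H1; rewrite fr -!EFinB lee_fin; lra.
  move: H2; rewrite hw -!EFinN -!EFinD lee_fin dotvNl; lra.
move=> [H1 H2] y.
have [r [fr _ _]] := hl_inf_bounds fge y t01.
have [w [hw _ _]] := hl_inf_bounds hge y (onem_itv t01).
have h1 := H1 _ _ fr; have h2 := H2 _ _ hw; rewrite dotvNl in h2.
by rewrite fr hw -!EFinN -!EFinD !lee_fin; split; lra.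
Qed.

Lemma grad_slope t x p : 0 < t < 1 -> touches f h t x p ->
  two_sided_slope a b f h t x p (g t x).
Proof.
move=> t01 fhp; apply/(contact_slopeP _ t01 fhp); apply: xgetPex.
have [k Hk] := two_sided_slope_exists fh t01 fhp.
by exists k; apply/(contact_slopeP _ t01 fhp).
Qed.

Lemma grad_unique t x p k : 0 < t < 1 -> touches f h t x p ->
  two_sided_slope a b f h t x p k -> g t x = k.
Proof.
by move=> t01 fhp Hk; have := two_sided_slope_uniq fh t01 fhp (grad_slope t01 fhp) Hk.
Qed.

Lemma touches_bounds t x p : 0 < t < 1 -> touches f h t x p ->
  2 * t * p <= 1 /\ -1 <= 2 * (1 - t) * p.
Proof.
move=> t01 [fp _]; have [r [+ r1 r2]] := hl_inf_bounds fge x t01.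
by rewrite fp => -[pr]; rewrite pr.
Qed.

Lemma contact_plus t x : 0 < t < 1 ->
  (h x = (- 2^-1)%:E <-> touches f h t x (2 * t)^-1).
Proof.
move=> t01; have := contact_minus hf x (onem_itv t01); rewrite subKr => H.
split.
  by move=> /H/touches_sym; rewrite subKr opprK.
by move=> /touches_sym/H.
Qed.

Lemma grad_minus t x : 0 < t < 1 -> f x = (- 2^-1)%:E -> g t x = 0.
Proof.
move=> t01 fx; have fhp := (contact_minus fh x t01).1 fx.
exact: (slope_minus fh t01 fx (grad_slope t01 fhp)).
Qed.

Lemma grad_plus t x : 0 < t < 1 -> h x = (- 2^-1)%:E -> g t x = 0.
Proof.
move=> t01 hx; have fhp := (contact_plus x t01).1 hx.
have := two_sided_slope_sym (grad_slope t01 fhp).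
have {1}-> : (2 * t)^-1 = (2 * (1 - (1 - t)))^-1 by rewrite subKr.
move/(slope_minus hf (onem_itv t01) hx) => /eqP.
by rewrite oppr_eq0 => /eqP.
Qed.

(** The denominator is affine in t and nonnegative at both ends by the bounds on p. It vanishes only
    at an end, and then p is extremal, so x lies in Xi^- or Xi^+. *)
Lemma transport_denom_cases s t x p : 0 < s < 1 -> 0 <= t <= 1 -> touches f h s x p ->
  0 < 1 + 2 * (t - s) * p \/
  1 + 2 * (t - s) * p = 0 /\
    (t = 1 /\ f x = (- 2^-1)%:E \/ t = 0 /\ h x = (- 2^-1)%:E).
Proof.
move=> s01 /andP[t0 t1] fhp; have [p1 p2] := touches_bounds s01 fhp.
have /andP[s0 s1] := s01; have s10 : 0 < 1 - s by rewrite subr_gt0.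
have [D|D] := ltP 0 (1 + 2 * (t - s) * p); [by left|right].
have [ts|ts] := leP s t.
  have t10 : t = 1 by apply/eqP; rewrite eq_le t1/=; nra.
  have pe : p = - (2 * (1 - s))^-1.
    apply: (@mulfI _ (2 * (1 - s))); first by rewrite gt_eqF// mulr_gt0.
    rewrite mulrN divff ?gt_eqF ?mulr_gt0//; apply/eqP; rewrite eq_le p2 andbT.
    by rewrite t10 in D; lra.
  split; first by rewrite t10 pe; field; rewrite gt_eqF.
  by left; split=> //; apply/(contact_minus fh x s01); rewrite -pe.
have t00 : t = 0 by apply/eqP; rewrite eq_le t0 andbT; nra.
have pe : p = (2 * s)^-1.
  apply: (@mulfI _ (2 * s)); first by rewrite gt_eqF// mulr_gt0.
  rewrite divff ?gt_eqF ?mulr_gt0//; apply/eqP; rewrite eq_le p1/=.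
  by rewrite t00 in D; lra.
split; first by rewrite t00 pe; field; rewrite gt_eqF.
by right; split=> //; apply/(contact_plus x s01); rewrite -pe.
Qed.

Lemma transport_denom_ge0 s t x p : 0 < s < 1 -> 0 <= t <= 1 -> touches f h s x p ->
  0 <= 1 + 2 * (t - s) * p.
Proof. by move=> s01 t01 /(transport_denom_cases s01 t01)[/ltW//|[-> _]]. Qed.

Lemma transport_denom_gt0 s t x p : 0 < s < 1 -> 0 < t < 1 -> touches f h s x p ->
  0 < 1 + 2 * (t - s) * p.
Proof.
move=> s01 /andP[t0 t1] fhp.
have [|//|[_ [] [te]]] := transport_denom_cases s01 _ fhp (t := t).
- by rewrite !ltW.
- by rewrite te ltxx in t1.
- by rewrite te ltxx in t0.
Qed.

Lemma optimal_lt s t x : t < s ->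
  optimal xi xibar s t x = argmin (s - t) (hl_inf t f) x.
Proof. by move=> ts; rewrite /optimal ts. Qed.

Lemma hl_sup_costN t (w : 'rV[R]_d -> \bar R) x y :
  hl_sup_cost t (fun z => - w z)%E x y = (- hl_inf_cost t w x y)%E.
Proof.
rewrite /hl_sup_cost /hl_inf_cost muleN oppeK -muleN; congr (_ * _)%E.
by rewrite oppeD ?fin_num_adde_defr// oppeK addeC.
Qed.

Lemma optimal_gt s t x : s < t ->
  optimal xi xibar s t x = argmin (t - s) (hl_inf (1 - t) h) x.
Proof.
move=> st; rewrite /optimal ltNge (ltW st)/= /argmin; apply/seteqP.
by split=> y [xy H]; split=> // z xz; have := H z xz; rewrite !hl_sup_costN leeN2.
Qed.

Lemma partner_exists s t x p : 0 < s < 1 -> 0 <= t <= 1 -> t != s ->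
  touches f h s x p -> 0 < 1 + 2 * (t - s) * p ->
  exists y, exists r, [/\ partner a b f h s t x p (g s x) y r,
    optimal xi xibar s t x = [set y] & optimal xi xibar t s y x].
Proof.
move=> s01 /andP[t0 t1] ts fhp D; have /andP[s0 s1] := s01.
have Hq := grad_slope s01 fhp.
have [lt|lt|e] := ltgtP t s; last by rewrite e eqxx in ts.
  have [|y [r [P o1 o2]]] := partner_exists_lt fh t0 lt s1 fhp Hq.
    by move: D; rewrite -(opprB s) mulrN mulNr.
  by exists y, r; rewrite optimal_lt// optimal_gt.
have t1' : 0 <= 1 - t by rewrite subr_ge0.
have lt' : 1 - t < 1 - s by rewrite ltrD2l ltrN2.
have s1' : 1 - s < 1 by rewrite gtrBl.
have [|y [r [P]]] := partner_exists_lt hf t1' lt' s1' (touches_sym fhp)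
  (two_sided_slope_sym Hq).
  by rewrite onemB mulrN opprK.
rewrite onemB subKr => o1 o2; exists y, (- r); split.
- by apply: partner_sym; rewrite opprK.
- by rewrite optimal_gt.
- by rewrite optimal_lt.
Qed.

Lemma xi_denomE s t x p : touches f h s x p ->
  (1 + (2 * (t - s))%:E * xi s x = (1 + 2 * (t - s) * p)%:E)%E.
Proof. by move=> [fp _]; rewrite /xi fp -EFinM -EFinD. Qed.

Lemma transport_partner s t x p : 0 < s < 1 -> 0 <= t <= 1 -> t != s ->
  touches f h s x p -> 0 < 1 + 2 * (t - s) * p ->
  exists r, [/\ partner a b f h s t x p (g s x) (T s t x) r,
    optimal xi xibar s t x = [set T s t x] & optimal xi xibar t s (T s t x) x].
Proof.
move=> s01 t01 ts fhp D.
have [y [r [P o1 o2]]] := partner_exists s01 t01 ts fhp D.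
suff -> : T s t x = y by exists r.
rewrite /T /transport (negbTE ts) (xi_denomE t fhp) lte_fin D o1.
by apply: xget_unique.
Qed.

(** No positivity is required: the argument of the arctangent is 0 when t = s, and also when the
    denominator vanishes, since then g_s(x) = 0. *)
Lemma transportE s t x p : 0 < s < 1 -> 0 <= t <= 1 -> touches f h s x p ->
  T s t x = x + arctanv (((t - s) / (1 + 2 * (t - s) * p)) *: g s x).
Proof.
move=> s01 t01 fhp; have [->|ts] := eqVneq t s.
  by rewrite subrr mul0r scale0r arctanv0 addr0 /T /transport eqxx.
have [D|[D c]] := transport_denom_cases s01 t01 fhp.
  by have [r [[]]] := transport_partner s01 t01 ts fhp D.
have -> : g s x = 0 by case: c => -[_]; [exact: grad_minus|exact: grad_plus].
by rewrite scaler0 arctanv0 addr0 /T /transport (negbTE ts) (xi_denomE t fhp) D ltxx.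
Qed.

Lemma growthE s t x p : touches f h s x p ->
  q s t x = Num.sqrt ((1 + 2 * (t - s) * p) ^+ 2 + (t - s) ^+ 2 * enorm (g s x) ^+ 2).
Proof. by move=> [fp _]; rewrite /q /growth /xi fp. Qed.

Lemma sqr_growth s t x p : touches f h s x p ->
  q s t x ^+ 2 = (1 + 2 * (t - s) * p) ^+ 2 + (t - s) ^+ 2 * enorm (g s x) ^+ 2.
Proof.
move=> fhp; rewrite (growthE _ fhp) sqr_sqrtr//.
by rewrite addr_ge0 ?sqr_ge0// -exprMn sqr_ge0.
Qed.

(* tan |x - T x| = |tau| |g| / (1 + 2 tau p), hence the two expressions of q^2. *)
Lemma partner_growth s t x p y r : touches f h s x p ->
  0 < 1 + 2 * (t - s) * p ->
  partner a b f h s t x p (g s x) y r ->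
  (1 - 2 * (t - s) * r) * q s t x ^+ 2 = 1 + 2 * (t - s) * p /\
  0 < 1 - 2 * (t - s) * r.
Proof.
move=> fhp D [xy _ e yE _]; rewrite (sqr_growth t fhp).
set D1 := 1 + _ * p in D e yE *; set E := 1 - _ in e *.
have E0 : 0 < E by have := cos2_trunc_gt0 xy; rewrite e pmulr_rgt0.
split=> //.
have th : enorm (x - y) = atan (enorm (((t - s) / D1) *: g s x)).
  by rewrite yE opprD addNKr enormN enorm_arctanv.
have c2 : cos (enorm (x - y)) ^+ 2
    = (1 + ((t - s) / D1) ^+ 2 * enorm (g s x) ^+ 2)^-1.
  rewrite th cos_atan exprVn sqr_sqrtr ?addr_ge0 ?sqr_ge0//.
  by rewrite enormZ exprMn real_normK ?num_real.
rewrite -cos2_trunc_in// e in c2.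
have n0 : 0 < 1 + ((t - s) / D1) ^+ 2 * enorm (g s x) ^+ 2.
  by rewrite ltr_pwDl// -exprMn sqr_ge0.
have {c2} : D1 * E * (1 + ((t - s) / D1) ^+ 2 * enorm (g s x) ^+ 2) = 1.
  by rewrite c2 mulVf// gt_eqF.
by move=> k; rewrite -[RHS]mul1r -k; field; rewrite gt_eqF.
Qed.

(** For |x - y| <= 1 the quadratic term of the slope bound is at most linear; at larger distances
    the boundedness of the potentials suffices. *)
Lemma potential_lipschitz s : 0 < s < 1 -> exists2 L, 0 <= L & forall x y p r,
  touches f h s x p -> touches f h s y r -> `|p - r| <= L * enorm (x - y).
Proof.
move=> s01; have /andP[s0 s1] := s01; have s10 : 0 < 1 - s by rewrite subr_gt0.
have [B HB] := two_sided_slope_bounded fh s01.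
have a0 : - 2^-1 <= a by case: fh => -[].
have L0 := Lambda_gt0 a0 s01.
pose M := (2 * s)^-1 + (2 * (1 - s))^-1.
have M0 : 0 <= M by rewrite addr_ge0// invr_ge0 mulr_ge0// ltW.
pose L := `|B| + 2^-1 * Lambda a s + M.
have kL : 0 <= 2^-1 * Lambda a s by rewrite pmulr_rge0 ?invr_gt0// ltW.
have BL : 0 <= `|B| + 2^-1 * Lambda a s by rewrite addr_ge0.
have L1 : 0 <= L by rewrite addr_ge0.
exists L => //.
suff H x y p r : touches f h s x p -> touches f h s y r ->
    r - p <= L * enorm (x - y).
  move=> x y p r xp yr; have h1 := H _ _ _ _ xp yr; have h2 := H _ _ _ _ yr xp.
  by rewrite (enormB y) in h2; rewrite ler_norml; apply/andP; lra.
move=> xp yr; have n0 := enorm_ge0 (x - y).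
have [n1|n1] := leP 1 (enorm (x - y)).
  have [_ p1] := touches_bounds s01 xp; have [r1 _] := touches_bounds s01 yr.
  have {}p1 : - (2 * (1 - s))^-1 <= p.
    by rewrite lerNl -[_^-1]mul1r ler_pdivlMr ?mulr_gt0//; lra.
  have {}r1 : r <= (2 * s)^-1.
    by rewrite -[_^-1]mul1r ler_pdivlMr ?mulr_gt0//; lra.
  apply: (@le_trans _ _ L); last by rewrite ler_peMr.
  by rewrite /L /M; lra.
have S := grad_slope s01 xp.
have gB := HB _ _ _ xp S.
have [H1 _] := S; have := H1 _ _ yr.1.
have := normr_dotv_le (g s x) (y - x); rewrite (enormB y).
have := ler_norm (dotv (g s x) (y - x)).
have : enorm (g s x) * enorm (x - y) <= `|B| * enorm (x - y).
  by rewrite ler_wpM2r// (le_trans gB)// ler_norm.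
have : 2^-1 * Lambda a s * enorm (x - y) ^+ 2 <= 2^-1 * Lambda a s * enorm (x - y).
  by rewrite ler_wpM2l// expr2 ler_piMl// ltW.
have : 0 <= M * enorm (x - y) by rewrite mulr_ge0.
rewrite /L; lra.
Qed.

End ContactCurves.

(** * Lipschitz bounds, and composition of transports *)

Section Regularity.
Context {R : realType} {d : nat}.
Variables (a b : R) (f h : 'rV[R]_d -> \bar R).
Hypothesis fh : dual_pair a b f h.
Implicit Types (x y z : 'rV[R]_d) (s t p r : R).

Local Notation xi := (fun t => hl_inf t f).
Local Notation xibar := (fun t x => (- hl_inf (1 - t) h x)%E).
Local Notation g := (contact_grad a b xi xibar).
Local Notation T := (transport xi xibar).
Local Notation q := (growth a b xi xibar).

Let fge := dual_pair_fge fh.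
Let hge := dual_pair_fge (dual_pair_sym fh).

Lemma grad_lipschitz s : 0 < s < 1 -> forall x y p r,
  touches f h s x p -> touches f h s y r ->
  enorm (g s x - g s y) <= 2 * (Lambda a s + Lambda b (1 - s)) * enorm (x - y).
Proof.
move=> s01 x y p r xp yr.
exact: (two_sided_slope_lipschitz fh s01 xp (grad_slope fh s01 xp) yr
  (grad_slope fh s01 yr)).
Qed.

Lemma normrB_le1 s t : 0 < s < 1 -> 0 <= t <= 1 -> `|t - s| <= 1.
Proof. by move=> /andP[? ?] /andP[? ?]; rewrite ler_norml; apply/andP; lra. Qed.

Lemma transport_lipschitz_on s t c : 0 < s < 1 -> 0 <= t <= 1 -> 0 < c ->
  exists C, forall x y p r, touches f h s x p -> touches f h s y r ->
    c <= 1 + 2 * (t - s) * p -> c <= 1 + 2 * (t - s) * r ->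
    enorm (T s t x - T s t y) <= C * enorm (x - y).
Proof.
move=> s01 t01 c0.
have [B HB] := two_sided_slope_bounded fh s01.
have [L L0 HL] := potential_lipschitz fh s01.
set G := 2 * (Lambda a s + Lambda b (1 - s)).
(* The 1 is for the base point and the 2 for [arctanv]; inside, the terms come from the variation of
   g and from that of tau / (1 + 2 tau p). *)
exists (1 + 2 * (c^-1 * G + 2 * L / c ^+ 2 * `|B|)) => x y p r xp yr cp cr.
have m0 := enorm_ge0 (x - y); set m := enorm (x - y) in m0 *.
rewrite (transportE fh s01 t01 xp) (transportE fh s01 t01 yr).
set D := 1 + _ * p in cp *; set D' := 1 + _ * r in cr *.
set k := (t - s) / D; set k' := (t - s) / D'.
have D0 : 0 < D := lt_le_trans c0 cp; have D0' : 0 < D' := lt_le_trans c0 cr.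
have ts := normrB_le1 s01 t01.
have gl := grad_lipschitz s01 xp yr; rewrite -/G -/m in gl.
have gB : enorm (g s y) <= `|B|.
  by apply: le_trans (HB _ _ _ yr (grad_slope fh s01 yr)) (ler_norm _).
have kc : `|k| <= c^-1.
  rewrite /k normrM normfV (gtr0_norm D0) -[leRHS]mul1r ler_pM ?invr_ge0 ?(ltW D0)//.
  by rewrite lef_pV2 ?posrE.
have kk : `|k - k'| <= 2 * L / c ^+ 2 * m.
  have -> : k - k' = (t - s) ^+ 2 * (2 * (r - p)) / (D * D').
    by rewrite /k /k' /D /D'; field; rewrite -/D -/D' !gt_eqF.
  rewrite normrM normfV (gtr0_norm (mulr_gt0 D0 D0')) ler_pdivrMr ?mulr_gt0//.
  apply: (@le_trans _ _ (2 * L * m)).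
    rewrite normrM -[leRHS]mul1r ler_pM ?normr_ge0//.
      by rewrite normrX expr_le1.
    by rewrite normrM normr_nat -mulrA ler_pM2l// distrC; exact: HL xp yr.
  rewrite -!mulrA ler_pM2l// ler_wpM2l// mulrCA ler_peMr//.
  rewrite mulrC ler_pdivlMr ?exprn_gt0// mul1r expr2 ler_pM// ltW//.
have -> : x + arctanv (k *: g s x) - (y + arctanv (k' *: g s y))
   = (x - y) + (arctanv (k *: g s x) - arctanv (k' *: g s y)).
  by rewrite opprD addrACA.
apply: le_trans (ler_enormD _ _) _; rewrite -/m mulrDl mul1r lerD2l.
apply: le_trans (arctanv_lipschitz _ _) _; rewrite -[leRHS]mulrA ler_pM2l//.
have -> : k *: g s x - k' *: g s y = k *: (g s x - g s y) + (k - k') *: g s y.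
  by rewrite scalerBr scalerBl addrA subrK.
apply: le_trans (ler_enormD _ _) _; rewrite !enormZ mulrDl lerD//.
  by rewrite -mulrA ler_pM ?enorm_ge0.
by rewrite mulrAC ler_pM ?enorm_ge0.
Qed.

Lemma transport_denom_lower s t : 0 < s < 1 -> 0 < t < 1 ->
  exists2 c, 0 < c & forall x p, touches f h s x p -> c <= 1 + 2 * (t - s) * p.
Proof.
(* For t < s the denominator is t/s + (1 - t/s)(1 - 2sp), hence at least t/s; the other side is the
   mirror image. *)
move=> s01 /andP[t0 t1]; have /andP[s0 s1] := s01.
have s10 : 0 < 1 - s by rewrite subr_gt0.
exists (Num.min (t / s) ((1 - t) / (1 - s))).
  by rewrite lt_min !divr_gt0// subr_gt0.
move=> x p xp; have [p1 p2] := touches_bounds fh s01 xp.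
rewrite ge_min; have [ts|ts] := leP s t; apply/orP; [right|left].
  by rewrite ler_pdivrMr//; nra.
by rewrite ler_pdivrMr//; nra.
Qed.

Lemma transport_lipschitz s t : 0 < s < 1 -> 0 < t < 1 ->
  exists C, elipschitz enorm C (contact xi xibar s) (T s t).
Proof.
move=> s01 t01; have t01' : 0 <= t <= 1 by case/andP: t01 => /ltW-> /ltW->.
have [c c0 cP] := transport_denom_lower s01 t01.
have [C CP] := transport_lipschitz_on s01 t01' c0.
exists C => x y /(contact_touches fh s01)[p xp] /(contact_touches fh s01)[r yr].
exact: (CP x y p r xp yr (cP _ _ xp) (cP _ _ yr)).
Qed.

Lemma transport_locally_lipschitz s t (A : set 'rV[R]_d) :
  0 < s < 1 -> 0 <= t <= 1 ->
  (forall x, A x -> exists2 p, touches f h s x p & 0 < 1 + 2 * (t - s) * p) ->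
  locally_elipschitz enorm A (T s t).
Proof.
move=> s01 t01 HA x /[dup] Ax /HA[p xp D0].
have [L L0 HL] := potential_lipschitz fh s01.
set D := 1 + 2 * (t - s) * p in D0.
have [|C CP] := @transport_lipschitz_on s t (D / 2) s01 t01; first by rewrite divr_gt0.
(* Within this radius the denominator varies by at most 2L D/(4(L + 1)) <= D/2. *)
have l0 : 0 < 4 * (L + 1) by rewrite mulr_gt0// ltr_wpDl.
have e0 : 0 < D / (4 * (L + 1)) by rewrite divr_gt0.
exists [set y | enorm (x - y) < D / (4 * (L + 1))]; first exact: near_enorm.
have lb y r : enorm (x - y) < D / (4 * (L + 1)) -> touches f h s y r ->
    D / 2 <= 1 + 2 * (t - s) * r.
  rewrite ltr_pdivlMr// => xy yr.
  have n0 := enorm_ge0 (x - y).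
  have := HL _ _ _ _ xp yr; have ts := normrB_le1 s01 t01 => pr.
  have : `|(t - s) * (p - r)| <= L * enorm (x - y).
    by rewrite normrM -[leRHS]mul1r ler_pM.
  rewrite ler_norml => /andP[_ k]; rewrite /D in xy *; nra.
exists C => y z [Ay yU] [Az zU].
have [r yr _] := HA _ Ay; have [w zw _] := HA _ Az.
exact: (CP y z r w yr zw (lb _ _ yU yr) (lb _ _ zU zw)).
Qed.

Lemma growth_lipschitz s t : 0 < s < 1 -> 0 <= t <= 1 ->
  exists C, elipschitz Num.norm C (contact xi xibar s) (q s t).
Proof.
move=> s01 t01; have [L L0 HL] := potential_lipschitz fh s01.
exists (2 * L + 2 * (Lambda a s + Lambda b (1 - s))).
move=> x y /(contact_touches fh s01)[p xp] /(contact_touches fh s01)[r yr].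
rewrite (growthE _ _ _ xp) (growthE _ _ _ yr) -!exprMn.
apply: le_trans (sqrt_sqrD_lipschitz _ _ _ _) _.
have ts := normrB_le1 s01 t01; rewrite [leRHS]mulrDl lerD//.
  have -> : 1 + 2 * (t - s) * p - (1 + 2 * (t - s) * r) = 2 * ((t - s) * (p - r)) by ring.
  rewrite normrM normr_nat -[leRHS]mulrA ler_pM2l// normrM -[leRHS]mul1r ler_pM//.
  exact: (HL _ _ _ _ xp yr).
rewrite -mulrBr normrM -[leRHS]mul1r ler_pM//.
apply: le_trans (ler_dist_enorm _ _) _.
exact: (grad_lipschitz s01 xp yr).
Qed.

Lemma growth_bounded s t : 0 < s < 1 -> 0 <= t <= 1 ->
  exists B, forall x, contact xi xibar s x -> `|q s t x| <= B.
Proof.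
move=> s01 t01; have [B HB] := two_sided_slope_bounded fh s01.
have /andP[s0 s1] := s01; have s10 : 0 < 1 - s by rewrite subr_gt0.
exists (1 + 2 * ((2 * s)^-1 + (2 * (1 - s))^-1) + `|B|).
move=> x /(contact_touches fh s01)[p xp]; rewrite (growthE _ _ _ xp) -exprMn.
have := sqrt_sqrD_lipschitz (1 + 2 * (t - s) * p) ((t - s) * enorm (g s x)) 0 0.
rewrite expr0n/= addr0 sqrtr0 !subr0 => k; apply: le_trans k _.
have ts := normrB_le1 s01 t01; have [p1 p2] := touches_bounds fh s01 xp.
have gB : enorm (g s x) <= `|B|.
  by apply: le_trans (HB _ _ _ xp (grad_slope fh s01 xp)) (ler_norm _).
rewrite lerD//; last first.
  by rewrite normrM -[leRHS]mul1r ler_pM// ger0_norm// enorm_ge0.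
apply: le_trans (ler_normD _ _) _; rewrite normr1 lerD2l normrM normrM normr_nat.
rewrite -mulrA ler_pM2l// -[leRHS]mul1r ler_pM//.
have u1 : p <= (2 * s)^-1.
  by rewrite -[_^-1]mul1r ler_pdivlMr ?mulr_gt0//; lra.
have u2 : - (2 * (1 - s))^-1 <= p.
  by rewrite lerNl -[_^-1]mul1r ler_pdivlMr ?mulr_gt0//; lra.
have : 0 < (2 * s)^-1 by rewrite invr_gt0 mulr_gt0.
have : 0 < (2 * (1 - s))^-1 by rewrite invr_gt0 mulr_gt0.
by rewrite ler_norml => *; apply/andP; lra.
Qed.

Lemma growth_gt0 s t x p : touches f h s x p -> 0 < 1 + 2 * (t - s) * p ->
  0 < q s t x.
Proof.
move=> xp D; rewrite (growthE _ _ _ xp) sqrtr_gt0.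
by rewrite ltr_pwDl ?exprn_gt0// -exprMn sqr_ge0.
Qed.

Lemma growth_critical s t x p : 0 < s < 1 -> 0 <= t <= 1 -> touches f h s x p ->
  g s x = 0 -> q s t x = 1 + 2 * (t - s) * p.
Proof.
move=> s01 t01 xp g0; rewrite (growthE _ _ _ xp) g0 enorm0 expr0n/= mulr0 addr0.
by rewrite sqrtr_sqr ger0_norm//; exact: (transport_denom_ge0 fh s01 t01 xp).
Qed.

(* In complex notation w(t) = 1 + 2 (t - t0) p + i (t - t0) |g|, the growth is
   |w| and the displacement is arg w; the claim is w(t2) = w(t1) w'(t2), where
   w' is the same function based at the transported point. *)
Lemma transport_comp t0 t1 t2 x : 0 < t0 < 1 -> 0 < t1 < 1 -> 0 <= t2 <= 1 ->
  contact xi xibar t0 x ->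
  T t1 t2 (T t0 t1 x) = T t0 t2 x /\
  q t1 t2 (T t0 t1 x) * q t0 t1 x = q t0 t2 x.
Proof.
move=> t001 t101 t201 /(contact_touches fh t001)[p xp].
have t101' : 0 <= t1 <= 1 by case/andP: t101 => /ltW-> /ltW->.
have [e|t10] := eqVneq t1 t0.
  have Tx : T t0 t0 x = x by rewrite /transport eqxx.
  rewrite e Tx (growthE _ _ t0 xp) subrr mulr0 mul0r addr0 expr0n/= mul0r addr0.
  by rewrite expr1n sqrtr1 mulr1.
have D1 := transport_denom_gt0 fh t001 t101 xp.
have [r [P _ _]] := transport_partner fh t001 t101' t10 xp D1.
have [E1 E0] := partner_growth xp D1 P.
case: P => _ yr _ yE /(_ t101 _ (grad_slope fh t101 yr)) gE.
set y := T t0 t1 x in yr yE gE *.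
have Q2 := sqr_growth a b t1 xp.
have q0 := growth_gt0 xp D1.
set tau := t1 - t0 in D1 E1 E0 yE gE Q2.
have tau0 : tau != 0 by rewrite subr_eq0.
set n := enorm (g t0 x) in Q2.
pose Q := (1 + 2 * tau * p) ^+ 2 + tau ^+ 2 * n ^+ 2.
have Q0 : 0 < Q by rewrite /Q -Q2 exprn_gt0.
rewrite Q2 -/Q in E1.
have gE' : g t1 y = Q^-1 *: g t0 x.
  apply: (scalerI (a := 1 + 2 * tau * p)); first by rewrite gt_eqF.
  rewrite gE scalerA -[in RHS]E1; congr (_ *: _); field; rewrite gt_eqF//.
(* With [gE'], these are the real and imaginary parts of 2r + i n/Q = (2p + i n)/w(t1). *)
have r2 : 2 * r = (2 * p * (1 + 2 * tau * p) + tau * n ^+ 2) / Q.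
  apply: (@mulfI _ tau) => //.
  have -> : tau * (2 * r) = 1 - (1 + 2 * tau * p) / Q.
    by rewrite -E1 mulfK ?gt_eqF//; ring.
  have Qn : Q != 0 by rewrite gt_eqF.
  have -> : 1 - (1 + 2 * tau * p) / Q = (Q - (1 + 2 * tau * p)) / Q by field.
  by rewrite [RHS]mulrA; congr (_ / Q); rewrite /Q; ring.
have A2 : 1 + 2 * (t2 - t1) * r
    = (Q + (t2 - t1) * (2 * p * (1 + 2 * tau * p) + tau * n ^+ 2)) / Q.
  have -> : 2 * (t2 - t1) * r = (t2 - t1) * (2 * r) by ring.
  by rewrite r2; field; rewrite gt_eqF.
have n1 : enorm (g t1 y) = n / Q.
  by rewrite gE' enormZ gtr0_norm ?invr_gt0// mulrC.
split; last first.
  rewrite (growthE _ _ _ yr) (growthE _ _ _ xp) (growthE _ _ _ xp).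
  rewrite -sqrtrM; last by rewrite -exprMn addr_ge0 ?sqr_ge0.
  congr Num.sqrt; rewrite n1 A2 -/tau -/n -/Q.
  have -> : t2 - t0 = tau + (t2 - t1) by rewrite /tau; ring.
  have -> : ((Q + (t2 - t1) * (2 * p * (1 + 2 * tau * p) + tau * n ^+ 2)) / Q) ^+ 2
      + (t2 - t1) ^+ 2 * (n / Q) ^+ 2
    = ((Q + (t2 - t1) * (2 * p * (1 + 2 * tau * p) + tau * n ^+ 2)) ^+ 2
      + (t2 - t1) ^+ 2 * n ^+ 2) / Q ^+ 2 by field; rewrite gt_eqF.
  rewrite -/Q; apply: (@mulIf _ Q); rewrite ?gt_eqF//.
  have -> X : X / Q ^+ 2 * Q * Q = X by field; rewrite gt_eqF.
  by rewrite /Q; ring.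
rewrite (transportE fh t101 t201 yr) (transportE fh t001 t201 xp) {1}yE.
(* Only when the gradient is 0 can a denominator at time t2 vanish. *)
have [g0|gn0] := eqVneq (g t0 x) 0.
  by rewrite gE' g0 !scaler0 arctanv0 !addr0.
have n0 : 0 < n := enorm_gt0 gn0.
have D3 : 0 < 1 + 2 * (t2 - t0) * p.
  have [//|[_ []]] := transport_denom_cases fh t001 t201 xp; case=> _ /= k.
    by rewrite (grad_minus fh t001 k) eqxx in gn0.
  by rewrite (grad_plus fh t001 k) eqxx in gn0.
have D2 : 0 < 1 + 2 * (t2 - t1) * r.
  have [//|[_ []]] := transport_denom_cases fh t101 t201 yr; case=> _ /= k.
    have := grad_minus fh t101 k; rewrite gE' => /eqP.
    by rewrite scaler_eq0 invr_eq0 gt_eqF// (negbTE gn0).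
  have := grad_plus fh t101 k; rewrite gE' => /eqP.
  by rewrite scaler_eq0 invr_eq0 gt_eqF// (negbTE gn0).
rewrite gE' scalerA -addrA; congr (_ + _).
have AZ k : arctanv (k *: g t0 x) = (atan (k * n) / n) *: g t0 x.
  rewrite /arctanv enormZ -/n scalerA; congr (_ *: _).
  have [->|k0] := eqVneq k 0; first by rewrite mul0r atan0 !mul0r mulr0.
  have [kp|kn] := ltP 0 k.
    by rewrite gtr0_norm//; field; rewrite !gt_eqF.
  by rewrite ler0_norm// mulNr atanN; field; rewrite k0 gt_eqF.
rewrite !AZ -scalerDl -mulrDl; congr ((_ / n) *: _).
have tau3 : t2 - t0 = tau + (t2 - t1) by rewrite /tau; ring.
rewrite tau3 in D3 *; move: (t2 - t1) A2 D2 D3 => tau2 A2 D2 D3.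
set D := 1 + 2 * tau * p in D1 A2; set A := 1 + 2 * tau2 * r in A2 D2 *.
pose M := Q + tau2 * (2 * p * D + tau * n ^+ 2).
have AM : A = M / Q by [].
have M0 : 0 < M by move: D2; rewrite AM pmulr_lgt0 ?invr_gt0.
have e1 : D * M - tau * tau2 * n ^+ 2 = (1 + 2 * (tau + tau2) * p) * Q.
  by rewrite /M /Q /D; ring.
have e2 : tau * M + tau2 * D = (tau + tau2) * Q by rewrite /M /Q /D; ring.
have -> : tau2 / A / Q = tau2 / M by rewrite AM; field; rewrite !gt_eqF.
set D' := 1 + _ * p in D3 e1 *.
have e3 : 1 - tau / D * n * (tau2 / M * n) = D' * Q / (D * M).
  by rewrite -e1; field; rewrite !gt_eqF.
(* The positivity required is that of D' Q / (D M): the arguments of the complex factors add up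
   without wrapping around. *)
rewrite atanD; last by rewrite e3 divr_gt0 ?mulr_gt0.
congr atan; rewrite e3.
have -> : tau / D * n + tau2 / M * n = n * (tau * M + tau2 * D) / (D * M).
  by field; rewrite !gt_eqF.
by rewrite e2; field; rewrite !gt_eqF.
Qed.

End Regularity.

(** * Power series of the angle and modulus of a point moving on a line *)

Section AnalyticMobius.
Context {R : realType}.
Implicit Types (A B c e h s t p n : R) (D : set R).

Lemma is_derive_affine c e x : is_derive x (1 : R) (fun h => c + e * h) e.
Proof. by apply: is_derive_eq; rewrite /GRing.scale/=; ring. Qed.

Lemma is_derive_atan_ratio A B c e h : A + c * h != 0 ->
  is_derive h 1 (fun u => atan ((B + e * u) / (A + c * u)))
    ((e * A - c * B) / ((A + c * h) ^+ 2 + (B + e * h) ^+ 2)).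
Proof.
move=> A0; have dA := is_derive_affine A c h; have dB := is_derive_affine B e h.
have dV := @is_deriveV _ (fun u => A + c * u) h _ 1 A0 dA.
have dM := is_deriveM dB dV.
have dC := is_derive1_comp (is_derive1_atan _) dM.
apply: (is_derive_eq dC); rewrite /GRing.scale/= !fctE.
have Q0 : (A + c * h) ^+ 2 + (B + e * h) ^+ 2 != 0.
  by rewrite gt_eqF// ltr_pwDl ?sqr_ge0// lt_neqAle sqr_ge0 andbT eq_sym sqrf_eq0.
have -> : 1 + ((B + e * h) / (A + c * h)) ^+ 2
    = ((A + c * h) ^+ 2 + (B + e * h) ^+ 2) / (A + c * h) ^+ 2 by field.
by field; rewrite Q0 A0.
Qed.

Lemma pseries_at_cst D c t0 : pseries_at D (fun=> c) t0.
Proof.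
exists 1 => //; exists (fun i : nat => c * (i == 0%N)%:R) => t _ _.
by have := pseries_cvgZ (k := c) (pseries_cvg1 (t - t0)); rewrite mulr1.
Qed.

Lemma pseries_at_affine D c e t0 : pseries_at D (fun t => c + e * t) t0.
Proof.
exists 1 => //; exists (fun i : nat => (c + e * t0) * (i == 0%N)%:R
  + e * shift_coef (fun j : nat => (j == 0%N)%:R) i) => t _ _.
have := pseries_cvgD (pseries_cvgZ (k := c + e * t0) (pseries_cvg1 (t - t0)))
  (pseries_cvgZ (k := e) (pseries_cvg_shift (pseries_cvg1 (t - t0)))).
rewrite !mulr1; suff -> : c + e * t0 + e * (t - t0) = c + e * t by [].
by ring.
Qed.

Lemma pseries_at_eq D (f k : R -> R) t0 : (forall t, D t -> f t = k t) ->
  pseries_at D k t0 -> pseries_at D f t0.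
Proof.
move=> fk [r r0 [c cP]]; exists r => //; exists c => t Dt tr.
by rewrite fk//; exact: cP.
Qed.

(** The derivative of an angle along a line is a constant over a quadratic; dividing by Q, the
    quadratic at t0, gives the form of [rational_primitive_pseries]. The radius keeps A + 2 p u
    positive. *)
Lemma pseries_at_atan D s p n t0 : 0 < 1 + 2 * (t0 - s) * p ->
  pseries_at D (fun t => atan ((t - s) * n / (1 + 2 * (t - s) * p))) t0.
Proof.
move=> A0; set A := 1 + _ in A0; pose B := (t0 - s) * n.
pose Q := A ^+ 2 + B ^+ 2.
have Q0 : 0 < Q by rewrite ltr_pwDl ?sqr_ge0 ?exprn_gt0.
pose F u := atan ((B + n * u) / (A + 2 * p * u)).
have p1 : 0 < `|2 * p| + 1 by rewrite ltr_wpDl.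
have r0 : 0 < A / (`|2 * p| + 1) by rewrite divr_gt0.
have [h hr|r' r'0 [c cP]] := @rational_primitive_pseries _ F
    ((4 * p * A + 2 * n * B) / Q) ((4 * p ^+ 2 + n ^+ 2) / Q) (n / Q) _ r0.
  rewrite ltr_pdivlMr// in hr.
  have Ah : 0 < A + 2 * p * h.
    have : - (`|2 * p| * `|h|) <= 2 * p * h by rewrite -normrM lerNnormlW.
    by have := normr_ge0 h; nra.
  have H := @is_derive_atan_ratio A B (2 * p) n h _.
  apply: (is_derive_eq (H _)); first by rewrite gt_eqF.
  have Qh : 0 < (A + 2 * p * h) ^+ 2 + (B + n * h) ^+ 2.
    by rewrite ltr_pwDl ?sqr_ge0 ?exprn_gt0.
  have -> : 1 + (4 * p * A + 2 * n * B) / Q * h + (4 * p ^+ 2 + n ^+ 2) / Q * h ^+ 2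
    = ((A + 2 * p * h) ^+ 2 + (B + n * h) ^+ 2) / Q.
    apply: (@mulIf _ Q); first by rewrite gt_eqF.
    rewrite divfK ?gt_eqF// !mulrDl mul1r -![_ / Q * _ * Q]mulrAC !divfK ?gt_eqF//.
    by rewrite /Q; ring.
  have -> : n * A - 2 * p * B = n by rewrite /A /B; ring.
  by field; rewrite !gt_eqF.
exists r' => //; exists c => t _ tr; have := cP _ tr.
suff -> : F (t - t0) = atan ((t - s) * n / (1 + 2 * (t - s) * p)) by [].
rewrite /F; congr (atan (_ / _)); first by rewrite /B; ring.
by rewrite /A; ring.
Qed.

Lemma pseries_at_sqrt D s p n t0 : 0 < 1 + 2 * (t0 - s) * p ->
  pseries_at D (fun t => Num.sqrt ((1 + 2 * (t - s) * p) ^+ 2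
                                   + (t - s) ^+ 2 * n ^+ 2)) t0.
Proof.
move=> A0; set A := 1 + _ in A0; pose B := (t0 - s) * n.
pose Q := A ^+ 2 + B ^+ 2.
have Q0 : 0 < Q by rewrite ltr_pwDl ?sqr_ge0 ?exprn_gt0.
have [r r0 [c cP]] := sqrt_quad_pseries ((4 * p * A + 2 * n * B) / Q)
  ((4 * p ^+ 2 + n ^+ 2) / Q).
exists r => //; exists (fun i : nat => Num.sqrt Q * c i) => t _ tr.
have := pseries_cvgZ (k := Num.sqrt Q) (cP _ tr).
rewrite -sqrtrM ?(ltW Q0)//.
set X := _ * (_ + _); suff -> : X = (1 + 2 * (t - s) * p) ^+ 2 + (t - s) ^+ 2 * n ^+ 2.
  by [].
rewrite /X !mulrDr mulr1 ![Q * (_ / Q * _)]mulrA ![Q * (_ / Q)]mulrC.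
rewrite !divfK ?gt_eqF// /Q /A /B; ring.
Qed.

End AnalyticMobius.

(** * Analyticity in time up to the end points *)

Section AnalyticTransport.
Context {R : realType} {d : nat}.
Variables (a b : R) (f h : 'rV[R]_d -> \bar R).
Hypothesis fh : dual_pair a b f h.
Implicit Types (x y z : 'rV[R]_d) (s t p r : R).

Local Notation xi := (fun t => hl_inf t f).
Local Notation xibar := (fun t x => (- hl_inf (1 - t) h x)%E).
Local Notation g := (contact_grad a b xi xibar).
Local Notation T := (transport xi xibar).
Local Notation q := (growth a b xi xibar).

Lemma arctanvZ k (w : 'rV[R]_d) :
  arctanv (k *: w) = atan (enorm w * k) *: ((enorm w)^-1 *: w).
Proof.
have [->|w0] := eqVneq w 0; first by rewrite !scaler0 arctanv0.
have n0 := enorm_gt0 w0; rewrite /arctanv enormZ !scalerA; congr (_ *: _).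
have [->|k0] := eqVneq k 0; first by rewrite !(mulr0, mul0r, atan0, normr0).
have [kp|kn] := ltP 0 k.
  by rewrite gtr0_norm// (mulrC k); field; rewrite !gt_eqF.
by rewrite ler0_norm// mulNr atanN (mulrC k); field; rewrite k0 gt_eqF.
Qed.

Lemma analytic_on_eq (W : normedModType R) (A : set R) (F G : R -> W) :
  (forall t, A t -> F t = G t) -> analytic_on A G -> analytic_on A F.
Proof.
move=> FG H t0 /H[r r0 [c cP]]; exists r => //; exists c => t At tr.
by rewrite FG//; exact: cP.
Qed.

Lemma itv01P t : `[0, 1]%classic t -> 0 <= t <= 1.
Proof. by rewrite /= in_itv. Qed.

Lemma transport_denom_gt0_noncritical s t x p : 0 < s < 1 -> 0 <= t <= 1 ->
  touches f h s x p -> g s x != 0 -> 0 < 1 + 2 * (t - s) * p.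
Proof.
move=> s01 t01 xp g0; have [//|[_ []]] := transport_denom_cases fh s01 t01 xp; case=> _ k.
  by rewrite (grad_minus fh s01 k) eqxx in g0.
by rewrite (grad_plus fh s01 k) eqxx in g0.
Qed.

Lemma transport_analytic s x : 0 < s < 1 -> contact xi xibar s x ->
  analytic_on `[0, 1] (fun t => T s t x).
Proof.
move=> s01 /(contact_touches fh s01)[p xp].
pose n := enorm (g s x).
(* When g = 0 the curve is constant although the denominator may vanish at an end; otherwise the
   denominator is positive on [0, 1]. *)
pose F t := if g s x == 0 then 0 else atan ((t - s) * n / (1 + 2 * (t - s) * p)).
apply: (@analytic_on_eq _ _ _ (fun t => x + F t *: (n^-1 *: g s x))).
  move=> t /itv01P t01; rewrite (transportE fh s01 t01 xp) arctanvZ /F /n.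
  have [->|_] := eqVneq (g s x) 0; first by rewrite !scaler0.
  by congr (_ + atan _ *: _); ring.
apply: analytic_on_affine => t0 /itv01P t001; rewrite /F.
have [_|g0] := eqVneq (g s x) 0; first exact: pseries_at_cst.
apply: pseries_at_atan; exact: (transport_denom_gt0_noncritical s01 t001 xp g0).
Qed.

Lemma growth_analytic s x : 0 < s < 1 -> contact xi xibar s x ->
  analytic_on `[0, 1] (fun t => q s t x : R^o).
Proof.
move=> s01 /(contact_touches fh s01)[p xp].
apply: (@analytic_on_eq R^o _ _ (fun t => 0 + q s t x *: (1 : R^o))).
  by move=> t _; rewrite add0r [RHS]mulr1.
apply: analytic_on_affine => t0 /itv01P t001.
(* At a critical point the radicand is a square that may vanish at an end time; the root is
   nevertheless affine, because 1 + 2 tau p >= 0. *)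
have [g0|g0] := eqVneq (g s x) 0.
  apply: (@pseries_at_eq _ _ _ (fun t => (1 - 2 * s * p) + (2 * p) * t)).
    move=> t /itv01P t01; rewrite (growth_critical fh s01 t01 xp g0); ring.
  exact: pseries_at_affine.
apply: (@pseries_at_eq _ _ _ (fun t => Num.sqrt ((1 + 2 * (t - s) * p) ^+ 2
    + (t - s) ^+ 2 * enorm (g s x) ^+ 2))).
  by move=> t _; rewrite (growthE _ _ t xp).
apply: pseries_at_sqrt; exact: (transport_denom_gt0_noncritical s01 t001 xp g0).
Qed.

End AnalyticTransport.

Lemma dual_pair_le0 {R : realType} {d : nat} (a b : R) (f h : 'rV[R]_d -> \bar R)
  (fh : dual_pair a b f h) (x : 'rV[R]_d) : (- hl_inf 1 h x <= f x)%E.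
Proof.
have [->|[r fx _]] := f_cases (dual_pair_fge fh) x; first exact: leey.
by rewrite fx leeNl -EFinN; exact: (dual_pair_order0 fh fx).
Qed.

Lemma dual_pair_le {R : realType} {d : nat} (a b : R) (f h : 'rV[R]_d -> \bar R)
  (fh : dual_pair a b f h) (t : R) (x : 'rV[R]_d) : 0 <= t <= 1 ->
  (- hl_inf (1 - t) h x <= hl_inf t f x)%E.
Proof.
move=> /andP[t0 t1].
have [->|tn0] := eqVneq t 0; first by rewrite subr0 hl_inf0 (dual_pair_le0 fh).
have [->|tn1] := eqVneq t 1.
  by rewrite subrr hl_inf0 leeNl (dual_pair_le0 (dual_pair_sym fh)).
have t01 : 0 < t < 1 by rewrite lt_neqAle eq_sym tn0 t0 lt_neqAle tn1.
have [p [fp _ _]] := hl_inf_bounds (dual_pair_fge fh) x t01.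
have [w [hw _ _]] := hl_inf_bounds (dual_pair_fge (dual_pair_sym fh)) x (onem_itv t01).
rewrite fp hw -EFinN lee_fin; have := dual_pair_order fh t01 fp hw; lra.
Qed.

Lemma ereal_between {R : realType} (x y : \bar R) : (x < y)%E ->
  exists c : R, (x < c%:E)%E /\ (c%:E < y)%E.
Proof.
case: x y => [x||] [y||] //=; rewrite ?ltNge ?leey ?leNye// -?ltNge => xy.
- exists ((x + y) / 2); rewrite lte_fin in xy; rewrite !lte_fin; split; lra.
- by exists (x + 1); rewrite lte_fin ltrDl ltry.
- by exists (y - 1); rewrite lte_fin gtrBl ltNyr.
- by exists 0; rewrite ltNyr ltry.
Qed.

(** * Closure of the contact sets *)

Section ContactClosure.
Context {R : realType} {d : nat}.
Variables (a b : R) (f h : 'rV[R]_d -> \bar R).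
Hypothesis fh : dual_pair a b f h.
Implicit Types (x y z : 'rV[R]_d) (s t p r : R).

Local Notation xi := (fun t => hl_inf t f).
Local Notation xibar := (fun t x => (- hl_inf (1 - t) h x)%E).

Let hf := dual_pair_sym fh.
Let fge := dual_pair_fge fh.
Let hge := dual_pair_fge hf.
Let flsc : lower_semicontinuous f. Proof. by case: fh. Qed.
Let hlsc : lower_semicontinuous h. Proof. by case: fh. Qed.

Lemma hl_inf_lsc_near t x c : 0 <= t <= 1 ->
  (t = 1 -> forall y, f y = (- 2^-1)%:E -> enorm (x - y) <> pi / 2) ->
  (c%:E < hl_inf t f x)%E -> \forall x' \near x, (c%:E < hl_inf t f x')%E.
Proof.
move=> /andP[t0 t1] exc cx; have [te|tn0] := eqVneq t 0.
  rewrite te hl_inf0 in cx; have [V Vx VP] := flsc cx.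
  by apply: filterS Vx => y /VP; rewrite te hl_inf0.
have t01 : 0 < t <= 1 by rewrite lt_neqAle eq_sym tn0 t0.
have [c' cc' H] := hl_inf_lsc_at fge flsc t01 exc cx.
by apply: filterS H => y; apply: lt_le_trans; rewrite lte_fin.
Qed.

End ContactClosure.

(** Off the contact set some real c separates xibar_t(x) < c < xi_t(x), and lower semicontinuity of
    both infima keeps c separating nearby. *)
Lemma contact_closure {R : realType} {d : nat} (a b : R) (f h : 'rV[R]_d -> \bar R)
  (fh : dual_pair a b f h) (t : R) (x : 'rV[R]_d) : 0 <= t <= 1 ->
  (t = 1 -> forall y, f y = (- 2^-1)%:E -> enorm (x - y) <> pi / 2) ->
  (t = 0 -> forall y, h y = (- 2^-1)%:E -> enorm (x - y) <> pi / 2) ->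
  closure (contact (fun t => hl_inf t f) (fun t x => - hl_inf (1 - t) h x)%E t) x ->
  contact (fun t => hl_inf t f) (fun t x => - hl_inf (1 - t) h x)%E t x.
Proof.
move=> t01 e1 e0 cl; rewrite /contact/=; apply/eqP; rewrite eq_le.
rewrite (dual_pair_le fh)//= leNgt; apply/negP => /ereal_between[c [c1 c2]].
have t01' : 0 <= 1 - t <= 1 by case/andP: t01 => ? ?; apply/andP; lra.
have N1 := hl_inf_lsc_near fh t01 e1 c2.
have c1' : ((- c)%:E < hl_inf (1 - t) h x)%E by rewrite EFinN lteNl.
have e0' : 1 - t = 1 -> forall y, h y = (- 2^-1)%:E -> enorm (x - y) <> pi / 2.
  by move=> te; apply: e0; lra.
have N2 := hl_inf_lsc_near (dual_pair_sym fh) t01' e0' c1'.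
have [y [/= yc [y1 y2]]] := cl _ (filterI N1 N2).
by move: y2; rewrite EFinN lteNl /contact/= in yc *; rewrite yc ltNge (ltW y1).
Qed.

(** * The individual assertions for a dual pair *)

Section Conclusions.
Context {R : realType} {d : nat}.
Variables (a b : R) (f h : 'rV[R]_d -> \bar R).
Hypothesis fh : dual_pair a b f h.
Implicit Types (x y z : 'rV[R]_d) (s t p r : R).

Local Notation xi := (fun t => hl_inf t f).
Local Notation xibar := (fun t x => (- hl_inf (1 - t) h x)%E).
Local Notation g := (contact_grad a b xi xibar).
Local Notation T := (transport xi xibar).
Local Notation q := (growth a b xi xibar).
Local Notation contact := (contact xi xibar).

Let hf := dual_pair_sym fh.
Let fge := dual_pair_fge fh.
Let hge := dual_pair_fge hf.

Lemma contact_closed t : 0 < t < 1 -> closed (contact t).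
Proof.
move=> /andP[t0 t1] x; apply: (contact_closure fh).
- by rewrite !ltW.
- by move=> te; rewrite te ltxx in t1.
- by move=> te; rewrite te ltxx in t0.
Qed.

(** Points outside the contact set can occur here. For d >= 1, let xi_0 be -1/2 at the origin and
    +oo elsewhere, and xibar_1 = -oo: then Xi_1 is the open ball of radius pi/2. Time reversal gives
    the case t = 0. *)
Lemma contact_closure0 : closure (contact 0) `<=`
  contact 0 `|` [set x | exists2 y, h y = (- 2^-1)%:E & enorm (x - y) = pi / 2].
Proof.
move=> x cl; apply: contrapT => /not_orP[nc ne]; apply: nc.
apply: (contact_closure fh) cl; first by rewrite lexx ler01.
  by move/eqP; rewrite eq_sym oner_eq0.
by move=> _ y hy xy; apply: ne; exists y.
Qed.

Lemma contact_closure1 : closure (contact 1) `<=`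
  contact 1 `|` [set x | exists2 y, f y = (- 2^-1)%:E & enorm (x - y) = pi / 2].
Proof.
move=> x cl; apply: contrapT => /not_orP[nc ne]; apply: nc.
apply: (contact_closure fh) cl; first by rewrite lexx ler01.
  by move=> _ y fy xy; apply: ne; exists y.
by move/eqP; rewrite oner_eq0.
Qed.

(** Since xibar_t <= xi_t, both potentials lie between the two parabolas that bound xi_t from above
    and xibar_t from below. *)
Lemma contact_differentiable t x : 0 < t < 1 -> contact t x ->
  [/\ exists! k, contact_slope a b xi xibar t x k,
      contact_slope a b xi xibar t x (g t x),
      has_gradient (hl_inf t f) x (g t x)
    & has_gradient (fun y => - hl_inf (1 - t) h y)%E x (g t x)].
Proof.
move=> t01 /(contact_touches fh t01)[p xp].
have S := grad_slope fh t01 xp; have [H1 H2] := S.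
have fin y : exists r w, [/\ hl_inf t f y = r%:E, hl_inf (1 - t) h y = w%:E,
    `|r - p - dotv (g t x) (y - x)|
      <= (2^-1 * Lambda a t + 2^-1 * Lambda b (1 - t)) * enorm (x - y) ^+ 2 &
    `|- w - p - dotv (g t x) (y - x)|
      <= (2^-1 * Lambda a t + 2^-1 * Lambda b (1 - t)) * enorm (x - y) ^+ 2].
  have [r [fr _ _]] := hl_inf_bounds fge y t01.
  have [w [hw _ _]] := hl_inf_bounds hge y (onem_itv t01).
  have o := dual_pair_order fh t01 fr hw.
  have h1 := H1 _ _ fr; have h2 := H2 _ _ hw; rewrite dotvNl in h2.
  have [a0 b0] : - 2^-1 <= a /\ - 2^-1 <= b by case: fh.
  have k1 : 0 <= Lambda a t * enorm (x - y) ^+ 2.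
    by rewrite mulr_ge0 ?sqr_ge0// ltW// Lambda_gt0.
  have k2 : 0 <= Lambda b (1 - t) * enorm (x - y) ^+ 2.
    by rewrite mulr_ge0 ?sqr_ge0// ltW// Lambda_gt0// onem_itv.
  by exists r, w; split=> //; rewrite ler_norml; apply/andP; split; lra.
split.
- exists (g t x); split; first by apply/(contact_slopeP fh _ t01 xp).
  by move=> k /(contact_slopeP fh _ t01 xp); exact: grad_unique.
- by apply/(contact_slopeP fh _ t01 xp).
- split; first by apply: (@filterE _ (nbhs x) (nbhs_filter x)) => y; have [r [w [-> _ _ _]]] := fin y.
  apply: is_diff_quadratic => y; rewrite xp.1.
  by have [r [w [-> _ + _]]] := fin y; exact.
- split; first by apply: (@filterE _ (nbhs x) (nbhs_filter x)) => y; have [r [w [_ -> _ _]]] := fin y.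
  apply: is_diff_quadratic => y; rewrite xp.2.
  by have [r [w [_ -> _]]] := fin y; rewrite /= opprK; exact.
Qed.

Lemma Lambda_sum_le t : 0 < t < 1 ->
  2 * (Lambda a t + Lambda b (1 - t)) <= 4 / (t * (1 - t)).
Proof.
move=> t01; have [a0 b0] : - 2^-1 <= a /\ - 2^-1 <= b by case: fh.
have := Lambda_le a0 t01; have := Lambda_le b0 (onem_itv t01).
rewrite subKr [(1 - t) * t]mulrC; lra.
Qed.

Lemma touches_minus0 x : f x = (- 2^-1)%:E -> touches f h 0 x (- 2^-1).
Proof.
move=> fx; split; first by rewrite hl_inf0.
rewrite subr0; apply/eqP; rewrite eq_le; apply/andP; split.
  have := hl_inf_le hge x (t := 1); rewrite ltr01 lexx mulr1 opprK.
  exact.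
exact: (dual_pair_order0 fh fx).
Qed.

Lemma hl_inf1_minus x : f x = (- 2^-1)%:E -> hl_inf 1 f x = -oo%E.
Proof.
move=> fx; have xx : enorm (x - x) < pi / 2 by rewrite subrr enorm0 pihalf_gt0.
have := hl_inf_le_cost f ltr01 xx; rewrite (hl_inf_cost_ninfty _ fx)//.
  by rewrite leeNy_eq => /eqP.
by rewrite mulr1 mulrN divff// subrr.
Qed.

Lemma contact_minus_all t x : 0 <= t <= 1 -> f x = (- 2^-1)%:E -> contact t x.
Proof.
move=> /andP[t0 t1] fx.
have [->|tn0] := eqVneq t 0; first exact: touches_contact (touches_minus0 fx).
have [->|tn1] := eqVneq t 1.
  rewrite /Defs.contact/= hl_inf1_minus//; apply/eqP.
  rewrite -leeNy_eq -(hl_inf1_minus fx); apply: (dual_pair_le fh).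
  by rewrite ler01 lexx.
have t01 : 0 < t < 1 by rewrite lt_neqAle eq_sym tn0 t0 lt_neqAle tn1.
exact: touches_contact ((contact_minus fh x t01).1 fx).
Qed.

Lemma transport_spec s t x : 0 < s < 1 -> 0 <= t <= 1 -> t - s != 0 ->
  contact s x -> (0 < 1 + (2 * (t - s))%:E * hl_inf s f x)%E ->
  [/\ optimal xi xibar s t x = [set T s t x],
      contact t (T s t x),
      optimal xi xibar t s (T s t x) x,
      T s t x = x + arctanv (((t - s) / (1 + 2 * (t - s) * fine (hl_inf s f x)))
                               *: g s x)
    & ((1 - (2 * (t - s))%:E * hl_inf t f (T s t x))
         * (1 + (2 * (t - s))%:E * hl_inf s f x)
       = (cos (Num.min (enorm (x - T s t x)) (pi / 2)) ^+ 2)%:E)%E].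
Proof.
move=> s01 t01; rewrite subr_eq0 => ts /(contact_touches fh s01)[p xp].
rewrite (xi_denomE t xp) lte_fin => D.
have [r [[_ yr e yE _] o1 o2]] := transport_partner fh s01 t01 ts xp D.
split=> //; first exact: touches_contact yr.
  by rewrite xp.1.
by rewrite yr.1 -EFinM mulrC -/(cos2_trunc _ _) e.
Qed.

Lemma grad_critical s x : 0 < s < 1 ->
  f x = (- 2^-1)%:E \/ h x = (- 2^-1)%:E -> g s x = 0.
Proof. by move=> s01 [k|k]; [exact: (grad_minus fh)|exact: (grad_plus fh)]. Qed.

Lemma transport_critical s t x : 0 < s < 1 -> 0 <= t <= 1 -> contact s x ->
  g s x = 0 -> T s t x = x.
Proof.
move=> s01 t01 /(contact_touches fh s01)[p xp] g0.
by rewrite (transportE fh s01 t01 xp) g0 scaler0 arctanv0 addr0.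
Qed.

Lemma sqr_growth_quotient s t x : 0 < s < 1 -> 0 <= t <= 1 -> contact s x ->
  ((q s t x ^+ 2)%:E = (1 + (2 * (t - s))%:E * hl_inf s f x)
                        / (1 - (2 * (t - s))%:E * hl_inf t f (T s t x)))%E.
Proof.
move=> s01 t01 cx; have [p xp] := contact_touches fh s01 cx.
have /andP[s0 s1] := s01; rewrite (xi_denomE t xp).
have [D|[D c]] := transport_denom_cases fh s01 t01 xp.
  have [te|ts] := eqVneq t s.
    rewrite te (sqr_growth a b s xp) subrr mulr0 /transport eqxx xp.1.
    rewrite -EFinM -EFinB !mul0r addr0 subr0 expr0n/= mul0r addr0 expr1n.
    by rewrite inver oner_eq0 -EFinM invr1 mulr1.
  have [r [P _ _]] := transport_partner fh s01 t01 ts xp D.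
  have [E1 E0] := partner_growth xp D P; case: P => _ yr _ _ _.
  rewrite yr.1 -EFinM -EFinB inver gt_eqF// -EFinM -E1; congr (_%:E).
  by rewrite mulrAC divff ?mul1r// gt_eqF.
(* The numerator is 0, and so is the quotient whatever its denominator; the second expression
   vanishes because g = 0. *)
have [g0 Tx] : g s x = 0 /\ T s t x = x.
  have g0 : g s x = 0 by apply: grad_critical => //; case: c => -[_ k]; [left|right].
  by split=> //; exact: transport_critical.
rewrite Tx (sqr_growth a b t xp) D g0 enorm0 expr0n/= mulr0 addr0.
by rewrite mul0e.
Qed.

Lemma growth_critical_ereal s t x : 0 < s < 1 -> 0 <= t <= 1 ->
  f x = (- 2^-1)%:E \/ h x = (- 2^-1)%:E ->
  ((q s t x)%:E = 1 + (2 * (t - s))%:E * hl_inf s f x)%E.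
Proof.
move=> s01 t01 k; have g0 := grad_critical s01 k.
have [p xp] : exists p, touches f h s x p.
  case: k => k; first by exists (- (2 * (1 - s))^-1); apply/(contact_minus fh x s01).
  by exists (2 * s)^-1; apply/(contact_plus fh x s01).
by rewrite (xi_denomE t xp) (growth_critical fh s01 t01 xp g0).
Qed.

Lemma transport_locally_lipschitz0 s : 0 < s < 1 ->
  locally_elipschitz enorm (contact s `\` [set x | h x = (- 2^-1)%:E]) (T s 0).
Proof.
move=> s01; apply: (transport_locally_lipschitz fh s01); first by rewrite lexx ler01.
move=> x [/(contact_touches fh s01)[p xp] nh]; exists p => //.
have := transport_denom_cases fh s01 _ xp (t := 0); rewrite lexx ler01.
move=> /(_ isT)[//|[_ [[te _]|[_ k]]]]; last by case: (nh k).
by move/esym/eqP: te; rewrite oner_eq0.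
Qed.

Lemma transport_locally_lipschitz1 s : 0 < s < 1 ->
  locally_elipschitz enorm (contact s `\` [set x | f x = (- 2^-1)%:E]) (T s 1).
Proof.
move=> s01; apply: (transport_locally_lipschitz fh s01); first by rewrite lexx ler01.
move=> x [/(contact_touches fh s01)[p xp] nf]; exists p => //.
have := transport_denom_cases fh s01 _ xp (t := 1); rewrite lexx ler01.
move=> /(_ isT)[//|[_ [[_ k]|[te _]]]]; first by case: (nf k).
by move/eqP: te; rewrite oner_eq0.
Qed.

Lemma growth_positive s t x : 0 < s < 1 -> contact s x ->
  0 < t < 1 \/ (t = 0 /\ ~ h x = (- 2^-1)%:E) \/ (t = 1 /\ ~ f x = (- 2^-1)%:E) ->
  0 < q s t x.
Proof.
move=> s01 /(contact_touches fh s01)[p xp] H.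
have t01 : 0 <= t <= 1.
  case: H => [/andP[? ?]|[[-> _]|[-> _]]]; first by rewrite !ltW.
    by rewrite lexx ler01.
  by rewrite lexx ler01.
apply: (growth_gt0 _ _ xp); have [//|[_ k]] := transport_denom_cases fh s01 t01 xp.
exfalso; case: H => [/andP[t0 t1]|[[te nh]|[te nf]]].
- by case: k => -[te _]; [move: t1|move: t0]; rewrite te ltxx.
- by case: k => -[te' k] //; move: te'; rewrite te => /esym/eqP; rewrite oner_eq0.
- by case: k => -[te' k] //; move: te'; rewrite te => /eqP; rewrite oner_eq0.
Qed.

End Conclusions.

(** * From the hypotheses to a dual pair, and assembly *)

Lemma dual_pair_of_order {R : realType} {d : nat} (a abar : R)
    (xi0 xibar1 : 'rV[R]_d -> \bar R) :
  - 2^-1 <= a -> - 2^-1 <= abar ->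
  (forall x, (a%:E <= xi0 x)%E) -> (forall x, (xibar1 x <= (- abar)%:E)%E) ->
  lower_semicontinuous xi0 -> upper_semicontinuous xibar1 ->
  (forall x, (xibar1 x <= hl_inf 1 xi0 x)%E) ->
  dual_pair a abar xi0 (fun x => - xibar1 x)%E.
Proof.
move=> ha hb xa xb lsc usc le; split=> //.
- by split=> // x; rewrite leeNr -EFinN.
- move=> x c; rewrite lteNr -EFinN => /usc[U Ux UP].
  by exists U => // y /UP; rewrite lteNr -EFinN.
move=> x z v r hx fz.
have xge y : ((- 2^-1)%:E <= xi0 y)%E by apply: le_trans (xa y); rewrite lee_fin.
have t01 : 0 < (1 : R) <= 1 by rewrite ltr01 lexx.
have xv : xibar1 x = (- v)%:E by rewrite -[xibar1 x]oppeK hx.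
have r1 : - 2^-1 <= r by have := xge z; rewrite fz lee_fin.
(* P_1 xi_0 (x) is finite: at most 1/2, and at least the real number xibar_1(x). *)
have := hl_inf_le xge x t01; have := le x; rewrite xv.
case E : (hl_inf 1 xi0 x) => [p||] //; rewrite !lee_fin => vp _.
have := hl_inf_dual xge t01 E fz; rewrite mulr1 => H; apply: le_trans H _.
by rewrite ler_wpM2r//; lra.
Qed.

Theorem theorem4p3 (R : realType) (d : nat) (a abar : R)
    (xi0 xibar1 : 'rV[R]_d -> \bar R)
    (ha : - 2^-1 <= a) (habar : - 2^-1 <= abar)
    (hxi0 : forall x, (a%:E <= xi0 x)%E)
    (hxibar1 : forall x, (xibar1 x <= (- abar)%:E)%E)
    (xi0_lsc : lower_semicontinuous xi0)
    (xibar1_usc : upper_semicontinuous xibar1)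
    (hle : forall x, (xibar1 x <= hl_inf 1 xi0 x)%E) :
  let xi := fun t : R => hl_inf t xi0 in
  let xibar := fun t : R => hl_sup (1 - t) xibar1 in
  let Xi := contact xi xibar in
  let Xim := [set x | xi0 x = (- 2^-1)%:E] in
  let Xip := [set x | xibar1 x = (2^-1)%:E] in
  let g := contact_grad a abar xi xibar in
  let Xi0 := critical a abar xi xibar in
  let M := optimal xi xibar in
  let T := transport xi xibar in
  let q := growth a abar xi xibar in
  (forall t, 0 <= t <= 1 -> forall x, (xibar t x <= xi t x)%E) /\
  (forall t, 0 < t < 1 -> closed (Xi t)) /\
  closure (Xi 0) `<=`
    Xi 0 `|` [set x | exists2 y, Xip y & enorm (x - y) = pi / 2] /\
  closure (Xi 1) `<=`
    Xi 1 `|` [set x | exists2 y, Xim y & enorm (x - y) = pi / 2] /\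
  (forall t, 0 < t < 1 -> forall x, Xi t x ->
     [/\ exists! p, contact_slope a abar xi xibar t x p,
         contact_slope a abar xi xibar t x (g t x),
         has_gradient (xi t) x (g t x)
       & has_gradient (xibar t) x (g t x)]) /\
  (forall t, 0 < t < 1 ->
     [/\ exists B, forall x, Xi t x -> enorm (g t x) <= B,
         exists2 C, elipschitz enorm C (Xi t) (g t)
                  & C <= 2 * (Lambda a t + Lambda abar (1 - t))
       & 2 * (Lambda a t + Lambda abar (1 - t)) <= 4 / (t * (1 - t))]) /\
  (forall t, 0 < t < 1 ->
     [/\ Xim = [set x | Xi t x /\ xi t x = (-1 / (2 * (1 - t)))%:E],
         Xip = [set x | Xi t x /\ xibar t x = (1 / (2 * t))%:E]
       & Xim `|` Xip `<=` Xi0 t]) /\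
  (forall t, 0 <= t <= 1 -> Xim `|` Xip `<=` Xi t) /\
  (forall s t, 0 < s < 1 -> 0 <= t <= 1 -> t - s != 0 ->
     forall x, Xi s x -> (0 < 1 + (2 * (t - s))%:E * xi s x)%E ->
     [/\ M s t x = [set T s t x],
         Xi t (T s t x),
         M t s (T s t x) x,
         T s t x = x + arctanv (((t - s) / (1 + 2 * (t - s) * fine (xi s x)))
                                  *: g s x)
       & ((1 - (2 * (t - s))%:E * xi t (T s t x))
            * (1 + (2 * (t - s))%:E * xi s x)
          = (cos (Num.min (enorm (x - T s t x)) (pi / 2)) ^+ 2)%:E)%E]) /\
  (forall s t, 0 < s < 1 -> 0 <= t <= 1 ->
     forall x, Xi0 s x -> T s t x = x) /\
  (forall s, 0 < s < 1 -> forall x, Xi s x ->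
     analytic_on `[0, 1] (fun t => T s t x)) /\
  (forall s t, 0 < s < 1 -> 0 < t < 1 ->
     exists C, elipschitz enorm C (Xi s) (T s t)) /\
  (forall s, 0 < s < 1 ->
     locally_elipschitz enorm (Xi s `\` Xip) (T s 0) /\
     locally_elipschitz enorm (Xi s `\` Xim) (T s 1)) /\
  (forall s t, 0 < s < 1 -> 0 <= t <= 1 -> forall x, Xi s x ->
     [/\ 0 <= q s t x,
         ((q s t x ^+ 2)%:E = (1 + (2 * (t - s))%:E * xi s x)
                              / (1 - (2 * (t - s))%:E * xi t (T s t x)))%E
       & q s t x ^+ 2 = (1 + 2 * (t - s) * fine (xi s x)) ^+ 2
                        + (t - s) ^+ 2 * enorm (g s x) ^+ 2]) /\
  (forall s, 0 < s < 1 -> forall x, Xi s x ->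
     analytic_on `[0, 1] (fun t => q s t x : R^o)) /\
  (forall s t, 0 < s < 1 -> 0 <= t <= 1 ->
     (exists B, forall x, Xi s x -> `|q s t x| <= B) /\
     (exists C, elipschitz Num.norm C (Xi s) (q s t))) /\
  (forall s t, 0 < s < 1 -> forall x, Xi s x ->
     0 < t < 1 \/ (t = 0 /\ ~ Xip x) \/ (t = 1 /\ ~ Xim x) -> 0 < q s t x) /\
  (forall s t, 0 < s < 1 -> 0 <= t <= 1 -> forall x, Xim x \/ Xip x ->
     ((q s t x)%:E = 1 + (2 * (t - s))%:E * xi s x)%E) /\
  (forall t0 t1 t2, 0 < t0 < 1 -> 0 < t1 < 1 -> 0 <= t2 <= 1 ->
     (forall s t, s \in [:: t0; t1] -> t \in [:: t0; t1] ->
        exists C, elipschitz enorm C (Xi s) (T s t)) /\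
     (forall x, Xi t0 x ->
        T t1 t2 (T t0 t1 x) = T t0 t2 x /\
        q t1 t2 (T t0 t1 x) * q t0 t1 x = q t0 t2 x)).
Proof.
move=> xi xibar Xi Xim Xip g Xi0 M T q.
(* With this [h], [hl_sup (1 - t) xibar1] unfolds to [- hl_inf (1 - t) h], so the results on dual
   pairs apply by conversion. *)
pose h := (fun x => - xibar1 x)%E.
have fh : dual_pair a abar xi0 h by exact: dual_pair_of_order.
have XipE x : Xip x <-> h x = (- 2^-1)%:E.
  rewrite /Xip /h /=; split=> [->//|e].
  by rewrite -[xibar1 x]oppeK e -EFinN opprK.
have XipS : Xip = [set x | h x = (- 2^-1)%:E] by apply/seteqP; split=> x /XipE.
have crit x : Xim x \/ Xip x -> xi0 x = (- 2^-1)%:E \/ h x = (- 2^-1)%:E.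
  by case=> [|/XipE]; [left|right].
have sub t : 0 <= t <= 1 -> Xim `|` Xip `<=` Xi t.
  move=> t01 x /crit[k|k]; first exact: (contact_minus_all fh t01 k).
  have t01' : 0 <= 1 - t <= 1 by case/andP: t01 => ? ?; apply/andP; lra.
  have := contact_minus_all (dual_pair_sym fh) t01' k.
  rewrite /contact/= subKr => e.
  have : (- hl_inf (1 - t) h x = hl_inf t xi0 x)%E by rewrite -e oppeK.
  exact.
split; first by move=> t t01 x; exact: (dual_pair_le fh x t01).
split; first by move=> t t01; exact: (contact_closed fh t01).
split; first by rewrite XipS; exact: (contact_closure0 fh).
split; first exact: (contact_closure1 fh).
split; first by move=> t t01 x; exact: (contact_differentiable fh t01).
split.
  move=> t t01; split; last exact: (Lambda_sum_le fh t01).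
    have [B HB] := two_sided_slope_bounded fh t01; exists B => x.
    move=> /(contact_touches fh t01)[p xp].
    exact: (HB x p _ xp (grad_slope fh t01 xp)).
  exists (2 * (Lambda a t + Lambda abar (1 - t))) => // x y.
  move=> /(contact_touches fh t01)[p xp] /(contact_touches fh t01)[r yr].
  exact: (grad_lipschitz fh t01 xp yr).
split.
  move=> t t01; have t01' : 0 <= t <= 1 by case/andP: t01 => /ltW-> /ltW->.
  split.
  - apply/seteqP; split=> [x k|x [cx e]].
      split; first by apply: (sub _ t01'); left.
      have [fp _] := (contact_minus fh x t01).1 k.
      by rewrite mulN1r; exact: fp.
    apply/(contact_minus fh x t01).
    have [p xp] := contact_touches fh t01 cx.
    suff <- : p = - (2 * (1 - t))^-1 by [].
    by apply: EFin_inj; rewrite -xp.1 -mulN1r; exact: e.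
  - apply/seteqP; split=> [x k|x [cx e]].
      split; first by apply: (sub _ t01'); right.
      have [_ hp] := (contact_plus fh x t01).1 ((XipE x).1 k).
      by rewrite mul1r -[(2 * t)^-1]opprK EFinN; congr (- _)%E; exact: hp.
    apply/XipE/(contact_plus fh x t01).
    have [p xp] := contact_touches fh t01 cx.
    suff <- : p = (2 * t)^-1 by [].
    apply: EFin_inj; rewrite -[(2 * t)^-1]mul1r -e -[p]opprK EFinN.
    by rewrite -xp.2.
  move=> x k; split; first exact: (sub _ t01').
  exact: (grad_critical fh t01 (crit _ k)).
split; first exact: sub.
split; first by move=> s t s01 t01 ts x; exact: (transport_spec fh s01 t01 ts).
split; first by move=> s t s01 t01 x [cx gx]; exact: (transport_critical fh s01 t01 cx gx).
split; first by move=> s s01 x; exact: (transport_analytic fh s01).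
split; first by move=> s t s01 t01; exact: (transport_lipschitz fh s01 t01).
split.
  move=> s s01; split; last exact: (transport_locally_lipschitz1 fh s01).
  by rewrite XipS; exact: (transport_locally_lipschitz0 fh s01).
split.
  move=> s t s01 t01 x cx; split; first exact: sqrtr_ge0.
    exact: (sqr_growth_quotient fh s01 t01 cx).
  have [p xp] := contact_touches fh s01 cx.
  by have := sqr_growth a abar t xp; rewrite /xi xp.1.
split; first by move=> s s01 x; exact: (growth_analytic fh s01).
split.
  move=> s t s01 t01; split; first exact: (growth_bounded fh s01 t01).
  exact: (growth_lipschitz fh s01 t01).
split.
  move=> s t s01 x cx H; apply: (growth_positive fh s01 cx).
  by case: H => [?|[[? nx]|?]]; [left|right; left; split=> // /XipE|right; right].
split.
  by move=> s t s01 t01 x /crit; exact: (growth_critical_ereal fh s01 t01).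
move=> t0 t1 t2 t001 t101 t201; split; last first.
  by move=> x; exact: (transport_comp fh t001 t101 t201).
have itv s : s \in [:: t0; t1] -> 0 < s < 1.
  by rewrite !inE => /orP[]/eqP->.
by move=> s t /itv s01 /itv t01; exact: (transport_lipschitz fh s01 t01).
Qed.
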